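(* Let $\nu>-\frac12$ and let $\mathcal{S}$ be the space of functions defined in the context. For every $f\in\mathcal{S}$ such that $\|f\|=1$, $x^2f\in L^2(\mathbb{R}^+,x^{2\nu+1}\,dx)$ and $\Delta_\nu f\in\mathcal{S}$, the functional $$J[f]=\left(\int_{\mathbb{R}^+}x^2|f(x)|^2x^{2\nu+1}\,dx\right)\left(\int_{\mathbb{R}^+}y^2|\mathcal{F}_\nu f(y)|^2y^{2\nu+1}\,dy\right)$$ satisfies $J[f]\ge(\nu+1)^2$, and this lower bound is attained by the ($L^2$-normalized) dilations of the Gaussian $e^{-x^2/2}$.
   Context: $\mathbb{R}^+=(0,\infty)$; $\|\cdot\|$ is the norm of $L^2(\mathbb{R}^+,x^{2\nu+1}\,dx)$. $\Delta_\nu=\frac{d^2}{dx^2}+\frac{2\nu+1}{x}\frac{d}{dx}$. $J_\nu(x)=\sum_{n=0}^\infty \frac{(-1)^n}{n!\,\Gamma(n+\nu+1)}\left(\frac{x}{2}\right)^{2n+\nu}$ is the Bessel function of the first kind and $\varphi_\nu(x)=x^{-\nu}J_\nu(x)$. The Fourier--Bessel transform of order $\nu$ is $\mathcal{F}_\nu f(y)=\int_{\mathbb{R}^+}\varphi_\nu(xy)f(x)x^{2\nu+1}\,dx$ for $y\in\mathbb{R}^+$. Dilations are given by $f\mapsto\alpha^{\nu+1}f(\alpha x)$, $\alpha>0$. Let $k=2(\nu+2)$ if $\nu$ is an integer and $k=2\lceil\nu+1\rceil$ if $\nu$ is not an integer. The space $\mathcal{S}$ consists of all $f\in C^{2k}(\mathbb{R}^+)\cap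 L^1(\mathbb{R}^+,x^{2\nu+1}\,dx)\cap L^2(\mathbb{R}^+,x^{2\nu+1}\,dx)$ such that $\Delta_\nu f,\dots,\Delta_\nu^k f\in L^1(\mathbb{R}^+,x^{2\nu+1}\,dx)$ and $\frac{d}{dx}f,\frac{d}{dx}\Delta_\nu f,\dots,\frac{d}{dx}\Delta_\nu^{k-1}f\in L^1(\mathbb{R}^+,x^{2\nu+1}\,dx)$, and such that $f$ and its derivatives (up to order $2k$) are bounded near $0$. *)

(* Defs.v *)
From mathcomp Require Import all_boot all_order all_algebra.
From mathcomp Require Import all_classical all_reals all_analysis.
From mathcomp Require Import complex.

Set Implicit Arguments.
Unset Strict Implicit.
Unset Printing Implicit Defensive.

Import Order.TTheory GRing.Theory Num.Theory numFieldNormedType.Exports.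

Local Open Scope classical_set_scope.
Local Open Scope ring_scope.

(* A function on R^+ = (0, +oo) is a total function R -> R[i] of which only the
   values on R^+ matter.  The library has no derivative or integral of
   R[i]-valued functions of a real variable: both are taken componentwise.
   Normc.normc is the R-valued modulus on R[i]. *)

Section FourierBessel.
Variable R : realType.
Implicit Types (nu alpha : R) (f : R -> R[i]).

Definition Rpos : set R := `]0, +oo[.

Definition re f : R -> R := fun x => complex.Re (f x).
Definition im f : R -> R := fun x => complex.Im (f x).

Definition cderive1n (n : nat) f : R -> R[i] :=
  fun x => (derive1n n (re f) x +i* derive1n n (im f) x)%C.

(* Derivatives at a point of R^+ do not depend on the values of g outside R^+. *)
Definition realCn (n : nat) (g : R -> R) : Prop :=
  (forall j (x : R), (j < n)%N -> 0 < x -> derivable (derive1n j g) x 1) /\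
  (forall x : R, 0 < x -> {for x, continuous (derive1n n g)}).

Definition Cn (n : nat) f : Prop := realCn n (re f) /\ realCn n (im f).

(* The integral of g over R^+ against x ^ (2 nu + 1) dx. *)
Definition wint nu (g : R -> R) : \bar R :=
  (\int[lebesgue_measure]_(x in Rpos) (g x * x `^ (2 * nu + 1))%:E)%E.

Definition Lp nu (p : nat) f : Prop :=
  [/\ measurable_fun Rpos (re f), measurable_fun Rpos (im f)
    & (wint nu (fun x => Normc.normc (f x) ^+ p)%R < +oo)%E].

Definition L2norm nu f : R :=
  Num.sqrt (fine (wint nu (fun x => Normc.normc (f x) ^+ 2))).

Definition Delta nu f : R -> R[i] :=
  fun x => cderive1n 2 f x + ((2 * nu + 1) / x)%:C%C * cderive1n 1 f x.

Definition order_k nu : nat :=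
  if nu \is a Num.int then (2 * absz (Num.floor nu + 2)%R)%N
  else (2 * absz (Num.ceil (nu + 1)%R))%N.

Definition bounded_near0 f : Prop :=
  exists M : R, \forall x \near 0^'+, Normc.normc (f x) <= M.

Definition spaceS nu f : Prop :=
  let k := order_k nu in
  [/\ Cn (2 * k) f,
      Lp nu 1 f /\ Lp nu 2 f,
      (forall j, (1 <= j <= k)%N -> Lp nu 1 (iter j (Delta nu) f)),
      (forall j, (j < k)%N -> Lp nu 1 (cderive1n 1 (iter j (Delta nu) f)))
    & (forall j, (j <= 2 * k)%N -> bounded_near0 (cderive1n j f))].

(* Euler's integral, meaningful for s > 0; here it is only applied to
   s = n + nu + 1 > 0. *)
Definition Gamma (s : R) : R :=
  \int[lebesgue_measure]_(t in Rpos) (t `^ (s - 1) * expR (- t)).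

Definition besselJ nu (x : R) : R :=
  limn (series (fun n : nat =>
    (-1) ^+ n / (n`!%:R * Gamma (n%:R + nu + 1))
      * (x / 2) `^ (2 * n%:R + nu))).

Definition phi nu (x : R) : R := x `^ (- nu) * besselJ nu x.

Definition FourierBessel nu f : R -> R[i] := fun y =>
  ((\int[lebesgue_measure]_(x in Rpos)
      (phi nu (x * y) * re f x * x `^ (2 * nu + 1)))%R
   +i* (\int[lebesgue_measure]_(x in Rpos)
      (phi nu (x * y) * im f x * x `^ (2 * nu + 1)))%R)%C.

Definition Jfun nu f : \bar R :=
  (wint nu (fun x => x ^+ 2 * Normc.normc (f x) ^+ 2)%R
   * wint nu (fun y => y ^+ 2 * Normc.normc (FourierBessel nu f y) ^+ 2)%R)%E.

Definition admissible nu f : Prop :=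
  [/\ spaceS nu f, L2norm nu f = 1,
      Lp nu 2 (fun x => (x ^+ 2)%:C%C * f x)
    & spaceS nu (Delta nu f)].

Definition dilation nu alpha f : R -> R[i] :=
  fun x => (alpha `^ (nu + 1))%:C%C * f (alpha * x).

Definition gaussian : R -> R[i] := fun x => (expR (- (x ^+ 2 / 2)))%:C%C.

Definition normalize nu f : R -> R[i] :=
  fun x => ((L2norm nu f)^-1)%:C%C * f x.

End FourierBessel.

Arguments gaussian {R}.

(* Main.v *)
(* The Laguerre functions [l_n(x) = L_n(s x^2) exp(- s x^2 / 2)], [L_n] the Laguerre
   polynomial of parameter [nu], diagonalise the harmonic oscillator
   [- Delta_nu + s^2 x^2], with eigenvalues [2 s (2 n + nu + 1) >= 2 s (nu + 1)], and
   the transform of order [nu] maps [l_n] to [(-1)^n] times its dilate.  Expanding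
   [0 <= int x^2 |f - h|^2] and [0 <= int y^2 |F f - F h|^2] for the partial Laguerre
   sum [h] of [f], and moving [F] off [f] by Fubini, one gets, for every [s > 0],
     [2 (nu + 1) |f|^2 <= s int x^2 |f|^2 + s^-1 int y^2 |F f|^2],
   once the Laguerre functions are known to be complete; for continuous [f] this
   follows from Bernstein polynomials in [exp(- s x^2 / 4)].  No integration by parts
   on [f], no inversion formula and no Plancherel formula is needed.  Optimising
   over [s] gives the product inequality. *)
From HB Require Import structures.
Require Import Defs.
From mathcomp Require Import all_boot all_order all_algebra.
From mathcomp Require Import all_classical all_reals all_analysis.
From mathcomp Require Import measurable_realfun complex.
From mathcomp Require Import ring lra.

Set Implicit Arguments.
Unset Strict Implicit.
Unset Printing Implicit Defensive.

Import Order.TTheory GRing.Theory Num.Theory numFieldNormedType.Exports.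

Local Open Scope classical_set_scope.
Local Open Scope ring_scope.

(** * Laguerre polynomials *)

(** All computations take place on functions [q(z) exp (- z)], [z = s x ^+ 2 / 2], [q] a polynomial.
    There [- Delta_nu] is [2 s] times [lapp], [s ^+ 2 x ^+ 2] is [2 s] times multiplication by ['X],
    the transform is [lapT], and the rules of the transform become identities between polynomials.
    The obstacle is the Fourier side of [f]: nothing tells beforehand that [int y^2 |F f|^2] is
    finite. So [F f] enters linearly only against Gaussians, where Fubini applies because [f] is
    integrable and the kernel is bounded by its value at 0 (an energy estimate for Bessel's
    equation); it enters quadratically only once that integral is known to be finite, and the
    infinite case is treated apart. The same exchange shows that [lapp] is symmetric, whence the
    orthogonality of the Laguerre functions. The partial sum at parameter [s] is transformed into
    the one at [s^-1] with alternating signs. The same coefficients thus serve in both squares, and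
    their sum is governed by the eigenvalues of the oscillator. *)

Section Laguerre.
Variables (R : realFieldType) (nu : R).
Implicit Types (p q : {poly R}) (k n : nat).

(* [lagp k] is [k`!] times the Laguerre polynomial of parameter [nu]. *)
Fixpoint lagp k : {poly R} :=
  if k is k'.+1 then
    'X * (lagp k')^`() - 'X * lagp k' + (nu + 1 + k'%:R)%:P * lagp k'
  else 1.

Lemma lagpS k : lagp k.+1 =
  'X * (lagp k)^`() - 'X * lagp k + (nu + 1 + k%:R)%:P * lagp k.
Proof. by []. Qed.

Lemma lagp0 : lagp 0 = 1. Proof. by []. Qed.

Opaque lagp.

(** The ladder relation [x L_n' = n L_n - (n + nu) L_(n-1)], scaled by [n!]. Eliminating the
    derivative between it and the recursion [lagpS] gives the three-term recurrence [lagp_rec]. *)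
Lemma lagp_deriv k :
  'X * (lagp k.+1)^`() =
  k.+1%:R%:P * lagp k.+1 - (k.+1%:R * (k.+1%:R + nu))%:P * lagp k.
Proof.
elim: k => [|k IH].
  rewrite !lagpS !lagp0 !poly.derivE !(rmorphM, rmorphD, rmorph1, rmorph0) /=.
  ring.
rewrite (lagpS k.+1); move: IH (lagpS k).
move: (lagp k.+1) (lagp k) => a b IH E1.
(* The goal contains a second derivative of [a]; the differentiated induction hypothesis expresses
   it through first derivatives. *)
have IH' := congr1 (fun p => p^`()) IH.
rewrite !poly.derivE in IH'; rewrite !poly.derivE.
set a' := a^`() in IH IH' *; set a'' := a'^`() in IH' *.
set b' := b^`() in E1 IH' *.
move: IH IH' E1.
rewrite -[k.+2%:R]natr1 -[k.+1%:R]natr1 !(rmorphD, rmorphM, rmorph1) /= => IH IH' E1.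
set kk := k%:R%:P in IH IH' E1 *; set nn := nu%:P in IH IH' E1 *.
have Xa'' : 'X * a'' = (kk + 1) * a' - (kk + 1) * (kk + 1 + nn) * b' - a'.
  have -> : 'X * a'' = (1 * a' + 'X * a'') - a' by ring.
  rewrite IH'; ring.
have Xb' : 'X * b' = a + 'X * b - (nn + 1 + kk) * b by rewrite E1; ring.
transitivity ('X * a' + 'X * ('X * a'') - 'X * a - 'X * ('X * a') + (nn + 1 + (kk + 1)) * ('X * a')).
  by ring.
rewrite Xa''.
have -> : 'X * ((kk + 1) * a' - (kk + 1) * (kk + 1 + nn) * b' - a') =
   (kk + 1) * ('X * a') - (kk + 1) * (kk + 1 + nn) * ('X * b') - 'X * a' by ring.
rewrite IH Xb'; ring.
Qed.

Lemma lagp_rec k :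
  lagp k.+2 = ((2 * k.+1%:R + nu + 1)%:P - 'X) * lagp k.+1
    - (k.+1%:R * (k.+1%:R + nu))%:P * lagp k.
Proof.
by rewrite lagpS lagp_deriv !(rmorphD, rmorphM, rmorph1, rmorphMn) /=; ring.
Qed.

(* [- Delta / 2] acts on [q(z) exp(- z)], [z = x ^+ 2 / 2], through [q |-> lapp q]. *)
Definition lapp q : {poly R} :=
  - ('X * q^`()^`() + ((nu + 1)%:P - 2%:P * 'X) * q^`() + ('X - (nu + 1)%:P) * q).

(** [D] is [z d/dz] acting on [r(z) exp (- z)], and [Delta_nu = (2 / z) D (D + nu)] for
    [z = x ^+ 2 / 2]. In this factored form [lapp_lagp] follows from first-order relations alone. *)
Lemma mulX_lapp q (D := fun r : {poly R} => 'X * r^`() - 'X * r) :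
  'X * lapp q = - D (D q + nu%:P * q).
Proof. by rewrite /lapp /D !poly.derivE !(rmorphD, rmorph1); ring. Qed.

(** As [lapT] sends ['X^k] to [lagp k], this is [lapT_mulX] on monomials. *)
Lemma lapp_lagp k : lapp (lagp k) = lagp k.+1.
Proof.
have X0 : ('X : {poly R}) != 0 by rewrite polyX_eq0.
apply: (mulfI X0); rewrite mulX_lapp /=.
have Dp j : 'X * (lagp j)^`() - 'X * lagp j = lagp j.+1 - (nu + 1 + j%:R)%:P * lagp j.
  by rewrite lagpS addrK.
have -> : 'X * (lagp k)^`() - 'X * lagp k + nu%:P * lagp k
   = lagp k.+1 - k.+1%:R%:P * lagp k.
  by rewrite Dp -[k.+1%:R]natr1 !(rmorphD, rmorph1); ring.
move: (Dp k) (Dp k.+1) (lagp_rec k) => {Dp}.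
move: (lagp k) (lagp k.+1) (lagp k.+2) => b a c Db Da Dc.
rewrite !poly.derivE.
transitivity (- ('X * a^`() - 'X * a) + k.+1%:R%:P * ('X * b^`() - 'X * b)).
  by ring.
by rewrite Da Db Dc -![k.+1%:R]natr1 !(rmorphD, rmorphM, rmorph1); ring.
Qed.

(* The transform of order [nu] of [q(z) exp(- z)] is [(lapT q)(w) exp(- w)] up to a
   constant, with [z = s x ^+ 2 / 2] and [w = y ^+ 2 / (2 s)]; see [FB_gq]. *)
Definition lapT q : {poly R} := \sum_(i < size q) q`_i *: lagp i.

Lemma lapT_widen n q : (size q <= n)%N -> lapT q = \sum_(i < n) q`_i *: lagp i.
Proof.
move=> le_n; rewrite /lapT (big_ord_widen n (fun i => q`_i *: lagp i) le_n).
rewrite big_mkcond /=; apply: eq_bigr => i _; case: ltnP => // h.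
by rewrite nth_default // scale0r.
Qed.

Lemma lapT_linear a p q : lapT (a *: p + q) = a *: lapT p + lapT q.
Proof.
pose n := maxn (size p) (size q).
have lp : (size p <= n)%N by rewrite leq_maxl.
have lq : (size q <= n)%N by rewrite leq_maxr.
have lpq : (size (a *: p + q)%R <= n)%N.
  apply: (leq_trans (size_polyD _ _)); rewrite geq_max lq andbT.
  exact: leq_trans (size_scale_leq _ _) lp.
rewrite (lapT_widen lp) (lapT_widen lq) (lapT_widen lpq) scaler_sumr -big_split /=.
by apply: eq_bigr => i _; rewrite coefD coefZ scalerDl scalerA.
Qed.

HB.instance Definition _ :=
  GRing.isLinear.Build R {poly R} {poly R} _ lapT lapT_linear.

Lemma lapT_Xn k : lapT 'X^k = lagp k.
Proof.
rewrite (@lapT_widen k.+1) ?size_polyXn // big_ord_recr /= big1 => [|i _].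
  by rewrite coefXn eqxx scale1r add0r.
by rewrite coefXn (ltn_eqF (ltn_ord i)) scale0r.
Qed.

Lemma lapp_linear a p q : lapp (a *: p + q) = a *: lapp p + lapp q.
Proof. by rewrite /lapp -!mul_polyC !poly.derivE; ring. Qed.

HB.instance Definition _ :=
  GRing.isLinear.Build R {poly R} {poly R} _ lapp lapp_linear.

Lemma lapTZ a q : lapT (a *: q) = a *: lapT q. Proof. exact: linearZ. Qed.
Lemma lapTB p q : lapT (p - q) = lapT p - lapT q. Proof. exact: linearB. Qed.
Lemma lappZ a q : lapp (a *: q) = a *: lapp q. Proof. exact: linearZ. Qed.
Lemma lapT_sum n (F : 'I_n -> {poly R}) : lapT (\sum_i F i) = \sum_i lapT (F i).
Proof. exact: raddf_sum. Qed.
Lemma lapp_sum n (F : 'I_n -> {poly R}) : lapp (\sum_i F i) = \sum_i lapp (F i).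
Proof. exact: raddf_sum. Qed.
Lemma lappE q : lapp q = - ('X * q^`()^`() + ((nu + 1)%:P - 2%:P * 'X) * q^`()
  + ('X - (nu + 1)%:P) * q).
Proof. by []. Qed.

Opaque lapT lapp.

(** With [lapT_lapp]: the transform exchanges multiplication by the squared variable with
    [- Delta_nu]. The second rule amounts, on monomials, to the three-term recurrence. *)
Lemma lapT_mulX q : lapT ('X * q) = lapp (lapT q).
Proof.
rewrite -[q]coefK poly_def mulr_sumr !lapT_sum lapp_sum; apply: eq_bigr => i _.
by rewrite -scalerAr !(lapTZ, lappZ) -exprS !lapT_Xn lapp_lagp.
Qed.

Lemma lapT_lapp q : lapT (lapp q) = 'X * lapT q.
Proof.
rewrite -[q]coefK poly_def lapp_sum !lapT_sum mulr_sumr; apply: eq_bigr => i _.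
rewrite !(lapTZ, lappZ) -scalerAr; congr (_ *: _); rewrite lapT_Xn.
case: (val i) => [|k].
  rewrite expr0 lappE !poly.derivE.
  have -> : - ('X * 0 + ((nu + 1)%:P - 2%:P * 'X) * 0 + ('X - (nu + 1)%:P) * 1) =
     (nu + 1) *: 'X^0 - 'X^1 :> {poly R}.
    by rewrite -mul_polyC expr0 expr1; ring.
  rewrite lapTB lapTZ !lapT_Xn lagpS lagp0 !poly.derivE -mul_polyC.
  by rewrite !(rmorphD, rmorph1, rmorph0); ring.
have -> : lapp 'X^(k.+1) = (2 * k.+1%:R + nu + 1) *: 'X^(k.+1) - 'X^(k.+2)
    - (k.+1%:R * (k.+1%:R + nu)) *: 'X^k.
  have X1 : ('X^(k.+1))^`() = k.+1%:R%:P * 'X^k :> {poly R}.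
    by rewrite derivXn /= -mulr_natl polyC_natr.
  have X2 : 'X * ('X^k)^`() = k%:R%:P * 'X^k :> {poly R}.
    case: (k) => [|j]; first by rewrite expr0 derivC mulr0 polyC0 mul0r.
    by rewrite derivXn /= mulrnAr -exprS -mulr_natl polyC_natr.
  rewrite lappE X1 derivM derivC mul0r add0r.
  transitivity (- (k.+1%:R%:P * ('X * ('X^k)^`()) +
      ((nu + 1)%:P - 2%:P * 'X) * (k.+1%:R%:P * 'X^k) +
      ('X - (nu + 1)%:P) * 'X^(k.+1))); first by ring.
  rewrite X2 -!mul_polyC !exprS -![_.+1%:R]natr1 !(rmorphD, rmorphM, rmorph1) /=.
  ring.
rewrite !(lapTB, lapTZ) !lapT_Xn lagp_rec -!mul_polyC; ring.
Qed.

(* The polynomial part of the Laguerre functions [lag k (z) * exp (- z)]. *)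
Definition lag k : {poly R} := lagp k \Po (2%:P * 'X).

Lemma lag_rec k :
  lag k.+2 = (2 * k.+1%:R + nu + 1)%:P * lag k.+1 - 2%:P * 'X * lag k.+1
    - (k.+1%:R * (k.+1%:R + nu))%:P * lag k.
Proof.
rewrite /lag lagp_rec comp_polyB !comp_polyM comp_polyB comp_polyX !comp_polyC.
ring.
Qed.

(** Equating the two expressions of [lagp k.+1] in [lapp_lagp] and [lagpS] gives Laguerre's equation
    [x L'' + (nu + 1 - x) L' + k L = 0]; the substitution of [2 z] for [x] turns it into an
    eigenvalue relation. *)
Lemma lag_eigen k : lapp (lag k) + 'X * lag k = (2 * k%:R + nu + 1)%:P * lag k.
Proof.
have ode : 'X * (lagp k)^`()^`() + ((nu + 1)%:P - 'X) * (lagp k)^`()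
    + k%:R%:P * lagp k = 0.
  have := lapp_lagp k; rewrite lagpS lappE => E.
  have : forall x y : {poly R}, x = y -> y - x = 0 by move=> x y ->; rewrite subrr.
  move/(_ _ _ E) => <-; rewrite !(rmorphD, rmorph1); ring.
have := congr1 (fun p => p \Po (2%:P * 'X)) ode.
rewrite !(comp_polyB, comp_polyD, comp_polyM, comp_polyX, comp_polyC) polyC0.
rewrite lappE /lag !deriv_comp !derivM !deriv_comp !poly.derivE.
move: ((lagp k)^`()^`() \Po _) ((lagp k)^`() \Po _) (lagp k \Po _) => a c b E.
have aux (x y z : {poly R}) : x = 0 -> y - z = -2%:P * x -> y = z.
  by move=> -> /eqP; rewrite mulr0 subr_eq0 => /eqP.
by apply: (aux _ _ _ E); rewrite !(rmorphD, rmorphM, rmorph1, rmorph0); ring.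
Qed.

(** [lapp - 'X] anticommutes with [lapT], which exchanges its two terms. By [step] it leads from
    [lag j.+1] to [lag j.+2], up to a multiple of [lag j], which has the same sign as [lag j.+2]. *)
Lemma lapT_lag k : lapT (lag k) = (-1) ^+ k *: lag k.
Proof.
suff : lapT (lag k) = (-1) ^+ k *: lag k /\ lapT (lag k.+1) = (-1) ^+ k.+1 *: lag k.+1.
  by case.
have rec j : lapT (lapp (lag j) - 'X * lag j) = 'X * lapT (lag j) - lapp (lapT (lag j)).
  by rewrite lapTB lapT_lapp lapT_mulX.
have step j : lag j.+2 = (lapp (lag j.+1) - 'X * lag j.+1)
    - (j.+1%:R * (j.+1%:R + nu)) *: lag j.
  rewrite lag_rec -lag_eigen -mul_polyC; ring.
have l0 : lag 0 = 1 by rewrite /lag lagp0 comp_polyC.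
have l1 : lag 1 = lapp (lag 0) - 'X * lag 0.
  have -> : lag 1 = (lagp 1) \Po (2%:P * 'X) by [].
  rewrite lagpS lagp0 l0 lappE !poly.derivE mulr0 addr0 mulr1.
  by rewrite -?polyC0 -!polyC1 !(comp_polyB, comp_polyD, comp_polyM, comp_polyC, comp_polyX, comp_poly0) !(rmorphD, rmorph0, rmorph1); ring.
have T0 : lapT (lag 0) = lag 0 by rewrite l0 -(expr0 'X) lapT_Xn.
elim: k => [|k [IH0 IH1]].
  rewrite expr0 scale1r; split=> //.
  by rewrite l1 rec T0 expr1 scaleN1r opprB.
split=> //.
rewrite step lapTB lapTZ rec IH0 IH1 lappZ !exprS -!mul_polyC.
rewrite !(rmorphM, rmorphN, rmorphXn, rmorphD, rmorph1) /=; ring.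
Qed.

Lemma size_lagp k : size (lagp k) = k.+1.
Proof.
suff H : (size (lagp k) <= k.+1)%N /\ (lagp k)`_k = (-1) ^+ k.
  apply/eqP; rewrite eqn_leq (proj1 H) ltnNge; apply/negP => le_k.
  have := proj2 H; rewrite nth_default // => /esym/eqP.
  by rewrite expf_eq0 oppr_eq0 oner_eq0 andbF.
elim: k => [|k [sz lc]]; first by rewrite lagp0 size_poly1 coef1 expr0.
rewrite lagpS; split.
  apply/leq_sizeP => -[|j] // kj.
  rewrite coefD coefB !coefXM /= coef_deriv coefCM !nth_default ?(mul0rn, mulr0, addr0, subr0) //.
  1,2: by apply: leq_trans sz _; rewrite ?(ltnW kj).
rewrite coefD coefB !coefXM /= coef_deriv coefCM lc.
by rewrite !(nth_default _ sz) mul0rn mulr0 addr0 sub0r exprS mulN1r.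
Qed.

Lemma size_lag k : size (lag k) = k.+1.
Proof.
rewrite /lag size_comp_poly2 ?size_lagp //.
by rewrite mul_polyC size_scale ?size_polyX // pnatr_eq0.
Qed.

Lemma lag_span n q : (size q <= n)%N ->
  exists d : nat -> R, q = \sum_(i < n) d i *: lag i.
Proof.
elim: n q => [|n IH] q sq.
  exists (fun _ => 0); rewrite big_ord0; apply/eqP; rewrite -size_poly_eq0.
  by rewrite -leqn0.
pose c := q`_n / lead_coef (lag n).
have lc0 : lead_coef (lag n) != 0 by rewrite lead_coef_eq0 -size_poly_eq0 size_lag.
have lcE : lead_coef (lag n) = (lag n)`_n by rewrite lead_coefE size_lag.
have [|d qE] := IH (q - c *: lag n).
  apply/leq_sizeP => j; rewrite leq_eqVlt => /predU1P[<-|nj].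
    by rewrite coefB coefZ /c lcE divfK ?subrr // -lcE.
  rewrite coefB coefZ !nth_default ?mulr0 ?subr0 ?size_lag //.
  exact: leq_trans sq nj.
exists (fun i => if i == n then c else d i).
rewrite big_ord_recr /= eqxx -[LHS](subrK (c *: lag n)) qE; congr (_ + _).
by apply: eq_bigr => i _; rewrite (ltn_eqF (ltn_ord i)).
Qed.

End Laguerre.

(** * The Gamma function *)

Section GammaMoments.
Variable R : realType.
Implicit Types (g : R -> R) (s t x : R).
Local Notation mu := (@lebesgue_measure R).

Lemma measurable_Rpos : measurable (@Rpos R).
Proof. exact: measurable_itv. Qed.

Lemma RposE x : (x \in @Rpos R) = (0 < x).
Proof. by rewrite /Rpos mem_setE in_itv /= andbT. Qed.

Lemma Rpos_gt0 x : @Rpos R x -> 0 < x.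
Proof. by rewrite /Rpos /= in_itv /= andbT. Qed.

Lemma gt0_Rpos x : 0 < x -> @Rpos R x.
Proof. by rewrite /Rpos /= in_itv /= andbT. Qed.

Lemma continuous_measurable_Rpos g :
  (forall x, 0 < x -> {for x, continuous g}) -> measurable_fun (@Rpos R) g.
Proof.
move=> cg; apply: open_continuous_measurable_fun; first exact: interval_open.
by move=> x; rewrite RposE => /cg.
Qed.

(** The fundamental theorem of calculus and the change of variables are applied on compact intervals
    inside [R^+]; monotone convergence then reaches the half-line. *)
Lemma ge0_integral_exhaust (a b : R^nat) g :
  (forall n, 0 < a n) -> nonincreasing_seq a -> nondecreasing_seq b ->
  (forall x, 0 < x -> exists n, a n <= x <= b n) ->
  measurable_fun (@Rpos R) g -> (forall x, 0 < x -> 0 <= g x) ->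
  (\int[mu]_(x in `[a n, b n]) (g x)%:E @[n --> \oo] -->
   \int[mu]_(x in @Rpos R) (g x)%:E)%E.
Proof.
move=> a0 da db ab mg g0.
have sub n : `[a n, b n] `<=` @Rpos R.
  move=> x /=; rewrite in_itv /= => /andP[ax _]; apply: gt0_Rpos; exact: lt_le_trans ax.
have -> : @Rpos R = \bigcup_n `[a n, b n]%classic.
  apply/seteqP; split=> [x /Rpos_gt0/ab[n abx]|x [n _]]; last exact: sub.
  by exists n => //=; rewrite in_itv.
apply: ge0_nondecreasing_set_cvg_integral => //.
- move=> m n mn; apply/subsetPset => x /=; rewrite !in_itv /= => /andP[ax xb].
  by rewrite (le_trans (da _ _ mn) ax) (le_trans xb (db _ _ mn)).
- move=> n; apply/measurable_EFinP; apply: measurable_funS mg => //.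
  exact: measurable_Rpos.
- move=> n x /sub/Rpos_gt0 x0; rewrite lee_fin; exact: g0.
Qed.

Lemma Rpos_exhaust x : 0 < x -> exists n : nat, n.+1%:R^-1 <= x <= n.+1%:R.
Proof.
move=> x0; have [n Hn] : exists n : nat, x^-1 <= n.+1%:R /\ x <= n.+1%:R.
  exists (Num.truncn x^-1 + Num.truncn x)%N.
  have h (y : R) : y < (Num.truncn y).+1%:R by exact: truncnS_gt.
  split; apply: (le_trans (ltW (h _))); rewrite ler_nat ltnS ?leq_addr ?leq_addl //.
case: Hn => h1 h2; exists n; rewrite h2 andbT.
by rewrite -[x]invrK lef_pV2 // posrE ?invr_gt0 // ltr0n.
Qed.

Lemma nonincreasing_invn : nonincreasing_seq (fun n => n.+1%:R^-1 : R).
Proof. by move=> m n mn; rewrite lef_pV2 ?posrE ?ltr0n // ler_nat. Qed.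

Lemma nondecreasing_natS : nondecreasing_seq (fun n => n.+1%:R : R).
Proof. by move=> m n mn; rewrite ler_nat. Qed.

Lemma ge0_integral_exhaust_nat g :
  measurable_fun (@Rpos R) g -> (forall x, 0 < x -> 0 <= g x) ->
  (\int[mu]_(x in `[(n.+1%:R^-1)%R, n.+1%:R%R]) (g x)%:E @[n --> \oo] -->
   \int[mu]_(x in @Rpos R) (g x)%:E)%E.
Proof.
move=> mg g0; apply: (@ge0_integral_exhaust (fun n => n.+1%:R^-1) (fun n => n.+1%:R)) => //.
- exact: nonincreasing_invn.
- exact: nondecreasing_natS.
- exact: Rpos_exhaust.
Qed.

Lemma FTC2_pos (f F : R -> R) a b : 0 < a -> a <= b ->
  (forall x, 0 < x -> {for x, continuous f}) ->
  (forall x, 0 < x -> is_derive x 1 F (f x)) ->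
  (\int[mu]_(x in `[a, b]) (f x)%:E = (F b - F a)%:E)%E.
Proof.
move=> a0; rewrite le_eqVlt => /predU1P[<- _ _|ab cf dF].
  by rewrite set_itv1 integral_set1 subrr.
have cF x : 0 < x -> {for x, continuous F}.
  move=> x0; apply: differentiable_continuous; apply/derivable1_diffP.
  by have [] := dF x x0.
rewrite (@continuous_FTC2 _ f F a b ab) //.
- apply: continuous_in_subspaceT => x; rewrite inE /= in_itv /= => /andP[ax _].
  apply: cf; exact: lt_le_trans ax.
- split.
  + move=> x; rewrite in_itv /= => /andP[ax _].
    by have [] := dF x (lt_trans a0 ax).
  + apply: cvg_at_right_filter; exact: cF.
  + apply: cvg_at_left_filter; apply: cF; exact: lt_trans ab.
- move=> x; rewrite in_itv /= => /andP[ax _]; rewrite derive1E.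
  by have [_ ->] := dF x (lt_trans a0 ax).
Qed.

(** The substitution [t = s x ^+ 2 / 2], which turns Gaussian moments into Gamma values. It is made
    on [[1/(n+1), n+1]], and the images of these intervals exhaust [R^+] too. *)
Lemma ge0_integral_sqr_subst s g : 0 < s ->
  (forall x, 0 < x -> {for x, continuous g}) -> (forall x, 0 < x -> 0 <= g x) ->
  (\int[mu]_(t in @Rpos R) (g t)%:E =
   \int[mu]_(x in @Rpos R) (g (s / 2 * x ^+ 2) * (s * x))%:E)%E.
Proof.
move=> s0 cg g0; pose F x := s / 2 * x ^+ 2.
have s20 : 0 < s / 2 by rewrite divr_gt0.
have F0 x : 0 < x -> 0 < F x by move=> x0; rewrite mulr_gt0 // exprn_gt0.
have dF x : is_derive x (1 : R) F (s * x).
  have -> : F = (s / 2) *: ((id : R -> R) ^+ 2) by apply/funext.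
  apply: is_derive_eq.
  rewrite -[RHS]mulr1 /GRing.scale /= expr1; lra.
have dF' : derive1 F = (fun x => s * x) :> (R -> R).
  by apply/funext => x; rewrite derive1E; have [_ ->] := dF x.
have cF x : {for x, continuous F}.
  by apply: differentiable_continuous; apply/derivable1_diffP; have [] := dF x.
have cF' x : {for x, continuous (fun x => s * x)}.
  by apply: cvgM; [exact: cvg_cst|exact: cvg_id].
have Fle x y : 0 <= x -> x <= y -> F x <= F y.
  move=> hx hxy; rewrite ler_wpM2l ?(ltW s20) // lerXn2r // nnegrE //.
  exact: le_trans hxy.
have sub n : (\int[mu]_(t in `[F (n.+1%:R^-1)%R, F (n.+1%:R)%R]) (g t)%:E =
    \int[mu]_(x in `[(n.+1%:R^-1)%R, n.+1%:R%R]) (g (F x) * (s * x))%:E)%E.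
  have n0 : 0 < n.+1%:R^-1 :> R by rewrite invr_gt0 ltr0n.
  rewrite (@integration_by_substitution_increasing _ F) //.
  - by rewrite dF'.
  - by apply: (@le_trans _ _ 1); rewrite ?invf_le1 ?ltr0n // ler1n.
  - move=> x y; rewrite !in_itv /= => /andP[hx _] /andP[hy _] xy.
    rewrite ltr_pM2l // ltr_pXn2r // nnegrE ltW //; exact: lt_le_trans hx || exact: lt_le_trans hy.
  - by rewrite dF' => x _; exact: cF'.
  - by rewrite dF'; apply/cvg_ex; eexists; apply: cvg_at_right_filter; exact: cF'.
  - by rewrite dF'; apply/cvg_ex; eexists; apply: cvg_at_left_filter; exact: cF'.
  - split => [x _||]; first by have [] := dF x.
      by apply: cvg_at_right_filter; exact: cF.
    by apply: cvg_at_left_filter; exact: cF.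
  - apply: continuous_in_subspaceT => x; rewrite inE /= in_itv /= => /andP[hx _].
    by apply: cg; apply: lt_le_trans hx; exact: F0.
have cvl := @ge0_integral_exhaust (fun n => F n.+1%:R^-1) (fun n => F n.+1%:R) g.
have cvr := @ge0_integral_exhaust_nat (fun x => g (F x) * (s * x)).
have cgF x : 0 < x -> {for x, continuous (fun x => g (F x) * (s * x))}.
  move=> x0; apply: continuousM; last exact: cF'.
  by apply: (@continuous_comp _ _ _ F g x); [exact: cF|apply: cg; exact: F0].
apply: (cvg_unique (@ereal_hausdorff R) (F := (\int[mu]_(t in `[F (n.+1%:R^-1)%R, F (n.+1%:R)%R]) (g t)%:E)%E @[n --> \oo])).
- apply: cvl => //.
  + by move=> n; apply: F0; rewrite invr_gt0 ltr0n.
  + move=> m n mn; apply: Fle; first by rewrite invr_ge0 ler0n.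
    exact: nonincreasing_invn.
  + by move=> m n mn; apply: Fle; rewrite ?ler0n // ler_nat.
  + move=> t t0; have q0 : 0 < Num.sqrt (t / (s / 2)) by rewrite sqrtr_gt0 divr_gt0.
    have [n /andP[n1 n2]] := Rpos_exhaust q0.
    have -> : t = F (Num.sqrt (t / (s / 2))).
      by rewrite /F sqr_sqrtr ?divr_ge0 1?ltW // mulrC divfK // gt_eqF.
    by exists n; rewrite !Fle // ?sqrtr_ge0 // invr_ge0 ler0n.
  + exact: continuous_measurable_Rpos.
- rewrite (funext sub); apply: cvr; first exact: continuous_measurable_Rpos.
  by move=> x x0; rewrite mulr_ge0 // ?mulr_ge0 ?(ltW s0) ?(ltW x0) // g0 // F0.
Qed.

(** This is [ln u < u] at [u = e t / p]. A small [e] leaves a part of [exp (- t)] available for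
    decay. *)
Lemma powR_le_expR (p e t : R) : 0 < p -> 0 < e -> 0 < t ->
  t `^ p <= expR (- (p * ln (e / p))) * expR (e * t).
Proof.
move=> p0 e0 t0; rewrite /powR gt_eqF // -expRD ler_expR.
have h : 0 < e / p * t by rewrite mulr_gt0 // divr_gt0.
have := ln_sublinear h; rewrite lnM ?posrE ?divr_gt0 // => H.
have : p * (ln (e / p) + ln t) < p * (e / p * t) by rewrite ltr_pM2l.
have -> : p * (e / p * t) = e * t by field; rewrite gt_eqF.
by rewrite mulrDr => ?; lra.
Qed.

Definition gammaf (p t : R) : R := t `^ (p - 1) * expR (- t).

Lemma gammaf_ge0 p t : 0 <= gammaf p t.
Proof. by rewrite mulr_ge0 ?powR_ge0 ?expR_ge0. Qed.

Lemma continuous_powR_pos p x : 0 < x -> {for x, continuous (fun t : R => t `^ p)}.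
Proof.
move=> x0; apply: differentiable_continuous; apply/derivable1_diffP.
by apply: derivable_powR; rewrite in_itv /= x0.
Qed.

Lemma continuous_gammaf p x : 0 < x -> {for x, continuous (gammaf p)}.
Proof.
move=> x0; apply: continuousM; first exact: continuous_powR_pos.
by apply: (@continuous_comp _ _ _ (fun t : R => - t) expR x); [exact: oppr_continuous|exact: continuous_expR].
Qed.

End GammaMoments.

Section Gamma2.
Variable R : realType.
Implicit Types (g : R -> R) (s t x p : R).
Local Notation mu := (@lebesgue_measure R).

(* [t `^ (p - 1) / (1 + t `^ p) ^+ 2] has the bounded primitive [- (1 + t `^ p)^-1 / p]
   and dominates [gammaf p]; this settles both endpoints at once. *)
Lemma gammaf_integral_fin p : 0 < p ->
  (\int[mu]_(t in @Rpos R) (gammaf p t)%:E < +oo)%E.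
Proof.
move=> p0; pose C : R := expR (- (p * ln (2^-1 / p))).
pose F t : R := - (1 + t `^ p)^-1.
pose f t : R := p * t `^ (p - 1) / (1 + t `^ p) ^+ 2.
have D0 t : 0 < 1 + t `^ p by rewrite ltr_pwDl // powR_ge0.
have dF t : 0 < t -> is_derive t 1 F (f t).
  move=> t0.
  have dD : is_derive t 1 (fun t => 1 + t `^ p) (p * t `^ (p - 1)).
    have -> : (fun t : R => 1 + t `^ p) = cst 1 + (fun t => t `^ p) by apply/funext.
    have dp := is_derive1_powR p t0.
    by apply: is_derive_eq; rewrite add0r.
  have := is_deriveN (@is_deriveV _ (fun t => 1 + t `^ p) t _ 1 (lt0r_neq0 (D0 t)) dD).
  have -> : - (fun t => (1 + t `^ p)^-1) = F by apply/funext.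
  move=> dF; apply: is_derive_eq.
  by rewrite /f scaleNr opprK /GRing.scale /= mulrC.
have cf t : 0 < t -> {for t, continuous f}.
  move=> t0; apply: continuousM.
    by apply: continuousM; [exact: cst_continuous|exact: continuous_powR_pos].
  apply: (@continuousV _ _ (fun t => (1 + t `^ p) ^+ 2)); first by rewrite expf_neq0 ?lt0r_neq0.
  have -> : (fun t => (1 + t `^ p) ^+ 2) = (fun t => (1 + t `^ p) * (1 + t `^ p)).
    by apply/funext => u; rewrite expr2.
  have c1 : {for t, continuous (fun t => 1 + t `^ p)}.
    by apply: continuousD; [exact: cst_continuous|exact: continuous_powR_pos].
  exact: continuousM.
have f0 t : 0 <= f t.
  by rewrite divr_ge0 ?sqr_ge0 // mulr_ge0 ?powR_ge0 // ltW.
(* [powR_le_expR] with [e = 1/2] gives [1 + t^p <= (1 + C) exp (t / 2)]; the square of the right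
   side costs exactly [exp t]. *)
have le_gf t : 0 < t -> gammaf p t <= ((1 + C) ^+ 2 / p) * f t.
  move=> t0; have -> : (1 + C) ^+ 2 / p * f t =
    t `^ (p - 1) * ((1 + C) ^+ 2 / (1 + t `^ p) ^+ 2).
    by rewrite /f; field; rewrite !gt_eqF.
  rewrite ler_wpM2l ?powR_ge0 // ler_pdivlMr ?exprn_gt0 // expRN mulrC ler_pdivrMr ?expR_gt0 //.
  have -> : expR t = expR (2^-1 * t) ^+ 2 by rewrite expr2 -expRD; congr expR; lra.
  rewrite -exprMn lerXn2r // ?nnegrE ?mulr_ge0 ?expR_ge0 ?(ltW (D0 t)) // ?addr_ge0 ?expR_ge0 //.
  rewrite mulrDl mul1r lerD //.
    by rewrite -expR0 ler_expR mulr_ge0 // ltW.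
  by apply: powR_le_expR => //; rewrite invr_gt0.
have mf : measurable_fun (@Rpos R) (gammaf p).
  by apply: continuous_measurable_Rpos => t t0; exact: continuous_gammaf.
have cvg := ge0_integral_exhaust_nat mf (fun x _ => gammaf_ge0 p x).
have K0 : 0 <= (1 + C) ^+ 2 / p by rewrite divr_ge0 ?sqr_ge0 // ltW.
suff : (\int[mu]_(t in @Rpos R) (gammaf p t)%:E <= ((1 + C) ^+ 2 / p)%:E)%E.
  by move=> h; apply: (le_lt_trans h); rewrite ltry.
rewrite -(cvg_lim (@ereal_hausdorff R) cvg).
apply: lime_le; first by apply/cvg_ex; eexists; exact: cvg.
apply: nearW => n.
have n0 : 0 < n.+1%:R^-1 :> R by rewrite invr_gt0 ltr0n.
have nn : n.+1%:R^-1 <= n.+1%:R :> R.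
  by apply: (@le_trans _ _ 1); rewrite ?invf_le1 ?ltr0n // ler1n.
have sub : `[n.+1%:R^-1, n.+1%:R] `<=` @Rpos R.
  move=> x /=; rewrite in_itv /= => /andP[ax _]; apply: gt0_Rpos; exact: lt_le_trans ax.
have mfn : measurable_fun (`[n.+1%:R^-1, n.+1%:R] : set R) f.
  apply: (@measurable_funS _ _ _ _ (@Rpos R)) => //; first exact: measurable_Rpos.
  exact: continuous_measurable_Rpos.
apply: (@le_trans _ _ (\int[mu]_(x in `[(n.+1%:R^-1)%R, n.+1%:R%R]) (((1 + C) ^+ 2 / p)%:E * (f x)%:E))%E).
  apply: ge0_le_integral => //=.
  - by move=> x _; rewrite lee_fin gammaf_ge0.
  - apply/measurable_EFinP; apply: measurable_funS sub mf; exact: measurable_Rpos.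
  - apply/measurable_EFinP; apply: measurable_funM => //; exact: measurable_cst.
  - by move=> x /sub/Rpos_gt0 x0; rewrite -EFinM lee_fin le_gf.
rewrite ge0_integralZl_EFin //; last 2 first.
- by move=> x _; rewrite lee_fin.
- exact/measurable_EFinP.
rewrite (@FTC2_pos _ f F) // -EFinM lee_fin ler_piMr //.
rewrite /F opprK addrC.
have h (u : R) : 0 <= (1 + u `^ p)^-1 by rewrite invr_ge0 ltW.
have : (1 + n.+1%:R^-1 `^ p)^-1 <= 1 by rewrite invf_le1 // lerDl powR_ge0.
have := h n.+1%:R; lra.
Qed.

Lemma GammaE p : 0 < p ->
  ((Gamma p)%:E = \int[mu]_(t in @Rpos R) (gammaf p t)%:E)%E.
Proof.
move=> p0; rewrite /Gamma /Rintegral fineK // ge0_fin_numE ?gammaf_integral_fin //.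
by apply: integral_ge0 => x _; rewrite lee_fin gammaf_ge0.
Qed.

(** Integration by parts: [t^p exp (- t)] has derivative [p * gammaf p t - gammaf (p + 1) t], and
    its values at [n + 1] and [1/(n+1)] both tend to 0. *)
Lemma GammaS p : 0 < p -> Gamma (p + 1) = p * Gamma p.
Proof.
move=> p0; have p10 : 0 < p + 1 by rewrite addr_gt0.
pose F t : R := t `^ p * expR (- t).
pose f t : R := p * gammaf p t - gammaf (p + 1) t.
have dF t : 0 < t -> is_derive t 1 F (f t).
  move=> t0.
  have d1 : is_derive t 1 (fun t => expR (- t)) (- expR (- t)).
    have -> : (fun t : R => expR (- t)) = expR \o -%R by apply/funext.
    by apply: is_derive_eq; rewrite mulrN1.
  have -> : F = (fun t => t `^ p) * (fun t => expR (- t)) by apply/funext.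
  have dp := is_derive1_powR p t0.
  apply: is_derive_eq.
  rewrite /f /gammaf addrK /GRing.scale /=; ring.
have cf t : 0 < t -> {for t, continuous f}.
  move=> t0; apply: continuousB; last exact: continuous_gammaf.
  by apply: continuousM; [exact: cst_continuous|exact: continuous_gammaf].
have mg q : measurable_fun (@Rpos R) (gammaf q).
  by apply: continuous_measurable_Rpos => t t0; exact: continuous_gammaf.
have c1 := ge0_integral_exhaust_nat (mg p) (fun x _ => gammaf_ge0 p x).
have c2 := ge0_integral_exhaust_nat (mg (p + 1)) (fun x _ => gammaf_ge0 (p + 1) x).
rewrite -GammaE // in c1; rewrite -GammaE // in c2.
have r1 : (\int[mu]_(x in `[n.+1%:R^-1, n.+1%:R]) gammaf p x) @[n --> \oo] --> Gamma p.
  exact: (fine_cvg c1).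
have r2 : (\int[mu]_(x in `[n.+1%:R^-1, n.+1%:R]) gammaf (p + 1) x) @[n --> \oo] -->
    Gamma (p + 1).
  exact: (fine_cvg c2).
have sub n : `[n.+1%:R^-1, n.+1%:R] `<=` @Rpos R.
  move=> x /=; rewrite in_itv /= => /andP[ax _]; apply: gt0_Rpos.
  by apply: lt_le_trans ax; rewrite invr_gt0 ltr0n.
have ig q : 0 < q -> mu.-integrable (@Rpos R) (EFin \o gammaf q).
  move=> q0; apply/integrableP; split; first by apply/measurable_EFinP; exact: mg.
  under eq_integral do rewrite /= ger0_norm ?gammaf_ge0 //.
  exact: gammaf_integral_fin.
have ign q n : 0 < q -> mu.-integrable (`[n.+1%:R^-1, n.+1%:R] : set R) (EFin \o gammaf q).
  by move=> q0; apply: integrableS (ig q q0) => //; exact: measurable_Rpos.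
have E n : p * (\int[mu]_(x in `[n.+1%:R^-1, n.+1%:R]) gammaf p x) -
    \int[mu]_(x in `[n.+1%:R^-1, n.+1%:R]) gammaf (p + 1) x = F n.+1%:R - F n.+1%:R^-1.
  rewrite -RintegralZl ?ign // -RintegralB //; last 2 first.
  - have -> : EFin \o (fun x => p * gammaf p x) = (fun x => p%:E * (EFin \o gammaf p) x)%E.
      by apply/funext => x; rewrite /= EFinM.
    by apply: integrableZl => //; exact: ign.
  - exact: ign.
  rewrite /Rintegral (@FTC2_pos _ f F) ?invr_gt0 ?ltr0n //.
  by apply: (@le_trans _ _ 1); rewrite ?invf_le1 ?ltr0n // ler1n.
have l1 : F n.+1%:R @[n --> \oo] --> 0.
  pose C := expR (- (p * ln (2^-1 / p))).
  apply: (@squeeze_cvgr _ _ _ _ (fun=> 0) (fun n => (2 * C) * harmonic n)).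
  - apply: nearW => n; rewrite mulr_ge0 ?powR_ge0 ?expR_ge0 //=.
    have n0 : 0 < n.+1%:R :> R by rewrite ltr0n.
    have h20 : 0 < 2^-1 :> R by rewrite invr_gt0.
    have := powR_le_expR p0 h20 n0; rewrite -/C => h.
    apply: (@le_trans _ _ (C * expR (2^-1 * n.+1%:R) * expR (- n.+1%:R))).
      by rewrite ler_wpM2r ?expR_ge0.
    rewrite -mulrA -expRD mulrAC [leRHS]mulrC ler_wpM2l ?expR_ge0 //.
    have -> : 2^-1 * n.+1%:R - n.+1%:R = - (n.+1%:R / 2) :> R by lra.
    rewrite expRN -[leRHS]invrK lef_pV2 ?posrE ?invr_gt0 ?mulr_gt0 ?expR_gt0 ?invr_gt0 //.
    have := expR_ge1Dx (n.+1%:R / 2 : R); rewrite invfM invrK mulrC; lra.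
  - exact: cvg_cst.
  - rewrite -[X in _ --> X](mulr0 (2 * C)); apply: cvgM; [exact: cvg_cst|exact: cvg_harmonic].
have l2 : F n.+1%:R^-1 @[n --> \oo] --> 0.
  apply: (@squeeze_cvgr _ _ _ _ (fun=> 0) (fun n => (harmonic n) `^ p)).
  - apply: nearW => n; rewrite mulr_ge0 ?powR_ge0 ?expR_ge0 //=.
    by rewrite ler_piMr ?powR_ge0 // -expR0 ler_expR oppr_le0 invr_ge0 ler0n.
  - exact: cvg_cst.
  - have h := (cvg_at_rightP (fun a : R => a `^ p) 0 0).1 (powR_cvg0 p0).
    apply: h; split; last exact: cvg_harmonic.
    by move=> n; rewrite invr_gt0 ltr0n.
have L : (p * (\int[mu]_(x in `[n.+1%:R^-1, n.+1%:R]) gammaf p x) -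
    \int[mu]_(x in `[n.+1%:R^-1, n.+1%:R]) gammaf (p + 1) x) @[n --> \oo] -->
    p * Gamma p - Gamma (p + 1).
  exact: (cvgB (cvgM (cvg_cst p) r1) r2).
have L' : (F n.+1%:R - F n.+1%:R^-1) @[n --> \oo] --> 0.
  by rewrite -[X in _ --> X](subrr 0); exact: cvgB.
rewrite (funext E) in L.
by apply/eqP; rewrite eq_sym -subr_eq0; apply/eqP; exact: cvg_unique L L'.
Qed.

(** At [p + 1] the power in the integrand is [t^p >= 1] on [[1, 2]], so [exp (-2)] is a lower bound
    there. *)
Lemma Gamma_gt0 p : 0 < p -> 0 < Gamma p.
Proof.
move=> p0; have p10 : 0 < p + 1 by rewrite addr_gt0.
suff : 0 < Gamma (p + 1) by rewrite GammaS // pmulr_rgt0.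
rewrite -lte_fin GammaE //.
have sub : `[1, 2] `<=` @Rpos R.
  by move=> x /=; rewrite in_itv /= => /andP[ax _]; apply: gt0_Rpos; exact: lt_le_trans ax.
have mg q : measurable_fun (@Rpos R) (EFin \o gammaf q).
  apply/measurable_EFinP.
  by apply: continuous_measurable_Rpos => t t0; exact: continuous_gammaf.
apply: (@lt_le_trans _ _ (\int[mu]_(x in `[1%R, 2%R]) (gammaf (p + 1) x)%:E)%E); last first.
  apply: ge0_subset_integral => //; [exact: measurable_Rpos|exact: mg|].
  by move=> x _; rewrite lee_fin gammaf_ge0.
apply: (@lt_le_trans _ _ (\int[mu]_(x in `[1%R, 2%R]) (expR (-2))%:E)%E).
  rewrite integral_cst //= lebesgue_measure_itv /= lte_fin ltr1n.
  by rewrite -EFinB -EFinM lte_fin mulr_gt0 ?expR_gt0 // subr_gt0 ltr1n.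
apply: ge0_le_integral => //=.
- apply: measurable_funS sub (mg _); exact: measurable_Rpos.
- move=> x; rewrite in_itv /= => /andP[x1 x2]; rewrite lee_fin /gammaf addrK.
  rewrite -[leLHS]mul1r ler_pM ?expR_ge0 // ?ler_expR ?lerN2 //.
  have -> : 1 = 1 `^ p :> R by rewrite powR1.
  by rewrite ge0_ler_powR ?nnegrE ?(ltW p0) //; exact: le_trans x1.
Qed.

End Gamma2.

(** * The Bessel function *)

Section EntireSeries.
Variable R : realType.
Implicit Types (c : R^nat) (z a K : R).

(** Coefficients of an entire function of exponential type. The condition survives termwise
    differentiation, so series can be differentiated repeatedly without discussing radii. *)
Definition exp_bounded c := exists K a, [/\ 0 <= K, 0 <= a &
  forall n, `|c n| <= K * (a ^+ n / n`!%:R)].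

Lemma exp_bounded_diffs c : exp_bounded c -> exp_bounded (pseries_diffs c).
Proof.
move=> [K [a [K0 a0 cK]]]; exists (K * a), a; split => //; first exact: mulr_ge0.
move=> n; rewrite /pseries_diffs normrM normr_nat.
apply: (@le_trans _ _ (n.+1%:R * (K * (a ^+ n.+1 / n.+1`!%:R)))).
  by rewrite ler_wpM2l.
rewrite le_eqVlt; apply/orP; left; apply/eqP.
rewrite factS natrM exprS; field.
by rewrite pnatr_eq0 -lt0n fact_gt0 nat1r pnatr_eq0.
Qed.

Lemma exp_bounded_cvg c z : exp_bounded c -> cvgn (pseries c z).
Proof.
move=> [K [a [K0 a0 cK]]]; apply: normed_cvg.
apply: (@series_le_cvg _ _ (fun n => K * exp_coeff (a * `|z|) n)).
- by move=> n /=; exact: normr_ge0.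
- move=> n; rewrite mulr_ge0 // exp_coeff_ge0 // mulr_ge0 //.
- move=> n; rewrite /= normrM normrX /exp_coeff /= exprMn.
  by rewrite mulrAC mulrA ler_wpM2r ?exprn_ge0.
- exact: (is_cvg_seriesZ (is_cvg_series_exp_coeff _)).
Qed.

Lemma exp_bounded_derive c z : exp_bounded c ->
  is_derive z (1 : R) (fun x => limn (pseries c x)) (limn (pseries (pseries_diffs c) z)).
Proof.
move=> h; have h1 := exp_bounded_diffs h; have h2 := exp_bounded_diffs h1.
(* A point farther from 0 than [z], at which the series and its first two formal derivatives
   converge. *)
apply: (@pseries_snd_diffs _ c (`|z| + 1)) => //; try exact: exp_bounded_cvg.
by rewrite [ltRHS]ger0_norm ?addr_ge0 // ltrDl.
Qed.

End EntireSeries.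

Section Bessel.
Variables (R : realType) (nu : R).
Hypothesis hnu : - (1 / 2) < nu.
Implicit Types (x z : R) (i k n : nat).

(** The Pochhammer symbol [(i + nu + 1)_k], that is [Gamma (i + k + nu + 1) / Gamma (i + nu +
    1)]. *)
Definition rfact i k : R := \prod_(l < k) (i%:R + nu + 1 + l%:R).

Lemma rfact0 i : rfact i 0 = 1. Proof. by rewrite /rfact big_ord0. Qed.

Lemma rfactSr i k : rfact i k.+1 = rfact i k * (i%:R + nu + 1 + k%:R).
Proof. by rewrite /rfact big_ord_recr. Qed.

Lemma rfactSl i k : rfact i k.+1 = (i%:R + nu + 1) * rfact i.+1 k.
Proof.
rewrite /rfact big_ord_recl addr0; congr (_ * _); apply: eq_bigr => l _.
by rewrite lift0 -[i.+1%:R]natr1 -[l.+1%:R]natr1; ring.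
Qed.

(** The recurrence [lagp_rec] read on coefficients: replacing [b i] by [i * b i.-1] multiplies the
    sum of [(- v)^i / i! * b i] by [- v], see [series_shift]. *)
Lemma rfact_rec i k : rfact i k.+2 = (2 * k.+1%:R + nu + 1) * rfact i k.+1
  + i%:R * rfact i.-1 k.+1 - k.+1%:R * (k.+1%:R + nu) * rfact i k.
Proof.
have -> : i%:R * rfact i.-1 k.+1 = i%:R * (i%:R + nu) * rfact i k.
  case: i => [|i]; first by rewrite !mul0r.
  by rewrite rfactSl /= -[i.+1%:R]natr1; ring.
by rewrite !rfactSr -[k.+1%:R]natr1; ring.
Qed.

Lemma rfact_rec0 i : rfact i 1 = (nu + 1) * rfact i 0 + i%:R * rfact i.-1 0.
Proof. by rewrite rfactSr !rfact0; ring. Qed.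

Lemma nu1_gt0 : 0 < nu + 1. Proof. by have := hnu; lra. Qed.

Lemma rfact_gt0 i k : 0 < rfact i k.
Proof.
apply: prodr_gt0 => l _; have := nu1_gt0; have := ler0n R i; have := ler0n R l; lra.
Qed.

Lemma rfactD i k : rfact 0 (i + k) = rfact 0 i * rfact i k.
Proof.
elim: k => [|k IH]; first by rewrite addn0 rfact0 mulr1.
by rewrite addnS !rfactSr IH natrD; ring.
Qed.

Lemma addn_nu1_gt0 n : 0 < n%:R + nu + 1.
Proof. by rewrite -addrA ltr_wpDl ?nu1_gt0. Qed.

Lemma Gamma_rfact n : Gamma (n%:R + nu + 1) = rfact 0 n * Gamma (nu + 1).
Proof.
elim: n => [|n IH]; first by rewrite rfact0 add0r mul1r.
have -> : n.+1%:R + nu + 1 = (n%:R + nu + 1) + 1 by rewrite -natr1; ring.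
by rewrite (GammaS (addn_nu1_gt0 n)) IH rfactSr add0r; ring.
Qed.

(** Each factor [nu + 1 + l] is at least [(l + 1) / 2], since [nu > - 1/2]. *)
Lemma rfact_ge n : n`!%:R / 2 ^+ n <= rfact 0 n.
Proof.
elim: n => [|n IH]; first by rewrite fact0 expr0 divr1 rfact0.
rewrite rfactSr factS natrM exprS.
have -> : n.+1%:R * n`!%:R / (2 * 2 ^+ n) = n`!%:R / 2 ^+ n * (n.+1%:R / 2) :> R.
  by field; rewrite expf_neq0.
apply: ler_pM => //; rewrite ?divr_ge0 ?exprn_ge0 // ?ler0n //.
by rewrite -natr1; have := hnu; have := ler0n R n; lra.
Qed.

(* [phi nu x] is proportional to [bes (x ^+ 2 / 4)], which is entire; see [phiE]. *)
Definition bescoef n : R := (-1) ^+ n / (n`!%:R * rfact 0 n).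

Definition bes z : R := limn (pseries bescoef z).
Definition bes1 z : R := limn (pseries (pseries_diffs bescoef) z).

(** Both factorials are kept: in [FB_gq_Xn] one pays for the powers of [y], the other for those of
    [x]. *)
Lemma norm_bescoef n : `|bescoef n| <= (2 ^+ n / n`!%:R) / n`!%:R.
Proof.
have f0 : 0 < n`!%:R :> R by rewrite ltr0n fact_gt0.
have r0 := rfact_gt0 0 n.
rewrite /bescoef normrM normrX normrN1 expr1n mul1r ger0_norm; last first.
  by rewrite invr_ge0 mulr_ge0 ?ltW.
rewrite invfM mulrC; apply: ler_wpM2r; first by rewrite invr_ge0 ltW.
rewrite -[leRHS]invrK lef_pV2 ?posrE ?invr_gt0 ?divr_gt0 ?exprn_gt0 //.
by rewrite invf_div; exact: rfact_ge.
Qed.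

Lemma bescoef_bounded : exp_bounded bescoef.
Proof.
exists 1, 2; split => // n; rewrite mul1r; apply: (le_trans (norm_bescoef n)).
rewrite ler_piMr ?divr_ge0 ?exprn_ge0 ?ler0n // invf_le1 ?ltr0n ?fact_gt0 //.
by rewrite ler1n fact_gt0.
Qed.

Lemma bes_cvg z : pseries bescoef z @ \oo --> bes z.
Proof. exact: exp_bounded_cvg bescoef_bounded. Qed.

Lemma is_derive_bes z : is_derive z (1 : R) bes (bes1 z).
Proof. exact: exp_bounded_derive bescoef_bounded. Qed.

Lemma bes0 : bes 0 = 1.
Proof.
rewrite /bes; apply: lim_near_cst => //; near=> m.
have m0 : (0 < m)%N by near: m; exact: nbhs_infty_gt.
rewrite -(prednK m0) /pseries /series /= big_nat_recl //= expr0 mulr1.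
rewrite big1 ?addr0 => [|i _]; last by rewrite expr0n mulr0.
by rewrite /bescoef expr0 fact0 rfact0 mulr1 divr1.
Unshelve. all: by end_near. Qed.

Lemma continuous_bes : continuous bes.
Proof.
move=> z; apply: differentiable_continuous; apply/derivable1_diffP.
by have [] := is_derive_bes z.
Qed.

Lemma diffs_bescoef i :
  pseries_diffs bescoef i * (i%:R + nu + 1) = - bescoef i.
Proof.
have p0 : i%:R + nu + 1 != 0.
  by rewrite gt_eqF // addn_nu1_gt0.
rewrite /pseries_diffs /bescoef rfactSr factS natrM exprS add0r.
have r0 : rfact 0 i != 0 by rewrite gt_eqF // rfact_gt0.
have f0 : i`!%:R != 0 :> R by rewrite pnatr_eq0 -lt0n fact_gt0.
have -> : nu + 1 + i%:R = i%:R + nu + 1 by ring.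
by field; rewrite r0 f0 p0 nat1r pnatr_eq0.
Qed.

Definition bes2 z : R := limn (pseries (pseries_diffs (pseries_diffs bescoef)) z).

(** [pseries_diffs_equiv] writes the series of [bes2] without index shift; the combined partial sums
    then vanish term by term, by [diffs_bescoef]. *)
Lemma bes_ode z : z * bes2 z + (nu + 1) * bes1 z + bes z = 0.
Proof.
have cb := bescoef_bounded; have db := exp_bounded_diffs cb.
have ddb := exp_bounded_diffs db.
have l2 := pseries_diffs_equiv (exp_bounded_cvg (z := z) ddb).
have l1 : pseries (pseries_diffs bescoef) z @ \oo --> bes1 z := exp_bounded_cvg db.
have l0 : pseries bescoef z @ \oo --> bes z := exp_bounded_cvg cb.
have L := cvgD (cvgD (cvgM (cvg_cst z) l2) (cvgM (cvg_cst (nu + 1)) l1)) l0.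
rewrite -[LHS](cvg_lim (@Rhausdorff R) (L _ _ _ _ _ _)); apply: lim_near_cst => //.
apply: nearW => n.
rewrite !fctE /= /pseries /series /= !mulr_sumr -!big_split /= big1 // => i _.
have -> : bescoef i = - (pseries_diffs bescoef i * (i%:R + nu + 1)).
  by rewrite diffs_bescoef opprK.
by case: i => [|i]; rewrite /= ?mul0r ?expr0 ?exprS; ring.
Qed.

Lemma is_derive_bes1 z : is_derive z (1 : R) bes1 (bes2 z).
Proof. exact: exp_bounded_derive (exp_bounded_diffs bescoef_bounded). Qed.

(* Energy of the Bessel equation: [bes z ^+ 2 + z * bes1 z ^+ 2] is nonincreasing
   because [2 * nu + 1 >= 0]. *)
Lemma bes_le1 z : 0 <= z -> `|bes z| <= 1.
Proof.
move=> z0.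
pose E : R -> R := bes * bes + id * (bes1 * bes1).
have dE x : is_derive x (1 : R) E (- (2 * nu + 1) * bes1 x ^+ 2).
  have d0 := is_derive_bes x; have d1 := is_derive_bes1 x.
  have dd := is_deriveD (is_deriveM d0 d0) (is_deriveM (is_derive_id x 1) (is_deriveM d1 d1)).
  apply: (is_derive_eq dd); rewrite /GRing.scale /=.
  have -> : bes x = - (x * bes2 x + (nu + 1) * bes1 x).
    by apply/eqP; rewrite -subr_eq0 opprK addrC bes_ode.
  rewrite /= fctE; ring.
have Ed : E z <= E 0.
  apply: (@ler0_derive1_nincry _ E 0) => //.
  - move=> x _; rewrite derive1E; have [_ ->] := dE x.
    by rewrite mulNr oppr_le0 mulr_ge0 ?sqr_ge0 //; have := hnu; lra.
  - apply: continuous_subspaceT => x; apply: differentiable_continuous.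
    by apply/derivable1_diffP; have [] := dE x.
have E0 : E 0 = 1 by rewrite /E /= !fctE /= bes0 mul0r mulr1 addr0.
rewrite -(ler_pXn2r (n := 2)) ?nnegrE // expr1n real_normK ?num_real //.
apply: le_trans (_ : E z <= 1); last by rewrite -E0.
by rewrite /E !fctE /= -!expr2 lerDl mulr_ge0 ?sqr_ge0.
Qed.

(** The limit of [phi nu] at 0, and by [bes_le1] a bound for [phi nu] on [R^+]. *)
Definition phicst : R := ((2 : R) `^ nu * Gamma (nu + 1))^-1.

Lemma phiE x : 0 < x -> phi nu x = phicst * bes (x ^+ 2 / 4).
Proof.
move=> x0; rewrite /phi /besselJ.
have p0 : (x / 2) `^ nu != 0 by rewrite gt_eqF // powR_gt0 // divr_gt0.
have G0 : Gamma (nu + 1) != 0 by rewrite gt_eqF // Gamma_gt0 // nu1_gt0.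
have term n : (-1) ^+ n / (n`!%:R * Gamma (n%:R + nu + 1)) * (x / 2) `^ (2 * n%:R + nu)
   = (x / 2) `^ nu / Gamma (nu + 1) * (bescoef n * (x ^+ 2 / 4) ^+ n).
  have x20 : 0 < x / 2 by rewrite divr_gt0.
  rewrite Gamma_rfact powRD ?(gt_eqF x20) ?implybT // -natrM powR_mulrn ?(ltW x20) //.
  rewrite exprM.
  have -> : (x / 2) ^+ 2 = x ^+ 2 / 4 by field.
  rewrite /bescoef; field.
  by rewrite G0 gt_eqF ?rfact_gt0 // pnatr_eq0 -lt0n fact_gt0.
rewrite (_ : series _ = fun n => (x / 2) `^ nu / Gamma (nu + 1) * pseries bescoef (x ^+ 2 / 4) n); last first.
  apply/funext => n; rewrite /pseries /series /= mulr_sumr.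
  by apply: eq_bigr => i _; exact: term.
have -> : limn (fun n => (x / 2) `^ nu / Gamma (nu + 1) * pseries bescoef (x ^+ 2 / 4) n)
   = (x / 2) `^ nu / Gamma (nu + 1) * bes (x ^+ 2 / 4).
  by apply/cvg_lim => //; apply: cvgM; [exact: cvg_cst|exact: bes_cvg].
rewrite /phicst powRM ?(ltW x0) ?invr_ge0 // powRN -[2^-1]powR_inv1 // powRAC powR_inv1 ?powR_ge0 //.
have h1 : x `^ nu != 0 by rewrite gt_eqF // powR_gt0.
have h2 : (2 : R) `^ nu != 0 by rewrite gt_eqF // powR_gt0.
by field; rewrite G0 h1 h2.
Qed.

End Bessel.

(** * Integrals over the half-line *)

Section IntegralRpos.
Variable R : realType.
Implicit Types (f g : R -> R) (s t x : R).
Local Notation mu := (@lebesgue_measure R).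

Definition intg f := mu.-integrable (@Rpos R) (EFin \o f).
Definition Int f : R := \int[mu]_(x in @Rpos R) f x.

Lemma eq_Int f g : (forall x, 0 < x -> f x = g x) -> Int f = Int g.
Proof. by move=> fg; apply: eq_Rintegral => x; rewrite RposE => /fg. Qed.

Lemma eq_intg f g : (forall x, 0 < x -> f x = g x) -> intg f -> intg g.
Proof.
move=> fg; apply: eq_integrable; first exact: measurable_Rpos.
by move=> x; rewrite RposE => x0; rewrite /= fg.
Qed.

Lemma IntE f : intg f -> ((Int f)%:E = \int[mu]_(x in @Rpos R) (f x)%:E)%E.
Proof.
by move=> h; rewrite /Int /Rintegral fineK // integrable_fin_num //; exact: measurable_Rpos.
Qed.

Lemma intg_measurable f : intg f -> measurable_fun (@Rpos R) f.
Proof. by move=> /measurable_int/measurable_EFinP. Qed.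

Lemma intgD f g : intg f -> intg g -> intg (fun x => f x + g x).
Proof.
move=> h1 h2; rewrite /intg (_ : EFin \o _ = (EFin \o f) \+ (EFin \o g))%E //.
by apply: integrableD => //; exact: measurable_Rpos.
Qed.

Lemma intgB f g : intg f -> intg g -> intg (fun x => f x - g x).
Proof.
move=> h1 h2; rewrite /intg (_ : EFin \o _ = (EFin \o f) \- (EFin \o g))%E //.
by apply: integrableB => //; exact: measurable_Rpos.
Qed.

Lemma intgZ c f : intg f -> intg (fun x => c * f x).
Proof.
move=> h1; rewrite /intg (_ : EFin \o _ = fun x => c%:E * (EFin \o f) x)%E //.
by apply: integrableZl => //; exact: measurable_Rpos.
Qed.

Lemma intg_abs f : intg f -> intg (fun x => `|f x|).
Proof. exact: integrable_norm. Qed.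

Lemma intg0 : intg (fun=> 0).
Proof. exact: integrable0. Qed.

Lemma intg_sum n (F : nat -> R -> R) : (forall i, intg (F i)) ->
  intg (fun x => \sum_(i < n) F i x).
Proof.
move=> h; elim: n => [|n IH].
  by apply: eq_intg intg0 => x _; rewrite big_ord0.
by apply: eq_intg (intgD IH (h n)) => x _; rewrite big_ord_recr.
Qed.

Lemma IntD f g : intg f -> intg g -> Int (fun x => f x + g x) = Int f + Int g.
Proof. by move=> h1 h2; apply: RintegralD => //; exact: measurable_Rpos. Qed.

Lemma IntB f g : intg f -> intg g -> Int (fun x => f x - g x) = Int f - Int g.
Proof. by move=> h1 h2; apply: RintegralB => //; exact: measurable_Rpos. Qed.

Lemma IntZ c f : intg f -> Int (fun x => c * f x) = c * Int f.
Proof. by move=> h1; apply: RintegralZl => //; exact: measurable_Rpos. Qed.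

Lemma Int_sum n (F : nat -> R -> R) : (forall i, intg (F i)) ->
  Int (fun x => \sum_(i < n) F i x) = \sum_(i < n) Int (F i).
Proof.
move=> h; elim: n => [|n IH].
  rewrite big_ord0 (@eq_Int _ (fun=> 0)) => [|x _]; last by rewrite big_ord0.
  by rewrite /Int /Rintegral integral0.
transitivity (Int (fun x => \sum_(i < n) F i x + F n x)).
  by apply: eq_Int => x _; rewrite big_ord_recr.
by rewrite IntD ?IH ?big_ord_recr //; exact: intg_sum.
Qed.

Lemma le_Int f g : intg f -> intg g -> (forall x, 0 < x -> f x <= g x) ->
  Int f <= Int g.
Proof.
move=> h1 h2 fg; apply: le_Rintegral => //; first exact: measurable_Rpos.
by move=> x /Rpos_gt0; exact: fg.
Qed.

Lemma Int_ge0 f : (forall x, 0 < x -> 0 <= f x) -> 0 <= Int f.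
Proof. by move=> h; apply: Rintegral_ge0 => x /Rpos_gt0; exact: h. Qed.

Lemma le_intg f g : measurable_fun (@Rpos R) f ->
  (forall x, 0 < x -> `|f x| <= g x) -> intg g -> intg f.
Proof.
move=> mf fg ig; apply: le_integrable ig; [exact: measurable_Rpos|exact/measurable_EFinP|].
by move=> x /Rpos_gt0 x0 /=; rewrite lee_fin (le_trans (fg x x0)) // ler_norm.
Qed.

Lemma ge0_intgP f : (forall x, 0 < x -> 0 <= f x) -> measurable_fun (@Rpos R) f ->
  (\int[mu]_(x in @Rpos R) (f x)%:E < +oo)%E -> intg f.
Proof.
move=> f0 mf h; apply/integrableP; split; first exact/measurable_EFinP.
apply: le_lt_trans h; rewrite le_eqVlt; apply/orP; left; apply/eqP.
by apply: eq_integral => x; rewrite RposE => x0; rewrite /= ger0_norm // f0.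
Qed.

Lemma Int_lty f : intg f -> (\int[mu]_(x in @Rpos R) (f x)%:E < +oo)%E.
Proof. by move=> h; rewrite -IntE // ltry. Qed.

Lemma intg_dominated (f_ : nat -> R -> R) f g :
  (forall n, measurable_fun (@Rpos R) (f_ n)) ->
  measurable_fun (@Rpos R) f ->
  (forall x, 0 < x -> f_ ^~ x @ \oo --> f x) ->
  intg g -> (forall n x, 0 < x -> `|f_ n x| <= g x) ->
  intg f /\ Int (f_ n) @[n --> \oo] --> Int f.
Proof.
move=> mf_ mf f_f ig f_g.
pose F_ n := EFin \o f_ n; pose F := EFin \o f.
have a1 n : measurable_fun (@Rpos R) (F_ n) by exact/measurable_EFinP.
have a2 : measurable_fun (@Rpos R) F by exact/measurable_EFinP.
have a3 : {ae mu, forall x, @Rpos R x -> F_ ^~ x @ \oo --> F x}.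
  apply/aeW => x /Rpos_gt0 x0; apply: cvg_EFin; first exact: nearW.
  exact: f_f.
have a4 : {ae mu, forall x n, @Rpos R x -> (`|F_ n x| <= (g x)%:E)%E}.
  by apply/aeW => x n /Rpos_gt0 x0; rewrite /= lee_fin f_g.
have [h1 _ h2] := @dominated_convergence _ _ R mu (@Rpos R) (@measurable_Rpos R)
  F_ F (EFin \o g) a1 a2 a3 ig a4.
by split => //; apply: fine_cvg; rewrite IntE.
Qed.

End IntegralRpos.

(** * Polynomial Gaussians and their moments *)

Section GaussianMoments.
Variables (R : realType) (nu : R).
Hypothesis hnu : - (1 / 2) < nu.
Implicit Types (f g : R -> R) (s t x : R) (p q : {poly R}).
Local Notation mu := (@lebesgue_measure R).

Definition wgt x : R := x `^ (2 * nu + 1).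

(** The polynomial is taken in [z = s x ^+ 2 / 2] rather than in [x]: this family is stable under
    [x ^+ 2] and [Delta_nu], and the transform maps it to the one of parameter [s^-1]. *)
Definition gq s q x : R := q.[s / 2 * x ^+ 2] * expR (- (s / 2 * x ^+ 2)).

(** The Jacobian constant in [x^(2 nu + 1) dx = mcst s * z^nu dz]. *)
Definition mcst s : R := (s / 2) `^ (- nu) / s.

(** The integral of [q(z) z^nu exp (- z)] over [R^+]; it does not involve [s]. *)
Definition moment q : R := \sum_(i < size q) q`_i * Gamma (i%:R + nu + 1).

Lemma wgt_ge0 x : 0 <= wgt x. Proof. exact: powR_ge0. Qed.

Lemma wgt_gt0 x : 0 < x -> 0 < wgt x. Proof. exact: powR_gt0. Qed.

Lemma continuous_wgt x : 0 < x -> {for x, continuous wgt}.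
Proof. exact: continuous_powR_pos. Qed.

Lemma mcst_gt0 s : 0 < s -> 0 < mcst s.
Proof. by move=> s0; rewrite divr_gt0 // powR_gt0 // divr_gt0. Qed.

Lemma continuous_sqrZ c x : {for x, continuous (fun x : R => c * x ^+ 2)}.
Proof.
have -> : (fun x : R => c * x ^+ 2) = (fun x => c * (x * x)) by apply/funext.
apply: continuousM; first exact: cst_continuous.
by apply: continuousM; exact: cvg_id.
Qed.

Lemma continuous_expN_sqr c x : {for x, continuous (fun x : R => expR (- (c * x ^+ 2)))}.
Proof.
apply: (@continuous_comp _ _ _ (fun x : R => - (c * x ^+ 2)) expR).
  by apply: continuousN; exact: continuous_sqrZ.
exact: continuous_expR.
Qed.

Lemma continuous_horner q : continuous (horner q : R -> R).
Proof.
by move=> x; apply: differentiable_continuous; apply/derivable1_diffP.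
Qed.

Lemma continuous_gq s q x : {for x, continuous (gq s q)}.
Proof.
apply: continuousM; last exact: continuous_expN_sqr.
apply: (@continuous_comp _ _ _ (fun x : R => s / 2 * x ^+ 2) (horner q)).
  exact: continuous_sqrZ.
exact: continuous_horner.
Qed.

Lemma gqD s p q x : gq s (p + q) x = gq s p x + gq s q x.
Proof. by rewrite /gq hornerD mulrDl. Qed.

Lemma gqZ s a q x : gq s (a *: q) x = a * gq s q x.
Proof. by rewrite /gq hornerZ mulrA. Qed.

Lemma gq_sum n s (F : nat -> {poly R}) x :
  gq s (\sum_(i < n) F i) x = \sum_(i < n) gq s (F i) x.
Proof. by rewrite /gq horner_sum mulr_suml. Qed.

Lemma gq_wgt_Xn s n x : 0 < s -> 0 < x ->
  gq s 'X^n x * wgt x =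
  (s / 2) `^ (- nu) / s * gammaf (n%:R + nu + 1) (s / 2 * x ^+ 2) * (s * x).
Proof.
move=> s0 x0; rewrite /gq /gammaf hornerXn addrK.
have z0 : 0 < s / 2 * x ^+ 2 by rewrite mulr_gt0 ?divr_gt0 // exprn_gt0.
rewrite powRD ?(gt_eqF z0) ?implybT // powR_mulrn ?(ltW z0) //.
rewrite (@powRM _ (s / 2)) ?divr_ge0 ?sqr_ge0 ?(ltW s0) //.
have -> : (x ^+ 2) `^ nu = x `^ (2 * nu).
  by rewrite -powR_mulrn ?(ltW x0) // -powRrM.
rewrite /wgt powRD ?(gt_eqF x0) ?implybT // powRr1 ?(ltW x0) // powRN.
have h : (s / 2) `^ nu != 0 by rewrite gt_eqF // powR_gt0 // divr_gt0.
by field; rewrite h gt_eqF.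
Qed.

Lemma integral_gq_Xn s n : 0 < s ->
  (\int[mu]_(x in @Rpos R) (gq s 'X^n x * wgt x)%:E =
   (mcst s * Gamma (n%:R + nu + 1))%:E)%E.
Proof.
move=> s0; have m0 := mcst_gt0 s0.
rewrite EFinM GammaE ?addn_nu1_gt0 //.
rewrite -ge0_integralZl_EFin ?(ltW m0) //=; last 3 first.
- exact: measurable_Rpos.
- by move=> x _; rewrite lee_fin gammaf_ge0.
- apply/measurable_EFinP; apply: continuous_measurable_Rpos => x; exact: continuous_gammaf.
rewrite (ge0_integral_sqr_subst (g := fun t => mcst s * gammaf (n%:R + nu + 1) t) s0).
- by apply: eq_integral => x; rewrite RposE => x0; rewrite gq_wgt_Xn.
- by move=> x x0; apply: continuousM; [exact: cst_continuous|exact: continuous_gammaf].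
- by move=> x _; apply: mulr_ge0; [exact: ltW|exact: gammaf_ge0].
Qed.

Lemma measurable_gq_wgt s q : measurable_fun (@Rpos R) (fun x => gq s q x * wgt x).
Proof.
apply: continuous_measurable_Rpos => x x0.
by apply: continuousM; [exact: continuous_gq|exact: continuous_wgt].
Qed.

Lemma intg_gq_Xn s n : 0 < s -> intg (fun x => gq s 'X^n x * wgt x).
Proof.
move=> s0; apply: ge0_intgP.
- move=> x x0; rewrite mulr_ge0 ?wgt_ge0 // mulr_ge0 ?expR_ge0 // hornerXn.
  by rewrite exprn_ge0 // mulr_ge0 ?sqr_ge0 // divr_ge0 // ltW.
- exact: measurable_gq_wgt.
- by rewrite integral_gq_Xn // ltry.
Qed.

Lemma gq_coef s q x : gq s q x = \sum_(i < size q) q`_i * gq s 'X^i x.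
Proof.
rewrite -{1}[q]coefK poly_def (gq_sum _ s (fun i => q`_i *: 'X^i)).
by apply: eq_bigr => i _; rewrite gqZ.
Qed.

Lemma intg_gq s q : 0 < s -> intg (fun x => gq s q x * wgt x).
Proof.
move=> s0; apply: eq_intg (intg_sum (size q) (fun i => intgZ q`_i (intg_gq_Xn i s0))).
move=> x x0; rewrite gq_coef mulr_suml; apply: eq_bigr => i _; exact: mulrA.
Qed.

Lemma Int_gq s q : 0 < s -> Int (fun x => gq s q x * wgt x) = mcst s * moment q.
Proof.
move=> s0.
transitivity (Int (fun x => \sum_(i < size q) q`_i * (gq s 'X^i x * wgt x))).
  by apply: eq_Int => x x0; rewrite gq_coef mulr_suml; apply: eq_bigr => i _; exact/esym/mulrA.
transitivity (\sum_(i < size q) Int (fun x => q`_i * (gq s 'X^i x * wgt x))).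
  exact: (@Int_sum R (size q) (fun i x => q`_i * (gq s 'X^i x * wgt x))
    (fun i => intgZ q`_i (intg_gq_Xn i s0))).
rewrite mulr_sumr.
apply: eq_bigr => i _; rewrite IntZ; last exact: intg_gq_Xn.
by rewrite /Int /Rintegral integral_gq_Xn //= mulrCA.
Qed.

(** The product of the exponentials has parameter [2 * s], whose variable is [2 z]; the composition
    halves it back. *)
Lemma gqM s p q x : gq s p x * gq s q x = gq (2 * s) ((p * q) \Po (2^-1 *: 'X)) x.
Proof.
rewrite /gq horner_comp hornerZ hornerX hornerM.
have -> : 2^-1 * (2 * s / 2 * x ^+ 2) = s / 2 * x ^+ 2 by lra.
have -> : - (2 * s / 2 * x ^+ 2) = - (s / 2 * x ^+ 2) + - (s / 2 * x ^+ 2) by lra.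
by rewrite expRD; ring.
Qed.

Lemma intg_gqM s p q : 0 < s -> intg (fun x => gq s p x * gq s q x * wgt x).
Proof.
move=> s0; have s20 : 0 < 2 * s by rewrite mulr_gt0.
by apply: eq_intg (intg_gq ((p * q) \Po (2^-1 *: 'X)) s20) => x _; rewrite gqM.
Qed.

End GaussianMoments.

(** * The Fourier--Bessel transform *)

Section Transform.
Variables (R : realType) (nu : R).
Hypothesis hnu : - (1 / 2) < nu.
Implicit Types (f g : R -> R) (s t x y : R) (p q : {poly R}).
Local Notation mu := (@lebesgue_measure R).
Local Notation wgt := (wgt nu).

Lemma series_exp_le t n : 0 <= t -> \sum_(i < n) t ^+ i / i`!%:R <= expR t.
Proof.
move=> t0; rewrite -(big_mkord xpredT (fun i => t ^+ i / i`!%:R)).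
apply: (nondecreasing_cvgn_le (u_ := series (exp_coeff t))).
  apply/nondecreasing_seqP => m; rewrite /series /= big_nat_recr //= lerDl.
  exact: exp_coeff_ge0.
exact: is_cvg_series_exp_coeff.
Qed.

Lemma exp_coeff_le t n : 0 <= t -> t ^+ n / n`!%:R <= expR t.
Proof.
move=> t0; apply: le_trans (series_exp_le n.+1 t0).
rewrite big_ord_recr /= lerDr sumr_ge0 // => i _.
exact: (exp_coeff_ge0 i t0).
Qed.

Lemma series_shift (b : nat -> R) (v l : R) :
  series (fun i => v ^+ i / i`!%:R * b i) @ \oo --> l ->
  series (fun i => v ^+ i / i`!%:R * (i%:R * b i.-1)) @ \oo --> v * l.
Proof.
move=> h; rewrite -cvg_shiftS /=.
rewrite (_ : (fun n => _) = (fun n => v * series (fun i => v ^+ i / i`!%:R * b i) n)).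
  by apply: cvgM => //; exact: cvg_cst.
apply/funext => n; rewrite /series /= big_nat_recl // mul0r mulr0 add0r mulr_sumr.
apply: eq_bigr => i _; rewrite exprS factS natrM; field.
by rewrite nat1r !pnatr_eq0 -lt0n fact_gt0.
Qed.

(** Kummer's transformation of [1F1(nu + 1 + k; nu + 1; - v)]. Both sides obey the same three-term
    recurrence in [k], by [rfact_rec] and [lagp_rec], and agree for [k = 0, 1]. *)
Lemma series_lagp (v : R) k :
  series (fun i => (- v) ^+ i / i`!%:R * rfact nu i k) @ \oo -->
  (lagp nu k).[v] * expR (- v).
Proof.
pose P k := series (fun i => (- v) ^+ i / i`!%:R * rfact nu i k) @ \oo -->
  (lagp nu k).[v] * expR (- v).
have P0 : P 0%N.
  rewrite /P lagp0 hornerE mul1r.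
  rewrite (_ : (fun i => _) = exp_coeff (- v)); first exact: is_cvg_series_exp_coeff.
  by apply/funext => i; rewrite rfact0 mulr1.
have P1 : P 1%N.
  rewrite /P.
  have L := cvgD (cvgM (cvg_cst (nu + 1)) P0) (series_shift P0).
  rewrite (_ : series _ = (fun n => (nu + 1) * series (fun i => (- v) ^+ i / i`!%:R * rfact nu i 0) n
     + series (fun i => (- v) ^+ i / i`!%:R * (i%:R * rfact nu i.-1 0)) n)); last first.
    apply/funext => n; rewrite /series /= mulr_sumr -big_split /=.
    by apply: eq_bigr => i _; rewrite rfact_rec0; ring.
  have -> : (lagp nu 1).[v] * expR (- v) =
     (nu + 1) * ((lagp nu 0).[v] * expR (- v)) + - v * ((lagp nu 0).[v] * expR (- v)).
    by rewrite lagpS lagp0 !poly.derivE !hornerE /=; ring.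
  exact: L.
suff : P k /\ P k.+1 by case.
elim: k => [//|k [IH0 IH1]]; split => //.
have L := cvgB (cvgD (cvgM (cvg_cst (2 * k.+1%:R + nu + 1)) IH1) (series_shift IH1))
  (cvgM (cvg_cst (k.+1%:R * (k.+1%:R + nu))) IH0).
rewrite /P (_ : series _ = (fun n => (2 * k.+1%:R + nu + 1) *
    series (fun i => (- v) ^+ i / i`!%:R * rfact nu i k.+1) n
    + series (fun i => (- v) ^+ i / i`!%:R * (i%:R * rfact nu i.-1 k.+1)) n
    - k.+1%:R * (k.+1%:R + nu) * series (fun i => (- v) ^+ i / i`!%:R * rfact nu i k) n)); last first.
  apply/funext => n; rewrite /series /= !mulr_sumr -big_split -sumrB /=.
  by apply: eq_bigr => i _; rewrite rfact_rec; ring.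
have -> : (lagp nu k.+2).[v] * expR (- v) =
   (2 * k.+1%:R + nu + 1) * ((lagp nu k.+1).[v] * expR (- v))
   + - v * ((lagp nu k.+1).[v] * expR (- v))
   - k.+1%:R * (k.+1%:R + nu) * ((lagp nu k).[v] * expR (- v)).
  by rewrite lagp_rec !hornerE /=; ring.
exact: L.
Qed.

Definition FB f y : R := Int (fun x => phi nu (x * y) * f x * wgt x).

(* Unlike [phi nu], [phi'] is continuous on the whole line: the powers of [x] are cancelled. *)
Definition phi' x : R := phicst nu * bes nu (x ^+ 2 / 4).

Lemma phicst_gt0 : 0 < phicst nu.
Proof. by rewrite invr_gt0 mulr_gt0 ?powR_gt0 ?Gamma_gt0 ?nu1_gt0. Qed.

Lemma phi'_le x : `|phi' x| <= phicst nu.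
Proof.
rewrite /phi' normrM (ger0_norm (ltW phicst_gt0)) ler_piMr ?(ltW phicst_gt0) //.
by apply: bes_le1 => //; rewrite divr_ge0 ?sqr_ge0.
Qed.

Lemma continuous_phi' : continuous phi'.
Proof.
move=> x; apply: cvgM; first exact: cvg_cst.
apply: (@continuous_comp _ _ _ (fun x : R => x ^+ 2 / 4) (bes nu)); last exact: continuous_bes.
rewrite (_ : (fun x : R => x ^+ 2 / 4) = (fun x => 4^-1 * x ^+ 2)).
  exact: continuous_sqrZ.
by apply/funext => u; rewrite mulrC.
Qed.

Lemma continuous_phi'M y x : {for x, continuous (fun x => phi' (x * y))}.
Proof.
apply: (@continuous_comp _ _ _ (fun x : R => x * y) phi'); last exact: continuous_phi'.
by apply: cvgM; [exact: cvg_id|exact: cvg_cst].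
Qed.

Lemma FBE f y : 0 < y -> FB f y = Int (fun x => phi' (x * y) * (f x * wgt x)).
Proof. by move=> y0; apply: eq_Int => x x0; rewrite phiE ?mulr_gt0 // -mulrA. Qed.

Lemma intg_phi' (c : R -> R) y : intg c -> intg (fun x => phi' (x * y) * c x).
Proof.
move=> ic; apply: le_intg (intgZ (phicst nu) (intg_abs ic)).
  apply: measurable_funM; last exact: intg_measurable.
  by apply: continuous_measurable_Rpos => x _; exact: continuous_phi'M.
by move=> x x0; rewrite normrM ler_wpM2r // phi'_le.
Qed.

(** The Bessel series is integrated term by term against the Gaussian. The moment
    [Gamma (i + k + nu + 1)] is [rfact 0 i * rfact i k * Gamma (nu + 1)]; its first factor cancels
    the one in [bescoef i], which leaves [series_lagp]. *)
Lemma FB_gq_Xn s k y : 0 < s -> 0 < y ->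
  FB (gq s 'X^k) y = s `^ (- (nu + 1)) * gq s^-1 (lagp nu k) y.
Proof.
move=> s0 y0; rewrite FBE //; pose v := s^-1 / 2 * y ^+ 2.
have v0 : 0 < v by rewrite mulr_gt0 ?divr_gt0 ?invr_gt0 // exprn_gt0.
pose f_ n x := \sum_(i < n) phicst nu * bescoef nu i * v ^+ i * (gq s 'X^(i + k) x * wgt x).
(* The i-th term is at most [(4 v)^i / i! * (z / 2)^i / i!]. The first quotient is at most
   [exp (4 v)], the second ones sum to at most [exp (z / 2)], which leaves [exp (- z / 2)], a
   Gaussian of parameter [s / 2]; [2^k] corrects [(z / 2)^k]. *)
pose g x := phicst nu * expR (4 * v) * 2 ^+ k * (gq (s / 2) 'X^k x * wgt x).
have ig i : intg (fun x => phicst nu * bescoef nu i * v ^+ i * (gq s 'X^(i + k) x * wgt x)).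
  by apply: intgZ; exact: intg_gq_Xn.
have f_E n x : 0 < x -> f_ n x =
    phicst nu * pseries (bescoef nu) ((x * y) ^+ 2 / 4) n * (gq s 'X^k x * wgt x).
  move=> x0; rewrite /f_ /pseries /series /= big_mkord mulr_sumr mulr_suml.
  apply: eq_bigr => i _; rewrite /gq !hornerXn exprD.
  have -> : (x * y) ^+ 2 / 4 = v * (s / 2 * x ^+ 2).
    by rewrite /v; field; rewrite gt_eqF.
  move: (s / 2 * x ^+ 2) (expR _) (wgt x) => z e w; rewrite (exprMn i v z).
  move: (v ^+ i) (z ^+ i) (z ^+ k) => a b c; ring.
pose F x := phi' (x * y) * (gq s 'X^k x * wgt x).
have mf_ n : measurable_fun (@Rpos R) (f_ n).
  exact: (intg_measurable (intg_sum n ig)).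
have mF : measurable_fun (@Rpos R) F.
  exact: (intg_measurable (intg_phi' y (intg_gq_Xn hnu k s0))).
have cv x : 0 < x -> f_ ^~ x @ \oo --> F x.
  move=> x0; rewrite (_ : f_ ^~ x = fun n => phicst nu * pseries (bescoef nu) ((x * y) ^+ 2 / 4) n * (gq s 'X^k x * wgt x)).
    apply: cvgM; last exact: cvg_cst.
    by apply: cvgM; [exact: cvg_cst|exact: bes_cvg].
  by apply/funext => n; rewrite f_E.
have intgg : intg g.
  by apply: intgZ; apply: intg_gq_Xn; rewrite // divr_gt0.
have dom n x : 0 < x -> `|f_ n x| <= g x.
  move=> x0; have z0 : 0 < s / 2 * x ^+ 2 by rewrite mulr_gt0 ?divr_gt0 // exprn_gt0.
  rewrite f_E //.
  have v40 : 0 <= 4 * v by rewrite mulr_ge0 // ltW.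
  have -> : (x * y) ^+ 2 / 4 = v * (s / 2 * x ^+ 2).
    by rewrite /v; field; rewrite gt_eqF.
  rewrite /g /gq !hornerXn; have -> : s / 2 / 2 * x ^+ 2 = (s / 2 * x ^+ 2) / 2 by ring.
  move: (s / 2 * x ^+ 2) z0 => z z0.
  have w0 := wgt_ge0 nu x; have p0 := phicst_gt0.
  have zk : 0 <= z ^+ k by rewrite exprn_ge0 // ltW.
  have -> : phicst nu * expR (4 * v) * 2 ^+ k * ((z / 2) ^+ k * expR (- (z / 2)) * wgt x) =
    phicst nu * (expR (4 * v) * expR (z / 2)) * (z ^+ k * expR (- z) * wgt x).
    have -> : expR (- (z / 2)) = expR (z / 2) * expR (- z).
      by rewrite -expRD; congr expR; field.
    have -> : z ^+ k = 2 ^+ k * (z / 2) ^+ k by rewrite -exprMn; congr (_ ^+ _); field.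
    move: (expR _) (expR _) (expR _) (2 ^+ k) ((z / 2) ^+ k) => a b c d e; ring.
  rewrite normrM (ger0_norm (x := _ * _ * wgt x)); last first.
    by rewrite mulr_ge0 // mulr_ge0 // expR_ge0.
  apply: ler_wpM2r; first by rewrite mulr_ge0 // mulr_ge0 // expR_ge0.
  rewrite normrM (ger0_norm (ltW p0)) ler_wpM2l ?(ltW p0) //.
  rewrite /pseries /series /= big_mkord; apply: (le_trans (ler_norm_sum _ _ _)).
  apply: (@le_trans _ _ (\sum_(i < n) expR (4 * v) * ((z / 2) ^+ i / i`!%:R))); last first.
    rewrite -mulr_sumr ler_wpM2l ?expR_ge0 //.
    by apply: series_exp_le; rewrite divr_ge0 // ltW.
  apply: ler_sum => i _; rewrite normrM [`|(v * z) ^+ i|]ger0_norm; last first.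
    by rewrite exprn_ge0 // mulr_ge0 // ltW.
  have vz0 : 0 <= (v * z) ^+ i by rewrite exprn_ge0 // mulr_ge0 // ltW.
  apply: (le_trans (ler_wpM2r vz0 (norm_bescoef hnu i))).
  have -> : 2 ^+ i / i`!%:R / i`!%:R * (v * z) ^+ i =
    ((4 * v) ^+ i / i`!%:R) * ((z / 2) ^+ i / i`!%:R).
    have -> : 2 ^+ i / i`!%:R / i`!%:R * (v * z) ^+ i =
       (2 ^+ i * (v * z) ^+ i) / i`!%:R / i`!%:R by ring.
    have -> : (4 * v) ^+ i / i`!%:R * ((z / 2) ^+ i / i`!%:R) =
       ((4 * v) ^+ i * (z / 2) ^+ i) / i`!%:R / i`!%:R by ring.
    by rewrite -!exprMn; congr (_ ^+ _ / _ / _); field.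
  apply: ler_wpM2r; last exact: exp_coeff_le.
  by rewrite divr_ge0 ?exprn_ge0 ?divr_ge0 ?ler0n // ltW.
have [_ L] := intg_dominated mf_ mF cv intgg dom.
have E n : Int (f_ n) = s `^ (- (nu + 1)) *
    series (fun i => (- v) ^+ i / i`!%:R * rfact nu i k) n.
  rewrite (Int_sum n ig) /series /= big_mkord mulr_sumr; apply: eq_bigr => i _.
  rewrite IntZ; last exact: intg_gq_Xn.
  rewrite /Int /Rintegral integral_gq_Xn //=.
  rewrite Gamma_rfact // rfactD.
  have -> : mcst nu s = s `^ (- (nu + 1)) * 2 `^ nu.
    rewrite /mcst powRM ?(ltW s0) // ?invr_ge0 //.
    rewrite -[2^-1]powR_inv1 // -powRrM mulN1r opprK opprD powRD; last first.
      by rewrite (gt_eqF s0) implybT.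
    by rewrite powR_inv1 ?(ltW s0) //; ring.
  rewrite /bescoef /phicst [(- v) ^+ i]exprNn; field.
  have n0 : (0 : R) < 2 by [].
  rewrite (gt_eqF (Gamma_gt0 (nu1_gt0 hnu))) (gt_eqF (powR_gt0 nu n0)).
  by rewrite (gt_eqF (rfact_gt0 hnu 0 i)) pnatr_eq0 -lt0n fact_gt0.
rewrite (funext E) in L.
have L2 : (fun n => s `^ (- (nu + 1)) *
    series (fun i => (- v) ^+ i / i`!%:R * rfact nu i k) n) @ \oo -->
    s `^ (- (nu + 1)) * ((lagp nu k).[v] * expR (- v)).
  by apply: cvgM; [exact: cvg_cst|exact: series_lagp].
exact: cvg_unique L L2.
Qed.

Lemma intg_phi'_gq s q y : 0 < s -> intg (fun x => phi' (x * y) * (gq s q x * wgt x)).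
Proof. by move=> s0; apply: intg_phi'; exact: intg_gq. Qed.

Lemma FB_gq s q y : 0 < s -> 0 < y ->
  FB (gq s q) y = s `^ (- (nu + 1)) * gq s^-1 (lapT nu q) y.
Proof.
move=> s0 y0; rewrite FBE //.
transitivity (Int (fun x => \sum_(i < size q) q`_i * (phi' (x * y) * (gq s 'X^i x * wgt x)))).
  apply: eq_Int => x x0; rewrite gq_coef mulr_suml mulr_sumr.
  by apply: eq_bigr => i _; rewrite -[q`_i * _ * _]mulrA mulrCA.
transitivity (\sum_(i < size q) q`_i * FB (gq s 'X^i) y).
  transitivity (\sum_(i < size q) Int (fun x => q`_i * (phi' (x * y) * (gq s 'X^i x * wgt x)))).
    exact: (@Int_sum R (size q) (fun i x => q`_i * (phi' (x * y) * (gq s 'X^i x * wgt x)))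
      (fun i => intgZ q`_i (intg_phi'_gq 'X^i y s0))).
  apply: eq_bigr => i _; rewrite IntZ; last exact: intg_phi'_gq.
  by rewrite FBE.
rewrite {2}/gq /lapT horner_sum mulr_suml mulr_sumr; apply: eq_bigr => i _.
by rewrite FB_gq_Xn // hornerZ /gq; ring.
Qed.

End Transform.

(** * Moving the transform across an integral *)

Section MultiplicationFormula.
Variables (R : realType) (nu : R).
Hypothesis hnu : - (1 / 2) < nu.
Local Notation mu := (@lebesgue_measure R).
Local Notation phi' := (phi' nu).
Variables (a b : R -> R).
Hypotheses (ia : intg a) (ib : intg b).

(** With [a] and [b] extended by zero, Fubini applies to the whole plane. *)
Let at_ : R -> R := a \_ (@Rpos R).
Let bt_ : R -> R := b \_ (@Rpos R).
Let H (z : R * R) : \bar R := (phi' (z.1 * z.2) * at_ z.1 * bt_ z.2)%:E.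

Let iat : mu.-integrable setT (EFin \o at_).
Proof.
have := (@integrable_mkcond _ _ R mu (@Rpos R) (EFin \o a) (@measurable_Rpos R)).1 ia.
by rewrite -restrict_EFin.
Qed.

Let ibt : mu.-integrable setT (EFin \o bt_).
Proof.
have := (@integrable_mkcond _ _ R mu (@Rpos R) (EFin \o b) (@measurable_Rpos R)).1 ib.
by rewrite -restrict_EFin.
Qed.

Let mat : measurable_fun setT at_.
Proof. by apply/measurable_EFinP; exact: measurable_int iat. Qed.

Let mbt : measurable_fun setT bt_.
Proof. by apply/measurable_EFinP; exact: measurable_int ibt. Qed.

Let mH : measurable_fun setT H.
Proof.
apply/measurable_EFinP; apply: measurable_funM; last first.
  by apply: (measurableT_comp mbt); exact: measurable_snd.
apply: measurable_funM; last first.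
  by apply: (measurableT_comp mat); exact: measurable_fst.
apply: (measurableT_comp (continuous_measurable_fun (continuous_phi' hnu))).
by apply: measurable_funM; [exact: measurable_fst|exact: measurable_snd].
Qed.

Let Kb : \bar R := (\int[mu]_x `|(bt_ x)%:E|)%E.

(** By Tonelli: the kernel is bounded by [phicst nu], so the double integral of [|H|] is at most
    [phicst nu] times the product of the L1 norms. *)
Let iH : (mu \x mu)%E.-integrable setT H.
Proof.
apply/(@integrable12ltyP _ _ _ _ R mu mu H mH).
have p0 := ltW (phicst_gt0 hnu).
have [_ Ka_fin] := integrableP _ _ _ iat.
have [_ Kb_fin] := integrableP _ _ _ ibt.
have Kb0 : (0 <= Kb)%E by apply: integral_ge0.
have mabs (c : R -> R) : measurable_fun setT c -> measurable_fun setT (fun x => `|(c x)%:E|%E).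
  by move=> mc; apply: measurableT_comp => //; exact/measurable_EFinP.
have inner x : (\int[mu]_y `|H (x, y)| <= ((phicst nu)%:E * `|(at_ x)%:E|) * Kb)%E.
  rewrite -ge0_integralZl //; last 2 first.
  - exact: mabs.
  - by rewrite mule_ge0 // lee_fin.
  apply: ge0_le_integral => //.
  - have mx : measurable_fun setT (fun y => phi' (x * y) * at_ x * bt_ y); last first.
      by apply: measurableT_comp => //; exact/measurable_EFinP.
    apply: measurable_funM => //.
    apply: measurable_funM; last exact: measurable_cst.
    apply: (measurableT_comp (continuous_measurable_fun (continuous_phi' hnu))).
    exact: mulrl_measurable.
  - by apply: measurable_funeM; exact: mabs.
  - move=> y _; rewrite /H /= !lee_fin 2!normrM.
    by rewrite ler_wpM2r // ler_wpM2r // phi'_le.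
apply: (@le_lt_trans _ _ (\int[mu]_x (((phicst nu)%:E * Kb) * `|(at_ x)%:E|))%E).
  apply: ge0_le_integral => //.
  - by move=> x _; apply: integral_ge0.
  - apply: (@measurable_fun_fubini_tonelli_F _ _ _ _ R mu (abse \o H)).
      exact: measurableT_comp.
    by move=> z; exact: abse_ge0.
  - by apply: measurable_funeM; exact: mabs.
  - by move=> x _; apply: (le_trans (inner x)); rewrite muleAC.
rewrite ge0_integralZl //.
- rewrite lte_mul_pinfty //; first by rewrite mule_ge0 // lee_fin.
  by rewrite fin_numM // ge0_fin_numE.
- exact: mabs.
- by rewrite mule_ge0 // lee_fin.
Qed.

(** The transform with the weight absorbed into [c], which makes the multiplication formula
    symmetric in its two functions; [FB_trans] translates back. *)
Definition trans (c : R -> R) y : R := Int (fun x => phi' (x * y) * c x).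

Let H_y y : (\int[mu]_x H (x, y) = (trans a y * bt_ y)%:E)%E.
Proof.
have -> : (trans a y * bt_ y)%:E = ((bt_ y)%:E * \int[mu]_(x in @Rpos R) (phi' (x * y) * a x)%:E)%E.
  by rewrite /trans -IntE ?intg_phi' // -EFinM mulrC.
rewrite -integralZl //; [|exact: measurable_Rpos|exact: intg_phi'].
rewrite [RHS]integral_mkcond; apply: eq_integral => x _.
rewrite /H /= /at_ !patchE; case: ifPn => _ /=; last by rewrite mulr0 mul0r.
by rewrite -EFinM mulrC.
Qed.

Let H_x x : (\int[mu]_y H (x, y) = (trans b x * at_ x)%:E)%E.
Proof.
have -> : (trans b x * at_ x)%:E = ((at_ x)%:E * \int[mu]_(y in @Rpos R) (phi' (y * x) * b y)%:E)%E.
  by rewrite /trans -IntE ?intg_phi' // -EFinM mulrC.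
rewrite -integralZl //; [|exact: measurable_Rpos|exact: intg_phi'].
rewrite [RHS]integral_mkcond; apply: eq_integral => y _.
rewrite /H /= /bt_ !patchE; case: ifPn => _ /=; last by rewrite mulr0.
by rewrite -EFinM [y * x]mulrC mulrC mulrCA mulrA.
Qed.

Let patch_mul (c d : R -> R) x : (c x * (d \_ (@Rpos R)) x)%:E =
  ((fun x => (c x * d x)%:E) \_ (@Rpos R)) x.
Proof. by rewrite !patchE; case: ifPn => //= _; rewrite mulr0. Qed.

Lemma intg_trans_mul : intg (fun x => trans b x * a x).
Proof.
apply/(@integrable_mkcond _ _ R mu (@Rpos R) (EFin \o (fun x => trans b x * a x)) (@measurable_Rpos R)).
have := @integrable_fubini_F _ _ _ _ R mu mu H iH.
apply: eq_integrable => // x _; rewrite /fubini_F H_x.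
exact: patch_mul.
Qed.

Lemma trans_Fubini : Int (fun y => trans a y * b y) = Int (fun x => trans b x * a x).
Proof.
rewrite /Int /Rintegral; congr fine.
rewrite [LHS]integral_mkcond [RHS]integral_mkcond.
transitivity (\int[mu]_y (trans a y * bt_ y)%:E)%E.
  by apply: eq_integral => y _; rewrite /bt_ patch_mul.
transitivity (\int[mu]_x (trans b x * at_ x)%:E)%E; last first.
  by apply: eq_integral => x _; rewrite /at_ patch_mul.
have E1 : (\int[mu]_y (trans a y * bt_ y)%:E = \int[mu]_y \int[mu]_x H (x, y))%E.
  by apply: eq_integral => y _; rewrite H_y.
have E2 : (\int[mu]_x (trans b x * at_ x)%:E = \int[mu]_x \int[mu]_y H (x, y))%E.
  by apply: eq_integral => x _; rewrite H_x.
rewrite E1 E2; apply/esym; exact: (@Fubini _ _ _ _ R mu mu H iH).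
Qed.

End MultiplicationFormula.

Section MultiplicationFormulaFB.
Variables (R : realType) (nu : R).
Hypothesis hnu : - (1 / 2) < nu.
Implicit Types (f : R -> R) (s : R) (q : {poly R}).
Local Notation wgt := (wgt nu).

Lemma FB_trans f y : 0 < y -> FB nu f y = trans nu (fun x => f x * wgt x) y.
Proof. exact: FBE. Qed.

(* [trans nu c] times a positive Gaussian weight is a Fubini marginal, hence measurable. *)
Lemma measurable_trans (c : R -> R) : intg c -> measurable_fun (@Rpos R) (trans nu c).
Proof.
move=> ic; have s1 : (0 : R) < 1 by [].
have ig := intg_gq hnu 1 s1.
have m := intg_measurable (intg_trans_mul hnu ig ic).
have mi : measurable_fun (@Rpos R) (fun x => (gq 1 1 x * wgt x)^-1).
  apply: continuous_measurable_Rpos => x x0.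
  apply: (@continuousV _ _ (fun x => gq 1 1 x * wgt x)).
    rewrite mulf_neq0 // ?gt_eqF ?wgt_gt0 //.
    by rewrite /gq hornerE mul1r expR_gt0.
  by apply: continuousM; [exact: continuous_gq|exact: continuous_wgt].
apply: eq_measurable_fun (measurable_funM m mi) => x; rewrite RposE => x0.
rewrite /= mulfK // mulf_neq0 // ?gt_eqF ?wgt_gt0 //.
by rewrite /gq hornerE mul1r expR_gt0.
Qed.

Lemma FB_gq_Fubini f s q : 0 < s -> intg (fun x => f x * wgt x) ->
  Int (fun y => FB nu f y * (gq s q y * wgt y)) =
  Int (fun x => FB nu (gq s q) x * (f x * wgt x)).
Proof.
move=> s0 fi; have ig := intg_gq hnu q s0.
transitivity (Int (fun y => trans nu (fun x => f x * wgt x) y * (gq s q y * wgt y))).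
  by apply: eq_Int => y y0; rewrite FB_trans.
rewrite (trans_Fubini hnu fi ig).
by apply: eq_Int => y y0; rewrite FB_trans.
Qed.

End MultiplicationFormulaFB.

(** * Density of the polynomial Gaussians *)

Section Bernstein.
Variable R : realType.
Implicit Types (g h : nat -> R) (u v : R) (n : nat).

(** De Casteljau's recursion for Bernstein polynomials: the mean of [g] under the binomial law of
    parameters [n] and [u]. Without binomial coefficients, the moment formulas become short
    inductions. *)
Fixpoint bern n g u : R :=
  if n is m.+1 then u * bern m (fun k => g k.+1) u + (1 - u) * bern m g u
  else g 0%N.

Fixpoint bernp n g : {poly R} :=
  if n is m.+1 then 'X * bernp m (fun k => g k.+1) + (1 - 'X) * bernp m g
  else (g 0%N)%:P.

Lemma horner_bernp n g u : (bernp n g).[u] = bern n g u.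
Proof.
elim: n g => [|n IH] g; first by rewrite /= hornerC.
by rewrite /= hornerD !hornerM hornerD hornerN hornerX hornerC !IH.
Qed.

Lemma le_bern n g h u : 0 <= u <= 1 -> (forall k, (k <= n)%N -> g k <= h k) ->
  bern n g u <= bern n h u.
Proof.
move=> u01; elim: n g h => [|n IH] g h gh /=; first exact: gh.
have /andP[u0 u1] := u01.
apply: lerD; apply: ler_wpM2l; rewrite ?subr_ge0 //; apply: IH => k kn.
  exact: gh.
by apply: gh; exact: leqW.
Qed.

Lemma bern_lin n g h a b u :
  bern n (fun k => a * g k + b * h k) u = a * bern n g u + b * bern n h u.
Proof. by elim: n g h => [|n IH] g h //=; rewrite !IH; ring. Qed.

Lemma bern_cst n a u : bern n (fun=> a) u = a.
Proof. by elim: n => [|n IH] //=; rewrite IH; ring. Qed.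

(** The second moment is taken about an arbitrary centre because the induction replaces [c] by
    [c - 1]. *)
Lemma bern_var n c u : bern n (fun k => (k%:R - c) ^+ 2) u =
  (n%:R * u - c) ^+ 2 + n%:R * (u * (1 - u)).
Proof.
elim: n c => [|n IH] c; first by rewrite /= !mul0r addr0.
rewrite [LHS]/=.
have E : bern n (fun k => (k.+1%:R - c) ^+ 2) u = bern n (fun k => (k%:R - (c - 1)) ^+ 2) u.
  by congr (bern _ _ _); apply/funext => k; rewrite -natr1; congr (_ ^+ 2); ring.
by rewrite E !IH -natr1; ring.
Qed.

(** Bernstein's argument through Chebyshev's inequality. Convergence is pointwise, at a point of
    continuity; dominated convergence does the rest in [appr_bounded]. *)
Lemma bern_cvg (G : R -> R) M u : 0 <= u <= 1 -> (forall v, `|G v| <= M) ->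
  {for u, continuous G} ->
  bern n.+1 (fun k => G (k%:R / n.+1%:R)) u @[n --> \oo] --> G u.
Proof.
move=> u01 GM cG; apply/cvgrPdist_le => e e0.
have M0 : 0 <= M := le_trans (normr_ge0 _) (GM 0).
have e20 : 0 < e / 2 by rewrite divr_gt0.
have /cvgrPdist_lt/(_ _ e20)/nbhs_ballP[d /= d0 dG] := cG.
have near_n : \forall n \near \oo, 2 * M / d ^+ 2 * (n.+1%:R^-1) <= e / 2.
  have L : (fun n => 2 * M / d ^+ 2 * harmonic n) @ \oo --> 2 * M / d ^+ 2 * 0.
    by apply: cvgM; [exact: cvg_cst|exact: cvg_harmonic].
  rewrite mulr0 in L.
  have /cvgrPdist_le/(_ _ e20) := L; apply: filterS => n.
  by rewrite sub0r normrN; apply: le_trans; exact: ler_norm.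
near=> n.
have hn : 2 * M / d ^+ 2 * (n.+1%:R^-1) <= e / 2 by near: n.
have n0 : 0 < n.+1%:R :> R by rewrite ltr0n.
pose V k : R := (k%:R - n.+1%:R * u) ^+ 2.
(* Chosen so that [K * V k >= 2 * M] as soon as [k / n.+1] is at distance at least [d] from [u]. *)
pose K : R := 2 * M / d ^+ 2 / n.+1%:R ^+ 2.
have K0 : 0 <= K by rewrite divr_ge0 ?sqr_ge0 // divr_ge0 ?sqr_ge0 // mulr_ge0.
have pt k : `|G u - G (k%:R / n.+1%:R)| <= e / 2 + K * V k.
  have V0 : 0 <= K * V k by rewrite mulr_ge0 ?sqr_ge0.
  have [lt_d|ge_d] := ltP `|u - k%:R / n.+1%:R| d.
    by apply: (le_trans (ltW (dG _ lt_d))); rewrite lerDl.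
  have Vd : d ^+ 2 * n.+1%:R ^+ 2 <= V k.
    have -> : V k = (u - k%:R / n.+1%:R) ^+ 2 * n.+1%:R ^+ 2.
      by rewrite /V; field; rewrite gt_eqF.
    rewrite ler_wpM2r ?sqr_ge0 // -[leRHS]real_normK ?num_real //.
    by rewrite lerXn2r ?nnegrE ?(ltW d0).
  apply: (@le_trans _ _ (2 * M)).
    by apply: (le_trans (ler_normB _ _)); have := GM u; have := GM (k%:R / n.+1%:R); lra.
  apply: (@le_trans _ _ (K * V k)); last by rewrite lerDr ltW.
  have -> : 2 * M = K * (d ^+ 2 * n.+1%:R ^+ 2).
    by rewrite /K; field; rewrite !gt_eqF.
  by rewrite ler_wpM2l.
have sumV : bern n.+1 (fun k => 1 * (e / 2) + K * V k) u <= e.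
  rewrite bern_lin bern_cst /V bern_var subrr expr0n add0r mul1r.
  pose A := 2 * M / d ^+ 2 / n.+1%:R; have hA : A <= e / 2 := hn.
  have -> : K * (n.+1%:R * (u * (1 - u))) = A * (u * (1 - u)).
    by rewrite /K /A; field; rewrite !gt_eqF.
  have /andP[u0 u1] := u01.
  have h : u * (1 - u) <= 1 by rewrite mulr_ile1 ?subr_ge0 // lerBlDr lerDl.
  have h2 : 0 <= A by rewrite divr_ge0 ?(ltW n0) // divr_ge0 ?sqr_ge0 // mulr_ge0.
  move: (ler_wpM2l h2 h) hA; clear; move: A (u * (1 - u)) => A B; lra.
have E : G u - bern n.+1 (fun k => G (k%:R / n.+1%:R)) u
   = bern n.+1 (fun k => 1 * G u + (-1) * G (k%:R / n.+1%:R)) u.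
  by rewrite bern_lin bern_cst; ring.
rewrite E ler_norml; apply/andP; split.
  rewrite lerNl.
  have -> : - bern n.+1 (fun k => 1 * G u + -1 * G (k%:R / n.+1%:R)) u
    = bern n.+1 (fun k => (-1) * G u + 1 * G (k%:R / n.+1%:R)) u.
    by rewrite !bern_lin; ring.
  apply: (le_trans _ sumV); apply: le_bern => // k _.
  have := pt k; rewrite ler_norml => /andP[]; lra.
apply: (le_trans _ sumV); apply: le_bern => // k _.
have := pt k; rewrite ler_norml => /andP[]; lra.
Unshelve. all: by end_near. Qed.

Lemma bern_bound (g : nat -> R) M n u : 0 <= u <= 1 -> (forall k, `|g k| <= M) ->
  `|bern n g u| <= M.
Proof.
move=> u01 gM; rewrite ler_norml; apply/andP; split.
  rewrite -[leLHS](bern_cst n (- M) u); apply: le_bern => // k _.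
  by have := gM k; rewrite ler_norml => /andP[].
rewrite -[leRHS](bern_cst n M u); apply: le_bern => // k _.
by have := gM k; rewrite ler_norml => /andP[].
Qed.

End Bernstein.

Section Density.

Variables (R : realType) (nu : R).
Hypothesis hnu : - (1 / 2) < nu.
Variable s : R.
Hypothesis s0 : 0 < s.
Implicit Types (f g h : R -> R) (q : {poly R}).

Lemma continuous_mul f g x : {for x, continuous f} -> {for x, continuous g} ->
  {for x, continuous (fun x => f x * g x)}.
Proof. by move=> cf cg; exact: cvgM. Qed.

Local Notation wgt := (wgt nu).

Definition l2 f := measurable_fun (@Rpos R) f /\ intg (fun x => f x ^+ 2 * wgt x).

Lemma measurable_wgt : measurable_fun (@Rpos R) wgt.
Proof. by apply: continuous_measurable_Rpos => x x0; exact: continuous_wgt. Qed.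

Lemma measurable_sqr_wgt f : measurable_fun (@Rpos R) f ->
  measurable_fun (@Rpos R) (fun x => f x ^+ 2 * wgt x).
Proof. by move=> mf; apply: measurable_funM measurable_wgt; exact: measurable_funX. Qed.

Lemma l2_le f g : measurable_fun (@Rpos R) f -> l2 g ->
  (forall x, 0 < x -> `|f x| <= `|g x|) -> l2 f.
Proof.
move=> mf [mg ig] fg; split => //; apply: le_intg ig; first exact: measurable_sqr_wgt.
move=> x x0; rewrite normrM (ger0_norm (wgt_ge0 nu x)) ler_wpM2r ?wgt_ge0 //.
rewrite normrX -[leRHS]real_normK ?num_real // lerXn2r ?nnegrE //; exact: fg.
Qed.

Lemma l2M f g : l2 f -> l2 g -> intg (fun x => f x * g x * wgt x).
Proof.
move=> [mf fi] [mg ig]; apply: (le_intg _ _ (intgD fi ig)).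
  by apply: measurable_funM measurable_wgt; exact: measurable_funM.
move=> x x0; rewrite -mulrDl normrM (ger0_norm (wgt_ge0 nu x)) ler_wpM2r ?wgt_ge0 //.
rewrite ler_norml; apply/andP; split.
  by have := sqr_ge0 (f x + g x); have := sqr_ge0 (f x); have := sqr_ge0 (g x); nra.
by have := sqr_ge0 (f x - g x); have := sqr_ge0 (f x); have := sqr_ge0 (g x); nra.
Qed.

Lemma l2Z a f : l2 f -> l2 (fun x => a * f x).
Proof.
move=> [mf fi]; split; first by apply: measurable_funM.
by apply: eq_intg (intgZ (a ^+ 2) fi) => x _; rewrite exprMn mulrA.
Qed.

Lemma l2D f g : l2 f -> l2 g -> l2 (fun x => f x + g x).
Proof.
move=> lf lg; have [mf fi] := lf; have [mg ig] := lg; split.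
  exact: measurable_funD.
apply: eq_intg (intgD (intgD fi ig) (intgZ 2 (l2M lf lg))) => x _; ring.
Qed.

Lemma l2N f : l2 f -> l2 (fun x => - f x).
Proof.
move=> lf; have [mf fi] := l2Z (-1) lf; split.
  by move: mf; congr (measurable_fun _ _); apply/funext => x; rewrite mulN1r.
by apply: eq_intg fi => x _; rewrite mulN1r.
Qed.

Lemma l2B f g : l2 f -> l2 g -> l2 (fun x => f x - g x).
Proof. by move=> lf lg; exact: l2D lf (l2N lg). Qed.

Lemma l2_gq q : l2 (gq s q).
Proof.
split; first by apply: continuous_measurable_Rpos => x _; exact: continuous_gq.
by apply: eq_intg (intg_gqM hnu q q s0) => x _; rewrite expr2.
Qed.

Definition dist2 f g : R := Int (fun x => (f x - g x) ^+ 2 * wgt x).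

(** The closure of the polynomial Gaussians of parameter [s] in the weighted L2 space. *)
Definition appr f := l2 f /\ forall e, 0 < e -> exists q, dist2 f (gq s q) <= e.

Lemma dist2_trans f g h : l2 f -> l2 g -> l2 h ->
  dist2 f h <= 2 * dist2 f g + 2 * dist2 g h.
Proof.
move=> lf lg lh; have [_ fg] := l2B lf lg; have [_ gh] := l2B lg lh.
have [_ fh] := l2B lf lh.
rewrite /dist2 -!IntZ // -IntD; try exact: intgZ.
apply: le_Int => //; first by apply: intgD; exact: intgZ.
move=> x x0; rewrite !mulrA -mulrDl ler_wpM2r ?wgt_ge0 //.
have := sqr_ge0 (f x - g x - (g x - h x)); nra.
Qed.

Lemma appr_lim f : l2 f ->
  (forall e, 0 < e -> exists2 g, appr g & dist2 f g <= e) -> appr f.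
Proof.
move=> lf H; split => // e e0; have e4 : 0 < e / 4 by rewrite divr_gt0.
have [g [lg Hg] fg] := H _ e4; have [q gq_] := Hg _ e4.
exists q; apply: (le_trans (dist2_trans lf lg (l2_gq q))); lra.
Qed.

Lemma appr_gq q : appr (gq s q).
Proof.
split; first exact: l2_gq.
move=> e e0; exists q; rewrite /dist2 (@eq_Int _ _ (fun=> 0)) => [|x _].
  by rewrite /Int /Rintegral integral0 ltW.
by rewrite subrr expr0n mul0r.
Qed.

Lemma apprZD a f g : appr f -> appr g -> appr (fun x => a * f x + g x).
Proof.
move=> [lf Hf] [lg Hg]; have la := l2Z a lf; have lag := l2D la lg.
split => // e e0; have K0 : 0 < 2 * (1 + a ^+ 2) by rewrite mulr_gt0 // ltr_pwDl ?sqr_ge0.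
(* From [(a F + G)^2 <= 2 a^2 F^2 + 2 G^2], with [1 + a^2] for [a^2] to keep the divisor
   positive. *)
have [|q fq] := Hf (e / 2 / (2 * (1 + a ^+ 2))); first by rewrite !divr_gt0.
have [|r gr] := Hg (e / 4); first by rewrite divr_gt0.
exists (a *: q + r).
have [_ i1] := l2B lf (l2_gq q); have [_ i2] := l2B lg (l2_gq r).
have [_ i3] := l2B lag (l2_gq (a *: q + r)).
apply: (@le_trans _ _ (2 * (1 + a ^+ 2) * dist2 f (gq s q) + 2 * dist2 g (gq s r))).
  rewrite /dist2 -!IntZ // -IntD; try exact: intgZ.
  apply: le_Int => //; first by apply: intgD; exact: intgZ.
  move=> x x0; rewrite !mulrA -mulrDl ler_wpM2r ?wgt_ge0 // gqD gqZ.
  move: (f x) (gq s q x) (g x) (gq s r x) => F Q G' R'.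
  have := sqr_ge0 (a * (F - Q) - (G' - R')); have := sqr_ge0 (F - Q); nra.
have : 2 * (1 + a ^+ 2) * dist2 f (gq s q) <= e / 2.
  by rewrite mulrC -ler_pdivlMr.
lra.
Qed.

Lemma appr_dominated (f_ : nat -> R -> R) f g : (forall n, appr (f_ n)) ->
  measurable_fun (@Rpos R) f -> l2 g ->
  (forall x, 0 < x -> f_ ^~ x @ \oo --> f x) ->
  (forall x, 0 < x -> `|f x| <= g x) ->
  (forall n x, 0 < x -> `|f_ n x| <= g x) ->
  appr f.
Proof.
move=> af_ mf lg f_f fg f_g; have [mg ig] := lg.
have lf : l2 f.
  by apply: (l2_le mf lg) => x x0; apply: (le_trans (fg x x0)); exact: ler_norm.
apply: appr_lim => // e e0.
pose d n x := (f x - f_ n x) ^+ 2 * wgt x.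
have md n : measurable_fun (@Rpos R) (d n).
  by apply: measurable_sqr_wgt; apply: measurable_funB => //; have [[]] := af_ n.
have dc x : 0 < x -> d ^~ x @ \oo --> (0 : R).
  move=> x0; rewrite -[X in _ --> X](mul0r (wgt x)); apply: cvgM; last exact: cvg_cst.
  have L : (f x - f_ n x) @[n --> \oo] --> (0 : R).
    by rewrite -[X in _ --> X](subrr (f x)); apply: cvgB; [exact: cvg_cst|exact: f_f].
  by rewrite -[X in _ --> X](mulr0 (0 : R)); exact: cvgM.
have dom n x : 0 < x -> `|d n x| <= 4 * (g x ^+ 2 * wgt x).
  move=> x0; rewrite normrM (ger0_norm (wgt_ge0 nu x)) mulrA ler_wpM2r ?wgt_ge0 //.
  rewrite ger0_norm ?sqr_ge0 //.
  have g0 : 0 <= g x := le_trans (normr_ge0 _) (fg x x0).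
  have -> : 4 * g x ^+ 2 = (2 * g x) ^+ 2 by ring.
  rewrite -[leLHS]real_normK ?num_real // lerXn2r ?nnegrE ?mulr_ge0 //.
  by apply: (le_trans (ler_normB _ _)); have := fg x x0; have := f_g n x x0; lra.
have [_ L] := intg_dominated md (measurable_cst (0 : R)) dc (intgZ 4 ig) dom.
rewrite (_ : Int (cst 0) = 0) in L; last by rewrite /Int /Rintegral integral0.
have /cvgrPdist_le/(_ _ e0)[N _ /(_ N (leqnn N))] := L.
rewrite /= sub0r normrN => h; exists (f_ N) => //.
by apply: le_trans h; exact: ler_norm.
Qed.

(** [q(z) exp (- z)] times the i-th power of [u = exp (- z / 2)]. The half in the exponent of [u]
    matters: its Taylor sums are bounded by [exp (z / 2)], and [exp (- z) exp (z / 2)] is still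
    square integrable. *)
Definition eg i q (x : R) : R :=
  q.[s / 2 * x ^+ 2] * expR (- ((1 + i%:R / 2) * (s / 2 * x ^+ 2))).

Lemma continuous_eg i q x : {for x, continuous (eg i q)}.
Proof.
apply: continuous_mul.
  apply: (@continuous_comp _ _ _ (fun x : R => s / 2 * x ^+ 2) (horner q)).
    exact: continuous_sqrZ.
  exact: continuous_horner.
rewrite (_ : (fun _ => _) = fun x => expR (- ((1 + i%:R / 2) * (s / 2) * x ^+ 2))).
  exact: continuous_expN_sqr.
by apply/funext => u; rewrite mulrA.
Qed.

Lemma zval_gt0 x : 0 < x -> 0 < s / 2 * x ^+ 2.
Proof. by move=> x0; rewrite mulr_gt0 ?divr_gt0 // exprn_gt0. Qed.

(* Induction on [i]: [exp (- z / 2)] is the limit of its Taylor polynomials, dominated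
   by [exp (z / 2)], which the factor [exp (- z)] absorbs. *)
Lemma appr_eg i q : appr (eg i q).
Proof.
elim: i q => [|i IH] q.
  have -> : eg 0 q = gq s q by apply/funext => x; rewrite /eg /gq mul0r addr0 mul1r.
  exact: appr_gq.
pose T n : {poly R} := \sum_(k < n) ((- 2^-1) ^+ k / k`!%:R) *: 'X^k.
pose g x := `|q.[s / 2 * x ^+ 2]| * expR (- (s / 2 * x ^+ 2 / 2)).
have TE n z : (T n).[z] = series (exp_coeff (- (z / 2))) n.
  rewrite /T horner_sum /series /= big_mkord; apply: eq_bigr => k _.
  rewrite hornerZ hornerXn /exp_coeff /=.
  have -> : - (z / 2) = - 2^-1 * z by ring.
  by rewrite exprMn mulrAC.
have decay x : 0 < x -> expR (- ((1 + i%:R / 2) * (s / 2 * x ^+ 2))) <= expR (- (s / 2 * x ^+ 2)).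
  move=> x0; rewrite ler_expR lerN2 mulrDl mul1r lerDl mulr_ge0 ?divr_ge0 //.
  exact: ltW (zval_gt0 x0).
have mg : measurable_fun (@Rpos R) g.
  apply: continuous_measurable_Rpos => x _; apply: continuous_mul.
    apply: (@continuous_comp _ _ _ (fun x : R => q.[s / 2 * x ^+ 2]) Num.norm).
      apply: (@continuous_comp _ _ _ (fun x : R => s / 2 * x ^+ 2) (horner q)).
        exact: continuous_sqrZ.
      exact: continuous_horner.
    exact: norm_continuous.
  rewrite (_ : (fun _ => _) = fun x => expR (- (s / 2 / 2 * x ^+ 2))).
    exact: continuous_expN_sqr.
  by apply/funext => u; rewrite [in RHS]mulrAC.
have lg : l2 g.
  split => //; apply: eq_intg (intg_gq hnu (q * q) s0) => x x0.
  rewrite /g exprMn real_normK ?num_real // /gq hornerM -expr2; congr (_ * _ * _).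
  by rewrite -expRM_natl; congr expR; field.
apply: (@appr_dominated (fun n => eg i (q * T n)) _ g) => //.
- by apply: continuous_measurable_Rpos => x _; exact: continuous_eg.
- move=> x x0; rewrite (_ : (fun n => _) = (fun n => q.[s / 2 * x ^+ 2] *
      series (exp_coeff (- (s / 2 * x ^+ 2 / 2))) n * expR (- ((1 + i%:R / 2) * (s / 2 * x ^+ 2))))); last first.
    by apply/funext => n; rewrite /eg hornerM TE.
  have -> : eg i.+1 q x = q.[s / 2 * x ^+ 2] * expR (- (s / 2 * x ^+ 2 / 2)) *
     expR (- ((1 + i%:R / 2) * (s / 2 * x ^+ 2))).
    by rewrite /eg -[RHS]mulrA -expRD -[i.+1%:R]natr1; congr (_ * expR _); field.
  apply: cvgM; last exact: cvg_cst.
  by apply: cvgM; [exact: cvg_cst|exact: is_cvg_series_exp_coeff].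
- move=> x x0; rewrite /eg /g normrM (ger0_norm (expR_ge0 _)) ler_wpM2l //.
  rewrite ler_expR lerN2 -[i.+1%:R]natr1; have z0 := zval_gt0 x0.
  have := mulr_ge0 (ler0n R i) (ltW z0); move: (s / 2 * x ^+ 2) z0 => z z0 iz.
  have -> : (1 + (i%:R + 1) / 2) * z = z + z / 2 + i%:R * z / 2 by field.
  lra.
- move=> n x x0; rewrite /eg /g hornerM !normrM (ger0_norm (expR_ge0 _)) -mulrA ler_wpM2l //.
  apply: (le_trans (ler_wpM2l (normr_ge0 _) (decay x x0))).
  have z0 := zval_gt0 x0; move: (s / 2 * x ^+ 2) z0 => z z0.
  have -> : - (z / 2) = z / 2 + - z by field.
  rewrite expRD ler_wpM2r ?expR_ge0 // TE /series /=.
  apply: (le_trans (ler_norm_sum _ _ _)); rewrite big_mkord.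
  have z20 : 0 <= z / 2 by rewrite divr_ge0 // ltW.
  apply: le_trans (series_exp_le n z20); apply: ler_sum => k _.
  by rewrite /exp_coeff /= normrM normrX normrN (ger0_norm z20) ger0_norm ?invr_ge0.
Qed.

Lemma appr_sum n (F : nat -> R -> R) (a : nat -> R) : (forall i, appr (F i)) ->
  appr (fun x => \sum_(i < n) a i * F i x).
Proof.
move=> aF; elim: n => [|n IH].
  have -> : (fun x => \sum_(i < 0) a i * F i x) = gq s 0.
    by apply/funext => x; rewrite big_ord0 /gq horner0 mul0r.
  exact: appr_gq.
have -> : (fun x => \sum_(i < n.+1) a i * F i x) =
    (fun x => a n * F n x + \sum_(i < n) a i * F i x).
  by apply/funext => x; rewrite big_ord_recr addrC.
exact: apprZD.
Qed.

(* [u = exp (- z / 2)] maps [R^+] onto [(0, 1)]; bounded functions of [u] are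
   approximated by their Bernstein polynomials. *)
Lemma appr_bounded (M : R) (G : R -> R) : (forall v, `|G v| <= M) ->
  (forall u : R, 0 < u < 1 -> {for u, continuous G}) ->
  appr (fun x : R => expR (- (s / 2 * x ^+ 2)) * G (expR (- (s / 2 * x ^+ 2 / 2)))).
Proof.
move=> GM cG.
pose U (x : R) := expR (- (s / 2 * x ^+ 2 / 2)).
have U01 (x : R) : 0 < x -> 0 < U x < 1.
  by move=> x0; rewrite expR_gt0 expR_lt1 oppr_lt0 divr_gt0 // zval_gt0.
have cU (x : R) : {for x, continuous U}.
  rewrite (_ : U = fun x => expR (- (s / 2 / 2 * x ^+ 2))).
    exact: continuous_expN_sqr.
  by apply/funext => u; rewrite /U [in RHS]mulrAC.
have cfull (x : R) : 0 < x -> {for x, continuous (fun x : R => expR (- (s / 2 * x ^+ 2)) * G (U x))}.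
  move=> x0; apply: continuous_mul; first exact: continuous_expN_sqr.
  by apply: (@continuous_comp _ _ _ U G); [exact: cU|apply: cG; exact: U01].
pose B n : {poly R} := bernp n.+1 (fun k => G (k%:R / n.+1%:R)).
have l2M1 : l2 (fun x => M * gq s 1 x) by apply: l2Z; exact: l2_gq.
have M0 : 0 <= M := le_trans (normr_ge0 _) (GM 0).
have gq1 x : gq s 1 x = expR (- (s / 2 * x ^+ 2)) by rewrite /gq hornerE mul1r.
apply: (@appr_dominated (fun n (x : R) => expR (- (s / 2 * x ^+ 2)) * (B n).[U x]) _
    (fun x => M * gq s 1 x)) => //.
- move=> n.
  have -> : (fun x : R => expR (- (s / 2 * x ^+ 2)) * (B n).[U x]) =
     (fun x => \sum_(i < size (B n)) (B n)`_i * eg i 1 x).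
    apply/funext => x; rewrite horner_coef mulr_sumr; apply: eq_bigr => i _.
    have h1 (z : R) : (1 : {poly R}).[z] = 1 by rewrite hornerE.
    rewrite /eg h1 mul1r mulrCA; congr (_ * _).
    by rewrite /U -expRM_natl -expRD; congr expR; field.
  exact: (@appr_sum _ (fun i => eg i 1) (fun i => (B n)`_i) (fun i => appr_eg i 1)).
- exact: continuous_measurable_Rpos.
- move=> x x0; apply: cvgM; first exact: cvg_cst.
  have /andP[u0 u1] := U01 x x0.
  rewrite (_ : (fun _ => _) = fun n => bern n.+1 (fun k => G (k%:R / n.+1%:R)) (U x)).
    by apply: (@bern_cvg _ G M); rewrite ?(ltW u0) ?(ltW u1) //; apply: cG; rewrite u0.
  by apply/funext => n; rewrite horner_bernp.
- move=> x x0; rewrite gq1 normrM (ger0_norm (expR_ge0 _)) mulrC ler_wpM2r ?expR_ge0 //.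
- move=> n x x0; rewrite gq1 normrM (ger0_norm (expR_ge0 _)) mulrC ler_wpM2r ?expR_ge0 //.
  have /andP[u0 u1] := U01 x x0.
  by rewrite horner_bernp; apply: bern_bound; rewrite ?(ltW u0) ?(ltW u1).
Qed.

(* A continuous truncation of [v] to [[- n.+1, n.+1]]. *)
Definition clamp n (v : R) : R := v / (1 + `|v| / n.+1%:R).

Lemma clamp_den n (v : R) : 1 <= 1 + `|v| / n.+1%:R.
Proof. by rewrite lerDl divr_ge0. Qed.

Lemma clamp_le_norm n (v : R) : `|clamp n v| <= `|v|.
Proof.
have h := clamp_den n v; have h0 := lt_le_trans ltr01 h.
rewrite /clamp normrM normfV (ger0_norm (ltW h0)) ler_pdivrMr //.
by rewrite ler_peMr.
Qed.

Lemma clamp_bound n (v : R) : `|clamp n v| <= n.+1%:R.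
Proof.
have h := clamp_den n v; have h0 := lt_le_trans ltr01 h.
have n0 : 0 < n.+1%:R :> R by rewrite ltr0n.
rewrite /clamp normrM normfV (ger0_norm (ltW h0)) ler_pdivrMr //.
by rewrite mulrDr mulr1 mulrC divfK ?gt_eqF // lerDr ltW.
Qed.

Lemma continuous_clamp n : continuous (clamp n).
Proof.
move=> v; apply: cvgM; first exact: cvg_id.
apply: cvgV; first by rewrite gt_eqF // (lt_le_trans ltr01) ?clamp_den.
apply: cvgD; first exact: cvg_cst.
by apply: cvgM; [exact: norm_continuous|exact: cvg_cst].
Qed.

Lemma clamp_cvg (v : R) : clamp n v @[n --> \oo] --> v.
Proof.
rewrite -[X in _ --> X]divr1; apply: cvgM; first exact: cvg_cst.
apply: cvgV; first exact: oner_neq0.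
rewrite -[X in _ --> X]addr0; apply: cvgD; first exact: cvg_cst.
rewrite -[X in _ --> X](mulr0 `|v|); apply: cvgM; [exact: cvg_cst|exact: cvg_harmonic].
Qed.

(** Write [f] as [exp (- z)] times a function of [u = exp (- z / 2)], possibly unbounded near 0 and
    1. Clamping makes it bounded, hence fit for [appr_bounded]; since clamping only shrinks, [|f|]
    dominates. *)
Lemma appr_continuous f : (forall x, 0 < x -> {for x, continuous f}) -> l2 f -> appr f.
Proof.
move=> cf lf.
(* The inverse of [x |-> u]: here [z = - 2 ln u], so that [exp (- (2 * ln u))] below is [exp z]. *)
pose X (u : R) : R := Num.sqrt (- (4 / s * ln u)).
pose G n (u : R) : R := clamp n (f (X u) * expR (- (2 * ln u))).
have XU (x : R) : 0 < x -> X (expR (- (s / 2 * x ^+ 2 / 2))) = x.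
  move=> x0; rewrite /X expRK.
  have -> : - (4 / s * - (s / 2 * x ^+ 2 / 2)) = x ^+ 2 by field; rewrite gt_eqF.
  by rewrite sqrtr_sqr gtr0_norm.
have X0 (u : R) : 0 < u < 1 -> 0 < X u.
  move=> u01; rewrite sqrtr_gt0 oppr_gt0 pmulr_rlt0 ?divr_gt0 //.
  exact: ln_lt0.
have cX (u : R) : 0 < u -> {for u, continuous X}.
  move=> u0; apply: (@continuous_comp _ _ _ (fun u : R => - (4 / s * ln u)) Num.sqrt).
    by apply: cvgN; apply: cvgM; [exact: cvg_cst|exact: continuous_ln].
  exact: sqrt_continuous.
have cG n (u : R) : 0 < u < 1 -> {for u, continuous (G n)}.
  move=> u01; have /andP[u0 _] := u01.
  apply: (@continuous_comp _ _ _ (fun u => f (X u) * expR (- (2 * ln u))) (clamp n)).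
    apply: cvgM.
      by apply: (@continuous_comp _ _ _ X f); [exact: cX|apply: cf; exact: X0].
    apply: (@continuous_comp _ _ _ (fun u : R => - (2 * ln u)) expR).
      by apply: cvgN; apply: cvgM; [exact: cvg_cst|exact: continuous_ln].
    exact: continuous_expR.
  exact: continuous_clamp.
have GU n (x : R) : 0 < x -> G n (expR (- (s / 2 * x ^+ 2 / 2))) =
    clamp n (f x * expR (s / 2 * x ^+ 2)).
  by move=> x0; rewrite /G XU // expRK; congr (clamp _ (_ * expR _)); field.
have ee (z : R) : expR (- z) * expR z = 1 by rewrite -expRD addNr expR0.
apply: (@appr_dominated (fun n (x : R) => expR (- (s / 2 * x ^+ 2)) *
    G n (expR (- (s / 2 * x ^+ 2 / 2)))) _ (fun x => `|f x|)) => //.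
- move=> n; apply: (@appr_bounded n.+1%:R); last exact: cG.
  by move=> v; exact: clamp_bound.
- exact: continuous_measurable_Rpos.
- have [mf fi] := lf; split; first exact: measurableT_comp.
  by apply: eq_intg fi => x _; rewrite real_normK ?num_real.
- move=> x x0.
  have -> : f x = expR (- (s / 2 * x ^+ 2)) * (f x * expR (s / 2 * x ^+ 2)).
    by rewrite mulrCA ee mulr1.
  apply: cvgM; first exact: cvg_cst.
  rewrite (_ : (fun _ => _) = fun n => clamp n (f x * expR (s / 2 * x ^+ 2))).
    exact: clamp_cvg.
  by apply/funext => n; rewrite GU.
- move=> n x x0; rewrite GU // normrM (ger0_norm (expR_ge0 _)).
  apply: (le_trans (ler_wpM2l (expR_ge0 _) (clamp_le_norm _ _))).
  by rewrite normrM (ger0_norm (expR_ge0 _)) mulrCA ee mulr1.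
Qed.

End Density.

(** * The uncertainty inequality *)

Section Uncertainty.
Variables (R : realType) (nu : R).
Hypothesis hnu : - (1 / 2) < nu.
Variable s : R.
Hypothesis s0 : 0 < s.
Implicit Types (f g h : R -> R) (p q : {poly R}).
Local Notation wgt := (wgt nu).
Local Notation l2 := (l2 nu).
Local Notation L := (lag nu).

Definition pair f q : R := Int (fun x => f x * gq s q x * wgt x).

Lemma intg_pair f q : l2 f -> intg (fun x => f x * gq s q x * wgt x).
Proof. by move=> lf; apply: l2M => //; exact: l2_gq. Qed.

Lemma pairZD f a p q : l2 f -> pair f (a *: p + q) = a * pair f p + pair f q.
Proof.
move=> lf; rewrite /pair -IntZ ?intg_pair // -IntD ?intg_pair //; last first.
  by apply: intgZ; exact: intg_pair.
by apply: eq_Int => x _; rewrite gqD gqZ; ring.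
Qed.

Lemma pair0 f : pair f 0 = 0.
Proof.
rewrite /pair (@eq_Int _ _ (fun=> 0)) => [|x _].
  by rewrite /Int /Rintegral integral0.
by rewrite /gq horner0 mul0r mulr0 mul0r.
Qed.

Lemma pairZ f a p : l2 f -> pair f (a *: p) = a * pair f p.
Proof. by move=> lf; rewrite -[a *: p]addr0 pairZD // pair0 addr0. Qed.

Lemma pairD f p q : l2 f -> pair f (p + q) = pair f p + pair f q.
Proof. by move=> lf; rewrite -[p in LHS]scale1r pairZD // mul1r. Qed.

Lemma pair_sum f n (a : nat -> R) (p : nat -> {poly R}) : l2 f ->
  pair f (\sum_(i < n) a i *: p i) = \sum_(i < n) a i * pair f (p i).
Proof.
move=> lf; elim: n => [|n IH]; first by rewrite !big_ord0 pair0.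
by rewrite !big_ord_recr /= addrC pairZD // IH addrC.
Qed.

Lemma pair_sym p q : pair (gq s p) q = pair (gq s q) p.
Proof. by apply: eq_Int => x _; rewrite [gq s p x * _]mulrC. Qed.

Lemma pair_sqr_ge0 q : 0 <= pair (gq s q) q.
Proof.
apply: Int_ge0 => x _; rewrite mulr_ge0 ?wgt_ge0 // -expr2; exact: sqr_ge0.
Qed.

(** Degenerate Cauchy-Schwarz. It settles the case of a zero divisor in the Laguerre coefficients,
    so no norm has to be computed. *)
Lemma pair_eq0 f q : l2 f -> pair (gq s q) q = 0 -> pair f q = 0.
Proof.
move=> lf N0; apply/eqP/negPn/negP => P0.
have lq := l2_gq hnu s0 q; have [_ fi] := lf.
pose I := Int (fun x => f x ^+ 2 * wgt x).
(* Makes [I - 2 * t * pair f q] equal to [-1], although it bounds an integral of a square. *)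
pose t := (I + 1) / (2 * pair f q).
have : 0 <= I - 2 * t * pair f q + t ^+ 2 * pair (gq s q) q.
  rewrite /I /pair -!IntZ ?intg_pair // -IntB // ?(intgZ _ (intg_pair q lf)) //.
  rewrite -IntD ?intgB ?(intgZ _ (intg_pair q lf)) ?(intgZ _ (intg_pair q lq)) //.
  apply: Int_ge0 => x x0.
  have -> : f x ^+ 2 * wgt x - 2 * t * (f x * gq s q x * wgt x)
     + t ^+ 2 * (gq s q x * gq s q x * wgt x) = (f x - t * gq s q x) ^+ 2 * wgt x by ring.
  by rewrite mulr_ge0 ?sqr_ge0 ?wgt_ge0.
rewrite N0 mulr0 addr0 /t.
have -> : I - 2 * ((I + 1) / (2 * pair f q)) * pair f q = - 1 by field.
by rewrite oppr_ge0 ler10.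
Qed.

Lemma gq_mulX t q x : gq t ('X * q) x = t / 2 * x ^+ 2 * gq t q x.
Proof. by rewrite /gq hornerM hornerX; exact/esym/mulrA. Qed.

Lemma sqr_form_x f q : l2 f -> intg (fun x => x ^+ 2 * f x ^+ 2 * wgt x) ->
  2 * pair f ('X * q) - pair (gq s q) ('X * q) <=
  s / 2 * Int (fun x => x ^+ 2 * f x ^+ 2 * wgt x).
Proof.
move=> lf ix; have lq := l2_gq hnu s0 q.
rewrite -subr_ge0 opprB /pair -!IntZ ?intg_pair //.
have i1 := intgZ (s / 2) ix; have i2 := intgZ 2 (intg_pair ('X * q) lf).
have i3 := intg_pair ('X * q) lq.
rewrite addrCA -IntB // -IntD //; last exact: intgB.
apply: Int_ge0 => x x0; rewrite !gq_mulX.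
have -> : gq s q x * (s / 2 * x ^+ 2 * gq s q x) * wgt x +
   (s / 2 * (x ^+ 2 * f x ^+ 2 * wgt x) - 2 * (f x * (s / 2 * x ^+ 2 * gq s q x) * wgt x))
   = s / 2 * x ^+ 2 * (f x - gq s q x) ^+ 2 * wgt x by ring.
by rewrite mulr_ge0 ?wgt_ge0 // mulr_ge0 ?sqr_ge0 // mulr_ge0 ?sqr_ge0 // divr_ge0 // ltW.
Qed.

(** Fubini moves the transform onto the Gaussian, where [lapT_mulX] turns ['X] into [lapp]; the
    power of [s] cancels the factor of [FB_gq] at [s^-1]. *)
Lemma FB_pair f k : l2 f -> intg (fun x => f x * wgt x) ->
  s `^ (- (nu + 1)) * Int (fun y => FB nu f y * (gq s^-1 ('X * k) y * wgt y)) =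
  pair f (lapp nu (lapT nu k)).
Proof.
move=> lf fi; have si0 : 0 < s^-1 by rewrite invr_gt0.
rewrite FB_gq_Fubini // /pair -IntZ.
  apply: eq_Int => x x0; rewrite FB_gq // lapT_mulX invrK.
  have -> : s^-1 `^ (- (nu + 1)) = (s `^ (- (nu + 1)))^-1.
    by rewrite -[s^-1]powR_inv1 ?(ltW s0) // powRAC powR_inv1 // powR_ge0.
  by field; rewrite gt_eqF // powR_gt0.
apply: eq_intg (intg_trans_mul hnu fi (intg_gq hnu ('X * k) si0)) => x x0.
by rewrite FB_trans.
Qed.

Lemma FB_measurable f : intg (fun x => f x * wgt x) ->
  measurable_fun (@Rpos R) (FB nu f).
Proof.
move=> fi; apply: eq_measurable_fun (measurable_trans hnu fi) => x.
by rewrite RposE => x0; rewrite FB_trans.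
Qed.

Lemma intg_FB_gq f t k : 0 < t -> intg (fun x => f x * wgt x) ->
  intg (fun y => FB nu f y * (gq t k y * wgt y)).
Proof.
move=> t0 fi; apply: eq_intg (intg_trans_mul hnu (intg_gq hnu k t0) fi) => x x0.
by rewrite FB_trans.
Qed.

(* Parseval against [h], whose transform is [s `^ (- (nu + 1)) * gq s^-1 k];
   multiplication by [y ^+ 2 / 2] on the Fourier side corresponds to [lapp]. *)
Lemma sqr_form_y f (h k : {poly R}) : lapT nu h = k -> lapT nu k = h ->
  l2 f -> intg (fun x => f x * wgt x) ->
  intg (fun y => y ^+ 2 * FB nu f y ^+ 2 * wgt y) ->
  2 * pair f (lapp nu h) - pair (gq s h) (lapp nu h) <=
  (2 * s)^-1 * Int (fun y => y ^+ 2 * FB nu f y ^+ 2 * wgt y).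
Proof.
move=> hk kh lf fi iy; have si0 : 0 < s^-1 by rewrite invr_gt0.
have lh := l2_gq hnu s0 h; have ih := intg_gq hnu h s0.
(* Only the occurrences of [h] under [lapp] become [lapT nu k], the form required by [FB_pair]. *)
rewrite -{1 3}kh -!FB_pair //; set S := s `^ (- (nu + 1)).
have i1 := intg_FB_gq ('X * k) si0 fi; have i2 := intg_FB_gq ('X * k) si0 ih.
have j1 := intgZ S i1; have j2 := intgZ S i2; have j3 := intgZ (2 * s)^-1 iy.
have j4 := intgZ 2 j1.
rewrite -subr_ge0 opprB -(IntZ S i1) -(IntZ S i2) -(IntZ 2 j1) -(IntZ _ iy).
rewrite addrCA -IntB // -IntD //; last exact: intgB.
apply: Int_ge0 => y y0; rewrite FB_gq // hk gq_mulX -/S.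
have -> : S * (S * gq s^-1 k y * (s^-1 / 2 * y ^+ 2 * gq s^-1 k y * wgt y)) +
   ((2 * s)^-1 * (y ^+ 2 * FB nu f y ^+ 2 * wgt y) -
    2 * (S * (FB nu f y * (s^-1 / 2 * y ^+ 2 * gq s^-1 k y * wgt y))))
   = (2 * s)^-1 * (y ^+ 2 * (FB nu f y - S * gq s^-1 k y) ^+ 2 * wgt y).
  by field; rewrite gt_eqF.
apply: mulr_ge0; first by rewrite invr_ge0 mulr_ge0 // ltW.
by rewrite mulr_ge0 ?wgt_ge0 // mulr_ge0 ?sqr_ge0.
Qed.

(** The Dirichlet form computed on the transform side, where [- Delta_nu] is multiplication by
    [y ^+ 2]: the result is visibly symmetric in [i] and [j]. *)
Lemma pair_lag_lapp i j : pair (gq s (L j)) (lapp nu (L i)) =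
  (-1) ^+ i * (-1) ^+ j * (s `^ (- (nu + 1))) ^+ 2 *
  Int (fun y => s^-1 / 2 * y ^+ 2 * (gq s^-1 (L i) y * gq s^-1 (L j) y) * wgt y).
Proof.
have si0 : 0 < s^-1 by rewrite invr_gt0.
have lj := l2_gq hnu s0 (L j); have ij := intg_gq hnu (L j) s0.
have := FB_pair (L i) lj ij; rewrite [lapT nu (L i)]lapT_lag lappZ.
set S := s `^ _; set W := Int (fun y => s^-1 / 2 * y ^+ 2 * _ * _).
rewrite pairZ //.
have -> : Int (fun y => FB nu (gq s (L j)) y * (gq s^-1 ('X * L i) y * wgt y)) =
    S * (-1) ^+ j * W.
  rewrite /W -IntZ; last first.
    apply: eq_intg (intg_gqM hnu ('X * L i) (L j) si0) => y y0.
    by rewrite gq_mulX; ring.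
  by apply: eq_Int => y y0; rewrite FB_gq // lapT_lag gqZ gq_mulX -/S; ring.
move=> /(congr1 (fun t => (-1) ^+ i * t)).
by rewrite [RHS]mulrA -expr2 sqrr_sign mul1r => <-; ring.
Qed.

(* [lapp] and multiplication by ['X] are both symmetric for the pairing, and [lag m],
   [lag n] are eigenvectors of their sum for different eigenvalues. *)
Lemma pair_lag_orth m n : m != n -> pair (gq s (L m)) (L n) = 0.
Proof.
move=> mn; have l i := l2_gq hnu s0 (L i).
have M : pair (gq s (L m)) (lapp nu (L n)) = pair (gq s (L n)) (lapp nu (L m)).
  rewrite 2!pair_lag_lapp [(-1) ^+ n * _]mulrC.
  set W1 := Int _; set W2 := Int _; have -> : W1 = W2; last by [].
  by apply: eq_Int => y _; rewrite [gq s^-1 (L n) y * _]mulrC.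
have X : pair (gq s (L m)) ('X * L n) = pair (gq s (L n)) ('X * L m).
  by apply: eq_Int => y _; rewrite !gq_mulX; ring.
have eig i j : pair (gq s (L i)) (lapp nu (L j)) + pair (gq s (L i)) ('X * L j) =
    (2 * j%:R + nu + 1) * pair (gq s (L i)) (L j).
  by rewrite -(pairD (lapp nu (L j)) ('X * L j) (l i)) lag_eigen mul_polyC pairZ.
have := eig m n; rewrite M X eig [pair (gq s (L n)) _]pair_sym => /eqP.
rewrite -subr_eq0 -mulrBl mulf_eq0 => /orP[|/eqP //].
have -> : 2 * m%:R + nu + 1 - (2 * n%:R + nu + 1) = 2 * (m%:R - n%:R) :> R by ring.
by rewrite mulf_eq0 pnatr_eq0 /= subr_eq0 eqr_nat (negPf mn).
Qed.

(* Add [sqr_form_x] and [sqr_form_y] with [h] the Laguerre partial sum of [f]. *)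
Lemma spectral_bound f N : l2 f -> intg (fun x => f x * wgt x) ->
  intg (fun x => x ^+ 2 * f x ^+ 2 * wgt x) ->
  intg (fun y => y ^+ 2 * FB nu f y ^+ 2 * wgt y) ->
  (nu + 1) * \sum_(n < N) pair f (L n) ^+ 2 / pair (gq s (L n)) (L n) <=
  s / 2 * Int (fun x => x ^+ 2 * f x ^+ 2 * wgt x) +
  (2 * s)^-1 * Int (fun y => y ^+ 2 * FB nu f y ^+ 2 * wgt y).
Proof.
move=> lf fi ix iy.
pose P n := pair f (L n); pose D n := pair (gq s (L n)) (L n).
pose c n := P n / D n.
pose h := \sum_(n < N) c n *: L n.
pose k := \sum_(n < N) ((-1) ^+ n * c n) *: L n.
have hk : lapT nu h = k.
  by rewrite lapT_sum; apply: eq_bigr => i _; rewrite lapTZ lapT_lag scalerA mulrC.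
have kh : lapT nu k = h.
  rewrite lapT_sum; apply: eq_bigr => i _; rewrite lapTZ lapT_lag scalerA.
  by rewrite mulrAC -expr2 sqrr_sign mul1r.
have := lerD (sqr_form_x h lf ix) (sqr_form_y hk kh lf fi iy).
apply: le_trans.
(* The eigenvalue in [lag_eigen]; this local name hides the Gaussian moment. It is at least
   [nu + 1], which is the constant of the bound. *)
pose moment n := 2 * n%:R + nu + 1.
have Kh : lapp nu h + 'X * h = \sum_(n < N) (c n * moment n) *: L n.
  rewrite lapp_sum mulr_sumr -big_split /=; apply: eq_bigr => i _.
  by rewrite lappZ -scalerAr -scalerDr lag_eigen mul_polyC scalerA.
have lh : l2 (gq s h) by exact: l2_gq.
have -> : 2 * pair f ('X * h) - pair (gq s h) ('X * h) +
    (2 * pair f (lapp nu h) - pair (gq s h) (lapp nu h)) =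
    2 * pair f (lapp nu h + 'X * h) - pair (gq s h) (lapp nu h + 'X * h).
  by rewrite !pairD //; ring.
rewrite Kh !(pair_sum _ (fun n => c n * moment n)) //.
have E n : (n < N)%N -> pair (gq s h) (L n) = c n * D n.
  move=> nN; rewrite pair_sym (pair_sum _ c); last exact: l2_gq.
  rewrite (bigD1 (Ordinal nN)) //= big1 ?addr0 // => i ni.
  by rewrite pair_lag_orth ?mulr0 // eq_sym.
rewrite !mulr_sumr -sumrB; apply: ler_sum => i _; rewrite E // -/(P i) -/(D i).
have D0 : 0 <= D i := pair_sqr_ge0 (L i).
have Q0 : 0 <= P i ^+ 2 / D i by rewrite divr_ge0 ?sqr_ge0.
have -> : 2 * (c i * moment i * P i) - c i * moment i * (c i * D i) = moment i * (P i ^+ 2 / D i).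
  (* As [x / 0 = 0], both sides vanish when [D i = 0]. *)
  rewrite /c; have [Di0|Dn0] := eqVneq (D i) 0; last by field.
  by rewrite Di0 invr0 !(mulr0, mul0r) subrr.
by rewrite ler_wpM2r // /moment -addrA lerDr mulr_ge0.
Qed.

(** The orthogonal projection is the best approximation: when no [D n] vanishes, the right side
    exceeds the left by the sum of [(P n - d n * D n)^2 / D n], where [d] are the Laguerre
    coefficients of [q]. *)
Lemma dist2_ge f q : l2 f -> exists N, Int (fun x => f x ^+ 2 * wgt x) <=
  dist2 nu f (gq s q) + \sum_(n < N) pair f (L n) ^+ 2 / pair (gq s (L n)) (L n).
Proof.
have [d] := lag_span nu (leqnn (size q)); move: (size q) => N qE lf; exists N.
have lq := l2_gq hnu s0 q; have [_ fi] := lf; have [_ qi] := lq.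
pose P n := pair f (L n); pose D n := pair (gq s (L n)) (L n).
have distE : dist2 nu f (gq s q) = Int (fun x => f x ^+ 2 * wgt x) - 2 * pair f q + pair (gq s q) q.
  have i2 := intgZ 2 (intg_pair q lf); have i3 := intg_pair q lq.
  rewrite /pair -IntZ ?intg_pair // -IntB // -IntD //; last exact: intgB.
  by apply: eq_Int => x _; ring.
have Pq : pair f q = \sum_(n < N) d n * P n by rewrite {1}qE pair_sum.
have Dq : pair (gq s q) q = \sum_(n < N) d n ^+ 2 * D n.
  rewrite {2}qE pair_sum //; apply: eq_bigr => i _.
  rewrite pair_sym {1}qE pair_sum; last exact: l2_gq.
  rewrite (bigD1 i) //= big1 ?addr0 ?expr2 ?mulrA // => j ji.
  by rewrite pair_lag_orth ?mulr0 // eq_sym.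
rewrite distE Pq Dq -!addrA lerDl mulr_sumr addrA addrC -sumrN -!big_split /=.
apply: sumr_ge0 => i _; rewrite -/(P i) -/(D i).
have D0 : 0 <= D i := pair_sqr_ge0 (L i).
have [Di0|Dn0] := eqVneq (D i) 0.
  by rewrite /P (pair_eq0 lf Di0) Di0 !(mulr0, expr0n, mul0r, oppr0, addr0).
have -> : P i ^+ 2 / D i + (- (2 * (d i * P i)) + d i ^+ 2 * D i) = (P i - d i * D i) ^+ 2 / D i.
  by field.
by rewrite divr_ge0 ?sqr_ge0.
Qed.

Lemma uncertainty_sum f : (forall x, 0 < x -> {for x, continuous f}) ->
  l2 f -> intg (fun x => f x * wgt x) ->
  intg (fun x => x ^+ 2 * f x ^+ 2 * wgt x) ->
  intg (fun y => y ^+ 2 * FB nu f y ^+ 2 * wgt y) ->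
  2 * (nu + 1) * Int (fun x => f x ^+ 2 * wgt x) <=
  s * Int (fun x => x ^+ 2 * f x ^+ 2 * wgt x) +
  s^-1 * Int (fun y => y ^+ 2 * FB nu f y ^+ 2 * wgt y).
Proof.
move=> cf lf fi ix iy; apply/ler_addgt0Pr => e e0.
have n1 := nu1_gt0 hnu.
have [_ H] := appr_continuous hnu s0 cf lf.
have [|q hq] := H (e / (2 * (nu + 1))); first by rewrite divr_gt0 // mulr_gt0.
have [N hN] := dist2_ge q lf.
have hS := spectral_bound N lf fi ix iy.
move: hq; rewrite ler_pdivlMr ?mulr_gt0 // => hq.
have si : (2 * s)^-1 = 2^-1 * s^-1 by rewrite invfM.
rewrite si in hS.
move: hN hS hq; set A := Int _; set B := Int _; set C := Int _; set S := \sum_(_ < _) _.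
move: (dist2 _ _ _) => Q hN hS hq.
have : 2 * (nu + 1) * A <= 2 * (nu + 1) * (Q + S) by rewrite ler_wpM2l // mulr_ge0 // ltW.
rewrite [2 * (nu + 1) * (Q + S)]mulrDr; lra.
Qed.

End Uncertainty.

(** * Complex-valued functions and the product inequality *)

Section LowerBound.
Variables (R : realType) (nu : R).
Hypothesis hnu : - (1 / 2) < nu.
Implicit Types (f : R -> R[i]) (g h : R -> R).
Local Notation wgt := (wgt nu).
Local Notation mu := (@lebesgue_measure R).

Lemma normc_sqr (z : R[i]) : Normc.normc z ^+ 2 = complex.Re z ^+ 2 + complex.Im z ^+ 2.
Proof. by case: z => u v /=; rewrite sqr_sqrtr // addr_ge0 ?sqr_ge0. Qed.

Lemma normc_ge0 (z : R[i]) : 0 <= Normc.normc z.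
Proof. by case: z => u v; exact: sqrtr_ge0. Qed.

Lemma normc_mulRe (c : R) (z : R[i]) :
  (complex.Re (c%:C%C * z) = c * complex.Re z) * (complex.Im (c%:C%C * z) = c * complex.Im z).
Proof. by case: z => u v /=; rewrite !mul0r subr0 addr0. Qed.

Lemma abs_re_le (z : R[i]) : `|complex.Re z| <= Normc.normc z.
Proof.
rewrite -(ler_pXn2r (n := 2)) ?nnegrE ?normc_ge0 // normc_sqr real_normK ?num_real //.
by rewrite lerDl sqr_ge0.
Qed.

Lemma abs_im_le (z : R[i]) : `|complex.Im z| <= Normc.normc z.
Proof.
rewrite -(ler_pXn2r (n := 2)) ?nnegrE ?normc_ge0 // normc_sqr real_normK ?num_real //.
by rewrite lerDr sqr_ge0.
Qed.

Lemma wintE g : intg (fun x => g x * wgt x) -> wint nu g = (Int (fun x => g x * wgt x))%:E.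
Proof. by move=> h; rewrite IntE. Qed.

Lemma measurable_normc f : measurable_fun (@Rpos R) (re f) ->
  measurable_fun (@Rpos R) (im f) ->
  measurable_fun (@Rpos R) (fun x => Normc.normc (f x)).
Proof.
move=> mr mi.
have -> : (fun x => Normc.normc (f x)) = (fun x => Num.sqrt (re f x ^+ 2 + im f x ^+ 2)).
  by apply/funext => x; rewrite -normc_sqr sqrtr_sqr ger0_norm ?normc_ge0.
apply: (measurableT_comp (continuous_measurable_fun (@sqrt_continuous R))).
by apply: measurable_funD; exact: measurable_funX.
Qed.

Lemma wint_intg g : (forall x, 0 < x -> 0 <= g x) -> measurable_fun (@Rpos R) g ->
  (wint nu g < +oo)%E -> intg (fun x => g x * wgt x).
Proof.
move=> g0 mg h; apply: ge0_intgP => //.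
  by move=> x x0; rewrite mulr_ge0 ?wgt_ge0 ?g0.
by apply: measurable_funM => //; exact: measurable_wgt.
Qed.

Lemma Lp1_intg f : Lp nu 1 f ->
  intg (fun x => re f x * wgt x) /\ intg (fun x => im f x * wgt x).
Proof.
move=> [mr mi h]; have mn := measurable_normc mr mi.
have i : intg (fun x => Normc.normc (f x) ^+ 1 * wgt x).
  by apply: wint_intg => // x _; rewrite expr1 normc_ge0.
have aux g : measurable_fun (@Rpos R) g -> (forall x, `|g x| <= Normc.normc (f x)) ->
    intg (fun x => g x * wgt x).
  move=> mg gf; apply: le_intg i; first by apply: measurable_funM => //; exact: measurable_wgt.
  by move=> x x0; rewrite expr1 normrM (ger0_norm (wgt_ge0 nu x)) ler_wpM2r ?wgt_ge0.
by split; apply: aux => // x; [exact: abs_re_le|exact: abs_im_le].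
Qed.

Lemma Lp2_intg f : Lp nu 2 f ->
  l2 nu (re f) /\ l2 nu (im f).
Proof.
move=> [mr mi h]; have mn := measurable_normc mr mi.
have i : intg (fun x => Normc.normc (f x) ^+ 2 * wgt x).
  apply: wint_intg => //; first by move=> x _; rewrite sqr_ge0.
  exact: measurable_funX.
have aux g : measurable_fun (@Rpos R) g -> (forall x, g x ^+ 2 <= Normc.normc (f x) ^+ 2) ->
    l2 nu g.
  move=> mg gf; split => //; apply: le_intg i; first exact: measurable_sqr_wgt.
  move=> x x0; rewrite normrM (ger0_norm (wgt_ge0 nu x)) ler_wpM2r ?wgt_ge0 //.
  by rewrite ger0_norm ?sqr_ge0.
by split; apply: aux => // x; rewrite normc_sqr ?lerDl ?lerDr sqr_ge0.
Qed.

Lemma realCn_continuous n g : realCn n g -> forall x, 0 < x -> {for x, continuous g}.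
Proof.
case: n => [|n] [dg cg] x x0; first exact: cg.
apply: differentiable_continuous; apply/derivable1_diffP.
by have := dg 0%N x isT x0.
Qed.

(** [s = sqrt (b / a)] makes the two terms equal. If [a = 0], then [s = (b + 1) / c] contradicts the
    hypothesis; if [b = 0], then [s = c / a] does. *)
Lemma product_bound (a b c : R) : 0 <= a -> 0 <= b -> 0 < c ->
  (forall s, 0 < s -> 2 * c <= s * a + s^-1 * b) -> c ^+ 2 <= a * b.
Proof.
move=> a0 b0 c0 H.
have [a00|an0] := eqVneq a 0.
  have t0 : 0 < (b + 1) / c by rewrite divr_gt0 // ltr_wpDl.
  have := H _ t0; rewrite a00 mulr0 add0r invf_div mulrAC ler_pdivlMr ?ltr_wpDl //; nra.
have [b00|bn0] := eqVneq b 0.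
  have ap : 0 < a by rewrite lt_def an0.
  have t0 : 0 < c / a by rewrite divr_gt0.
  have := H _ t0; rewrite b00 mulr0 addr0 divfK //; lra.
have ap : 0 < a by rewrite lt_def an0.
have bp : 0 < b by rewrite lt_def bn0.
pose r := Num.sqrt (b / a).
have r0 : 0 < r by rewrite sqrtr_gt0 divr_gt0.
have r2 : r ^+ 2 = b / a by rewrite sqr_sqrtr // divr_ge0.
have E : r^-1 * b = r * a.
  have -> : b = r ^+ 2 * a by rewrite r2 divfK.
  by field; rewrite gt_eqF.
have := H _ r0; rewrite E => h.
have h2 : c <= r * a by lra.
have -> : a * b = (r * a) ^+ 2 by rewrite exprMn r2; field.
by rewrite lerXn2r // nnegrE ?ltW // mulr_gt0.
Qed.

Section OneFunction.
Variable f : R -> R[i].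
Hypothesis af : admissible nu f.

Let sp : spaceS nu f. Proof. by case: af. Qed.
Let cr : forall x, 0 < x -> {for x, continuous (re f)}.
Proof. by case: sp => -[h _] _ _ _ _; exact: realCn_continuous h. Qed.
Let ci : forall x, 0 < x -> {for x, continuous (im f)}.
Proof. by case: sp => -[_ h] _ _ _ _; exact: realCn_continuous h. Qed.
Let L1 : Lp nu 1 f. Proof. by case: sp => _ []. Qed.
Let L2 : Lp nu 2 f. Proof. by case: sp => _ []. Qed.

Let norm1 : Int (fun x => re f x ^+ 2 * wgt x) + Int (fun x => im f x ^+ 2 * wgt x) = 1.
Proof.
have [[_ i1] [_ i2]] := Lp2_intg L2.
case: af => _ + _ _; rewrite /L2norm.
have i : intg (fun x => Normc.normc (f x) ^+ 2 * wgt x).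
  by apply: eq_intg (intgD i1 i2) => x _; rewrite normc_sqr mulrDl.
rewrite wintE //= -IntD // => h.
rewrite (_ : Int _ = Int (fun x => Normc.normc (f x) ^+ 2 * wgt x)); last first.
  by apply: eq_Int => x _; rewrite normc_sqr mulrDl.
move: h; set I := Int _ => h.
have I0 : 0 <= I by rewrite leNgt; apply/negP => In; move: h; rewrite ler0_sqrtr ?ltW // => /eqP; rewrite eq_sym oner_eq0.
by rewrite -[I]sqr_sqrtr // h expr1n.
Qed.

Let intg_x2 g : l2 nu g -> l2 nu (fun x => x ^+ 2 * g x) ->
  intg (fun x => x ^+ 2 * g x ^+ 2 * wgt x).
Proof.
move=> lg lxg; apply: eq_intg (l2M lxg lg) => x _; ring.
Qed.

Let A : R := Int (fun x => x ^+ 2 * re f x ^+ 2 * wgt x) +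
             Int (fun x => x ^+ 2 * im f x ^+ 2 * wgt x).

Let ix : intg (fun x => x ^+ 2 * re f x ^+ 2 * wgt x) /\
         intg (fun x => x ^+ 2 * im f x ^+ 2 * wgt x).
Proof.
have [lr li] := Lp2_intg L2; case: af => _ _ /Lp2_intg[xr xi] _.
have E (c : R -> R[i]) : re (fun x => (x ^+ 2)%:C%C * c x) = (fun x => x ^+ 2 * re c x).
  by apply/funext => x; rewrite /re normc_mulRe.
have E' (c : R -> R[i]) : im (fun x => (x ^+ 2)%:C%C * c x) = (fun x => x ^+ 2 * im c x).
  by apply/funext => x; rewrite /im normc_mulRe.
by rewrite E in xr; rewrite E' in xi; split; exact: intg_x2.
Qed.

Let AE : wint nu (fun x => x ^+ 2 * Normc.normc (f x) ^+ 2) = A%:E.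
Proof.
have [i1 i2] := ix.
have i : intg (fun x => x ^+ 2 * Normc.normc (f x) ^+ 2 * wgt x).
  by apply: eq_intg (intgD i1 i2) => x _; rewrite normc_sqr; ring.
rewrite (wintE i) /A -IntD //; congr EFin.
by apply: eq_Int => x _; rewrite normc_sqr; ring.
Qed.

(** If [A = 0] then [f] vanishes almost everywhere, against its norm 1. This excludes the product
    [0 * +oo], which is 0 by convention. *)
Let A_neq0 : A != 0.
Proof.
apply/negP => /eqP A0; have [i1 i2] := ix.
have [[mr j1] [mi j2]] := Lp2_intg L2.
have aux (g : R -> R) : intg (fun x => x ^+ 2 * g x ^+ 2 * wgt x) ->
    Int (fun x => x ^+ 2 * g x ^+ 2 * wgt x) = 0 ->
    intg (fun x => g x ^+ 2 * wgt x) -> Int (fun x => g x ^+ 2 * wgt x) = 0.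
  move=> xg xg0 gg.
  pose F := EFin \o (fun x => x ^+ 2 * g x ^+ 2 * wgt x).
  pose G := EFin \o (fun x => g x ^+ 2 * wgt x).
  have mF : measurable_fun (@Rpos R) F by apply/measurable_EFinP; exact: intg_measurable.
  have mG : measurable_fun (@Rpos R) G by apply/measurable_EFinP; exact: intg_measurable.
  have I0 : (\int[mu]_(x in @Rpos R) `|F x|)%E = 0%E.
    rewrite -[RHS]/(0%R%:E) -xg0 IntE //; apply: eq_integral => x _.
    by rewrite /F /= ger0_norm // mulr_ge0 ?wgt_ge0 // mulr_ge0 ?sqr_ge0.
  have := (@ae_eq_integral_abs _ _ R mu (@Rpos R) (@measurable_Rpos R) F mF).1 I0 => ae1.
  have ae2 : ae_eq mu (@Rpos R) G (cst 0%E).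
    apply: filterS ae1 => x /= h Dx; have := h Dx; have x0 := Rpos_gt0 Dx.
    rewrite /F /G /= => -[] /eqP; rewrite -mulrA mulf_eq0 expf_eq0 /= gt_eqF //=.
    by move=> /eqP ->.
  have E : (\int[mu]_(x in @Rpos R) G x = \int[mu]_(x in @Rpos R) (cst 0 x))%E.
    by apply: (@ae_eq_integral _ _ R mu (@Rpos R) (cst 0%E) G) => //; exact: measurable_Rpos.
  by rewrite -[LHS]/(fine (\int[mu]_(x in @Rpos R) G x)%E) E integral0.
have p1 : 0 <= Int (fun x => x ^+ 2 * re f x ^+ 2 * wgt x).
  by apply: Int_ge0 => x _; rewrite mulr_ge0 ?wgt_ge0 // mulr_ge0 ?sqr_ge0.
have p2 : 0 <= Int (fun x => x ^+ 2 * im f x ^+ 2 * wgt x).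
  by apply: Int_ge0 => x _; rewrite mulr_ge0 ?wgt_ge0 // mulr_ge0 ?sqr_ge0.
have q1 : Int (fun x => x ^+ 2 * re f x ^+ 2 * wgt x) = 0 by move: A0; rewrite /A; lra.
have q2 : Int (fun x => x ^+ 2 * im f x ^+ 2 * wgt x) = 0 by move: A0; rewrite /A; lra.
by move: norm1; rewrite !aux // addr0 => /eqP; rewrite eq_sym oner_eq0.
Qed.

Lemma lower_bound : (((nu + 1) ^+ 2)%:E <= Jfun nu f)%E.
Proof.
have [f1 f2] := Lp1_intg L1; have [l1 l2] := Lp2_intg L2; have [i1 i2] := ix.
have A0 : 0 <= A.
  by rewrite addr_ge0 //; apply: Int_ge0 => x _; rewrite mulr_ge0 ?wgt_ge0 // mulr_ge0 ?sqr_ge0.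
rewrite /Jfun AE; set B := wint _ _.
have B0 : (0 <= B)%E.
  apply: integral_ge0 => y /Rpos_gt0 y0; rewrite lee_fin mulr_ge0 ?powR_ge0 //.
  by rewrite mulr_ge0 ?sqr_ge0.
have normF y : Normc.normc (FourierBessel nu f y) ^+ 2 =
   FB nu (re f) y ^+ 2 + FB nu (im f) y ^+ 2 by rewrite normc_sqr.
have m1 := FB_measurable hnu f1; have m2 := FB_measurable hnu f2.
(* If the Fourier integral diverges, the product is [+oo] because [A > 0]. *)
have [Bfin|] := boolP (B \is a fin_num); last first.
  rewrite ge0_fin_numE // -leNgt leye_eq => /eqP ->.
  by rewrite gt0_muley ?leey // lte_fin lt_def A_neq0.
have mF : measurable_fun (@Rpos R) (fun y => y ^+ 2 * (FB nu (re f) y ^+ 2 + FB nu (im f) y ^+ 2)).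
  apply: measurable_funM; first by apply: measurable_funX; exact: measurable_id.
  by apply: measurable_funD; exact: measurable_funX.
have BE : B = wint nu (fun y => y ^+ 2 * (FB nu (re f) y ^+ 2 + FB nu (im f) y ^+ 2)).
  by apply: eq_integral => y _; rewrite normF.
have iB : intg (fun y => y ^+ 2 * (FB nu (re f) y ^+ 2 + FB nu (im f) y ^+ 2) * wgt y).
  apply: wint_intg => //.
    by move=> y _; rewrite mulr_ge0 ?addr_ge0 ?sqr_ge0.
  by rewrite -BE -ge0_fin_numE.
have my (g : R -> R) : measurable_fun (@Rpos R) g ->
    measurable_fun (@Rpos R) (fun y => y ^+ 2 * g y ^+ 2 * wgt y).
  move=> mg; apply: measurable_funM; last exact: measurable_wgt.
  apply: measurable_funM; last exact: measurable_funX.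
  by apply: measurable_funX; exact: measurable_id.
have iy1 : intg (fun y => y ^+ 2 * FB nu (re f) y ^+ 2 * wgt y).
  apply: le_intg iB; first exact: my.
  move=> y y0; rewrite ger0_norm; last by rewrite mulr_ge0 ?wgt_ge0 // mulr_ge0 ?sqr_ge0.
  by rewrite ler_wpM2r ?wgt_ge0 // ler_wpM2l ?sqr_ge0 // lerDl sqr_ge0.
have iy2 : intg (fun y => y ^+ 2 * FB nu (im f) y ^+ 2 * wgt y).
  apply: le_intg iB; first exact: my.
  move=> y y0; rewrite ger0_norm; last by rewrite mulr_ge0 ?wgt_ge0 // mulr_ge0 ?sqr_ge0.
  by rewrite ler_wpM2r ?wgt_ge0 // ler_wpM2l ?sqr_ge0 // lerDr sqr_ge0.
rewrite BE wintE // -EFinM lee_fin.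
have -> : Int (fun y => y ^+ 2 * (FB nu (re f) y ^+ 2 + FB nu (im f) y ^+ 2) * wgt y) =
   Int (fun y => y ^+ 2 * FB nu (re f) y ^+ 2 * wgt y) +
   Int (fun y => y ^+ 2 * FB nu (im f) y ^+ 2 * wgt y).
  by rewrite -IntD //; apply: eq_Int => y _; ring.
apply: product_bound => //.
- by rewrite addr_ge0 //; apply: Int_ge0 => x _; rewrite mulr_ge0 ?wgt_ge0 // mulr_ge0 ?sqr_ge0.
- exact: nu1_gt0.
(* The kernel is real, so real and imaginary parts satisfy the inequality separately. They are added
   at a common [s], before optimising, because only the sum of their squared norms is known. *)
- move=> s s0.
  have u1 := uncertainty_sum hnu s0 cr l1 f1 i1 iy1.
  have u2 := uncertainty_sum hnu s0 ci l2 f2 i2 iy2.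
  rewrite /A [s * _]mulrDr [s^-1 * _]mulrDr addrACA; apply: le_trans (lerD u1 u2).
  by rewrite -mulrDr norm1 mulr1.
Qed.

End OneFunction.
End LowerBound.

(** * Extremality of the Gaussians *)

Section PolyGaussian.
Variables (R : realType) (nu s : R).
Hypothesis hnu : - (1 / 2) < nu.
Hypothesis s0 : 0 < s.
Implicit Types (f : R -> R[i]) (g h : R -> R) (P q : {poly R}) (x : R).
Local Notation wgt := (wgt nu).

(** A polynomial in [x] itself: [gq] gives only even functions, which [d/dx] does not preserve. *)
Definition pgauss P x : R := P.[x] * expR (- (s / 2 * x ^+ 2)).

Definition pgaussD P : {poly R} := P^`() - s *: ('X * P).

Lemma is_derive_pgauss P x : is_derive x (1 : R) (pgauss P) (pgauss (pgaussD P) x).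
Proof.
have dz : is_derive x (1 : R) (fun x : R => - (s / 2 * x ^+ 2)) (- (s * x)).
  have -> : (fun x : R => - (s / 2 * x ^+ 2)) = - ((s / 2) *: ((id : R -> R) ^+ 2)).
    by apply/funext.
  by apply: is_derive_eq; rewrite /GRing.scale /= expr1; lra.
have de : is_derive x (1 : R) (fun x => expR (- (s / 2 * x ^+ 2)))
    (expR (- (s / 2 * x ^+ 2)) * (- (s * x))).
  exact: (is_derive1_comp (is_derive_expR _) dz).
have dp := is_derive_poly P x.
have d := is_deriveM dp de.
apply: (is_derive_eq d).
rewrite /pgauss /pgaussD !hornerE /GRing.scale /=; ring.
Qed.

Lemma continuous_pgauss P : continuous (pgauss P).
Proof.
move=> x; apply: differentiable_continuous; apply/derivable1_diffP.
by have [] := is_derive_pgauss P x.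
Qed.

Lemma derive_eq_Rpos g h x : (forall x, 0 < x -> g x = h x) -> 0 < x ->
  derivable h x 1 -> derivable g x 1 /\ derive1 g x = derive1 h x.
Proof.
move=> gh x0 dh.
have near_gh : \forall y \near x, g y = h y.
  by near=> y; apply: gh; near: y; exact: lt_nbhsr.
split.
  apply: near_eq_derivable dh => //.
  by apply: filterS near_gh => y ->.
by rewrite !derive1E; apply: near_eq_derive.
Unshelve. all: by end_near. Qed.

Lemma derive1n_pgauss n g P : (forall x, 0 < x -> g x = pgauss P x) ->
  forall x, 0 < x -> derive1n n g x = pgauss (iter n pgaussD P) x.
Proof.
move=> gP; elim: n => [//|n IH] x x0; rewrite derive1nS.
have d := is_derive_pgauss (iter n pgaussD P) x; have [d1 d2] := d.
have [_ ->] := derive_eq_Rpos IH x0 d1.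
by rewrite derive1E d2.
Qed.

Lemma realCn_pgauss n g P : (forall x, 0 < x -> g x = pgauss P x) -> realCn n g.
Proof.
move=> gP; split => [j x _ x0|x x0].
  have [d1 _] := is_derive_pgauss (iter j pgaussD P) x.
  by have [] := derive_eq_Rpos (derive1n_pgauss j gP) x0 d1.
have [d1 _] := is_derive_pgauss (iter n pgaussD P) x.
have [d _] := derive_eq_Rpos (derive1n_pgauss n gP) x0 d1.
by apply: differentiable_continuous; apply/derivable1_diffP.
Qed.

Lemma gq_pgauss q x : gq s q x = pgauss (q \Po ((s / 2) *: 'X^2)) x.
Proof. by rewrite /gq /pgauss horner_comp hornerZ hornerXn. Qed.

(** Stable under [Delta nu] and [x ^+ 2], so that membership in [spaceS] follows for all orders [k]
    at once. *)
Definition is_gq f := exists q, forall x, 0 < x ->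
  complex.Re (f x) = gq s q x /\ complex.Im (f x) = 0.

Lemma pgauss0 x : pgauss 0 x = 0. Proof. by rewrite /pgauss horner0 mul0r. Qed.

Lemma is_gq_pgauss f : is_gq f -> exists P, (forall x, 0 < x -> re f x = pgauss P x) /\
  (forall x, 0 < x -> im f x = pgauss 0 x).
Proof.
move=> [q fq]; exists (q \Po ((s / 2) *: 'X^2)).
by split=> x x0; have [h1 h2] := fq x x0; rewrite ?pgauss0 // /re h1 gq_pgauss.
Qed.

Lemma bounded_near0_pgauss f P Q : (forall x, 0 < x -> re f x = pgauss P x) ->
  (forall x, 0 < x -> im f x = pgauss Q x) -> bounded_near0 f.
Proof.
move=> rP iQ; exists (`|pgauss P 0| + 1 + (`|pgauss Q 0| + 1)).
have near1 (T : {poly R}) : \forall x \near 0^'+, `|pgauss T x| <= `|pgauss T 0| + 1.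
  have := cvg_at_right_filter (@continuous_pgauss T 0) => /cvgrPdist_le/(_ _ ltr01).
  apply: filterS => x h; have := ler_normB (pgauss T x - pgauss T 0) (- pgauss T 0).
  rewrite opprK subrK normrN distrC; lra.
near=> x.
have x0 : 0 < x by near: x; exact: nbhs_right_gt.
have h1 : `|pgauss P x| <= `|pgauss P 0| + 1 by near: x; exact: near1.
have h2 : `|pgauss Q x| <= `|pgauss Q 0| + 1 by near: x; exact: near1.
apply: (@le_trans _ _ (`|pgauss P x| + `|pgauss Q x|)); last exact: lerD.
rewrite -(ler_pXn2r (n := 2)) ?nnegrE ?normc_ge0 ?addr_ge0 // normc_sqr.
have -> : complex.Re (f x) = pgauss P x by rewrite -rP.
have -> : complex.Im (f x) = pgauss Q x by rewrite -iQ.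
rewrite -(real_normK (num_real (pgauss P x))) -(real_normK (num_real (pgauss Q x))).
by rewrite sqrrD [leRHS]addrAC lerDl mulrn_wge0 // mulr_ge0.
Unshelve. all: by end_near. Qed.

Lemma Lp_real f g p : (forall x, 0 < x -> complex.Re (f x) = g x /\ complex.Im (f x) = 0) ->
  measurable_fun (@Rpos R) g -> intg (fun x => `|g x| ^+ p * wgt x) -> Lp nu p f.
Proof.
move=> fg mg ig; split.
- by apply: eq_measurable_fun mg => x; rewrite RposE => /fg[].
- apply: eq_measurable_fun (measurable_cst (0 : R)) => x.
  by rewrite RposE => /fg[].
- rewrite /wint; have := Int_lty ig; apply: le_lt_trans.
  rewrite le_eqVlt; apply/orP; left; apply/eqP; apply: eq_integral => x.
  rewrite RposE => /fg; case: (f x) => u v /= -[-> ->].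
  by rewrite expr0n addr0 sqrtr_sqr.
Qed.

Lemma measurable_gq q : measurable_fun (@Rpos R) (gq s q).
Proof. by apply: continuous_measurable_Rpos => x _; exact: continuous_gq. Qed.

Lemma intg_abs_gq q : intg (fun x => `|gq s q x| * wgt x).
Proof.
apply: eq_intg (intg_abs (intg_gq hnu q s0)) => x _.
by rewrite normrM (ger0_norm (wgt_ge0 nu x)).
Qed.

Lemma is_gq_Lp1 f : is_gq f -> Lp nu 1 f.
Proof.
move=> [q fq]; apply: (Lp_real fq); first exact: measurable_gq.
exact: intg_abs_gq.
Qed.

Lemma is_gq_Lp2 f : is_gq f -> Lp nu 2 f.
Proof.
move=> [q fq]; apply: (Lp_real fq); first exact: measurable_gq.
apply: eq_intg (intg_gqM hnu q q s0) => x _.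
by rewrite real_normK ?num_real // expr2.
Qed.

Lemma cderive1n_pgauss n f P Q : (forall x, 0 < x -> re f x = pgauss P x) ->
  (forall x, 0 < x -> im f x = pgauss Q x) ->
  (forall x, 0 < x -> re (cderive1n n f) x = pgauss (iter n pgaussD P) x) /\
  (forall x, 0 < x -> im (cderive1n n f) x = pgauss (iter n pgaussD Q) x).
Proof. by move=> rP iQ; split; [exact: (derive1n_pgauss n rP)|exact: (derive1n_pgauss n iQ)]. Qed.

Lemma pgaussD0 : pgaussD 0 = 0.
Proof. by rewrite /pgaussD poly.derivC mulr0 scaler0 subr0. Qed.

Lemma iter_pgaussD0 n : iter n pgaussD 0 = 0.
Proof. by elim: n => [//|n IH]; rewrite iterS IH pgaussD0. Qed.

Lemma pgaussD_comp q : pgaussD (q \Po ((s / 2) *: 'X^2)) =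
  s *: ('X * ((q^`() - q) \Po ((s / 2) *: 'X^2))).
Proof.
have dphi : ((s / 2) *: 'X^2)^`() = s *: 'X :> {poly R}.
  by rewrite derivZ derivXn /= expr1 -scalerMnr scalerMnl -mulr_natr divfK // pnatr_eq0.
by rewrite /pgaussD deriv_comp dphi comp_polyB -!mul_polyC; ring.
Qed.

(** The odd factor [x] cancels the [1 / x] in [Delta]; this is why [Delta] preserves [is_gq]. *)
Lemma pgauss_derive_gq q x : pgauss (pgaussD (q \Po ((s / 2) *: 'X^2))) x =
  s * x * gq s (q^`() - q) x.
Proof.
rewrite pgaussD_comp /pgauss /gq hornerZ hornerM hornerX horner_comp hornerZ hornerXn; ring.
Qed.

Lemma pgauss_derive2_gq q x (r := q^`() - q) :
  pgauss (iter 2 pgaussD (q \Po ((s / 2) *: 'X^2))) x =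
  gq s (s *: r + (2 * s) *: ('X * (r^`() - r))) x.
Proof.
rewrite /= pgaussD_comp -/r.
have -> : pgaussD (s *: ('X * (r \Po ((s / 2) *: 'X^2)))) =
   s *: ((r \Po ((s / 2) *: 'X^2)) + 'X * pgaussD (r \Po ((s / 2) *: 'X^2))).
  by rewrite /pgaussD derivZ derivM derivX -!mul_polyC; ring.
rewrite pgaussD_comp /pgauss /gq.
rewrite !(hornerZ, hornerM, hornerD, hornerX, horner_comp, hornerXn).
by field.
Qed.

Lemma is_gq_Delta f : is_gq f -> is_gq (Delta nu f).
Proof.
move=> [q fq]; pose r := q^`() - q.
exists (s *: r + (2 * s) *: ('X * (r^`() - r)) + ((2 * nu + 1) * s) *: r) => x x0.
have rP y : 0 < y -> re f y = pgauss (q \Po ((s / 2) *: 'X^2)) y.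
  by move=> y0; rewrite -gq_pgauss; case: (fq y y0).
have iP y : 0 < y -> im f y = pgauss 0 y by move=> y0; rewrite pgauss0; case: (fq y y0).
have [r2 i2] := cderive1n_pgauss 2 rP iP.
have [r1 i1] := cderive1n_pgauss 1 rP iP.
have := r2 x x0; have := i2 x x0; have := r1 x x0; have := i1 x x0.
rewrite [iter 1 _ _]/= pgauss_derive_gq pgauss_derive2_gq -/r !iter_pgaussD0 pgaussD0 !pgauss0.
rewrite /re /im /Delta; case: (cderive1n 2 f x) => a b; case: (cderive1n 1 f x) => c d /=.
move=> -> -> -> ->; rewrite !(mul0r, mulr0, subr0, addr0); split => //.
by rewrite !(gqD, gqZ); field; rewrite gt_eqF.
Qed.

Lemma is_gq_iter j f : is_gq f -> is_gq (iter j (Delta nu) f).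
Proof. by move=> h; elim: j => [//|j IH]; exact: is_gq_Delta. Qed.

(** The derivative [s * x * gq s r x] leaves the family, but [x <= 1 + x ^+ 2] bounds it by two
    members of it. *)
Lemma is_gq_Lp1_derive f : is_gq f -> Lp nu 1 (cderive1n 1 f).
Proof.
move=> [q fq]; pose r := q^`() - q.
have rP y : 0 < y -> re f y = pgauss (q \Po ((s / 2) *: 'X^2)) y.
  by move=> y0; rewrite -gq_pgauss; case: (fq y y0).
have iP y : 0 < y -> im f y = pgauss 0 y by move=> y0; rewrite pgauss0; case: (fq y y0).
have [r1 i1] := cderive1n_pgauss 1 rP iP.
have mg : measurable_fun (@Rpos R) (fun x => s * x * gq s r x).
  apply: measurable_funM; last exact: measurable_gq.
  by apply: measurable_funM => //; exact: measurable_id.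
apply: (@Lp_real _ (fun x => s * x * gq s r x)) => //.
  move=> x x0; have := r1 x x0; have := i1 x x0.
  by rewrite [iter 1 _ _]/= pgauss_derive_gq pgaussD0 pgauss0 => h1 h2; split.
have ig := intgD (intg_abs_gq r) (intg_abs_gq ((2 / s) *: ('X * r))).
apply: le_intg (intgZ s ig).
  apply: measurable_funM; last exact: measurable_wgt.
  by apply: measurable_funX; exact: measurableT_comp.
move=> x x0; rewrite expr1 normrM normr_id (ger0_norm (wgt_ge0 nu x)) -mulrDl mulrA.
rewrite ler_wpM2r ?wgt_ge0 //.
have -> : gq s ((2 / s) *: ('X * r)) x = x ^+ 2 * gq s r x.
  by rewrite gqZ /gq hornerM hornerX; field; rewrite gt_eqF.
rewrite (normrM (s * x)) (normrM (x ^+ 2)) (ger0_norm (sqr_ge0 x)).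
rewrite (ger0_norm (mulr_ge0 (ltW s0) (ltW x0))) -mulrA ler_wpM2l ?(ltW s0) //.
rewrite -[X in _ <= X + _]mul1r -mulrDl ler_wpM2r //.
by have := sqr_ge0 (x - 1); have := sqr_ge0 x; nra.
Qed.

Lemma is_gq_spaceS f : is_gq f -> spaceS nu f.
Proof.
move=> h; have [P [rP iP]] := is_gq_pgauss h; rewrite /spaceS; split.
- by split; [exact: (realCn_pgauss _ rP)|exact: (realCn_pgauss _ iP)].
- by split; [exact: is_gq_Lp1|exact: is_gq_Lp2].
- by move=> j _; apply: is_gq_Lp1; exact: is_gq_iter.
- by move=> j _; apply: is_gq_Lp1_derive; exact: is_gq_iter.
- move=> j _; have [rj ij] := cderive1n_pgauss j rP iP; exact: bounded_near0_pgauss rj ij.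
Qed.

Lemma is_gq_mulsqr f : is_gq f -> is_gq (fun x => (x ^+ 2)%:C%C * f x).
Proof.
move=> [q fq]; exists ((2 / s) *: ('X * q)) => x x0; have [h1 h2] := fq x x0.
rewrite !normc_mulRe h1 h2 mulr0; split => //.
by rewrite gqZ /gq hornerM hornerX; field; rewrite gt_eqF.
Qed.

Lemma is_gq_admissible f : is_gq f -> L2norm nu f = 1 -> admissible nu f.
Proof.
move=> h n1; split => //; first exact: is_gq_spaceS.
  by apply: is_gq_Lp2; exact: is_gq_mulsqr.
by apply: is_gq_spaceS; exact: is_gq_Delta.
Qed.

End PolyGaussian.

(** * The value of the functional at the Gaussians *)

Section Extremal.
Variables (R : realType) (nu : R).
Hypothesis hnu : - (1 / 2) < nu.
Implicit Types (s c x y alpha : R).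
Local Notation wgt := (wgt nu).

Lemma moment1 : moment nu 1 = Gamma (nu + 1).
Proof. by rewrite /moment size_poly1 big_ord1 coef1 mul1r add0r. Qed.

Lemma momentX : moment nu 'X = (nu + 1) * Gamma (nu + 1).
Proof.
rewrite /moment size_polyX !big_ord_recl big_ord0 !coefX /= mul0r add0r addr0 mul1r.
transitivity (Gamma (nu + 1 + 1)); last exact: GammaS (nu1_gt0 hnu).
have -> : (bump 0 0)%:R = 1 :> R by [].
by rewrite [1 + nu]addrC.
Qed.

Lemma gq1_sqr s x : gq s 1 x ^+ 2 = gq (2 * s) 1 x.
Proof. by rewrite expr2 gqM mulr1 comp_polyC. Qed.

Lemma wint_gq1_sqr s c : 0 < s ->
  wint nu (fun x => (c * gq s 1 x) ^+ 2) = (c ^+ 2 * (mcst nu (2 * s) * Gamma (nu + 1)))%:E.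
Proof.
move=> s0; have s20 : 0 < 2 * s by rewrite mulr_gt0.
have E x : (c * gq s 1 x) ^+ 2 * wgt x = c ^+ 2 * (gq (2 * s) 1 x * wgt x).
  by rewrite exprMn gq1_sqr mulrA.
have i := intgZ (c ^+ 2) (intg_gq hnu 1 s20).
rewrite wintE; last by apply: eq_intg i => x _; rewrite E.
rewrite (@eq_Int _ _ (fun x => c ^+ 2 * (gq (2 * s) 1 x * wgt x))) => [|x _]; last exact: E.
by rewrite IntZ ?intg_gq // Int_gq // moment1.
Qed.

Lemma wint_x2gq1_sqr s c : 0 < s ->
  wint nu (fun x => x ^+ 2 * (c * gq s 1 x) ^+ 2) =
  (c ^+ 2 * (mcst nu (2 * s) * Gamma (nu + 1)) * ((nu + 1) / s))%:E.
Proof.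
move=> s0; have s20 : 0 < 2 * s by rewrite mulr_gt0.
have E x : x ^+ 2 * (c * gq s 1 x) ^+ 2 * wgt x = c ^+ 2 / s * (gq (2 * s) 'X x * wgt x).
  have -> : gq (2 * s) 'X x = s * x ^+ 2 * gq (2 * s) 1 x.
    by rewrite -['X]mulr1 gq_mulX; field.
  by rewrite exprMn gq1_sqr; field; rewrite gt_eqF.
have i := intgZ (c ^+ 2 / s) (intg_gq hnu 'X s20).
rewrite wintE; last by apply: eq_intg i => x _; rewrite E.
rewrite (@eq_Int _ _ (fun x => c ^+ 2 / s * (gq (2 * s) 'X x * wgt x))) => [|x _]; last exact: E.
rewrite IntZ ?intg_gq // Int_gq // momentX; congr EFin; field; rewrite gt_eqF //.
Qed.

Lemma mcst_double s : 0 < s -> mcst nu (2 * s) = s `^ (- (nu + 1)) / 2.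
Proof.
move=> s0; rewrite /mcst; have -> : 2 * s / 2 = s by field.
rewrite opprD powRD; last by rewrite (gt_eqF s0) implybT.
by rewrite powR_inv1 ?(ltW s0) //; field; rewrite gt_eqF.
Qed.

Section Scale.
Variable alpha : R.
Hypothesis alpha0 : 0 < alpha.

Let s := alpha ^+ 2.
Let f0 := dilation nu alpha (normalize nu (@gaussian R)).
Let c := alpha `^ (nu + 1) * (L2norm nu (@gaussian R))^-1.

Let s0 : 0 < s. Proof. by rewrite exprn_gt0. Qed.

Let f0E x : complex.Re (f0 x) = c * gq s 1 x /\ complex.Im (f0 x) = 0.
Proof.
rewrite /f0 /dilation /normalize !normc_mulRe /gaussian /= !mulr0; split => //.
have h1 (z : R) : (1 : {poly R}).[z] = 1 by rewrite hornerE.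
rewrite /gq h1 mul1r /c mulrA; congr (_ * expR (- _)).
by rewrite /s exprMn; ring.
Qed.

Lemma L2norm_gaussian : L2norm nu (@gaussian R) ^+ 2 = Gamma (nu + 1) / 2.
Proof.
have one : (0 : R) < 1 by [].
rewrite /L2norm.
have -> : wint nu (fun x => Normc.normc (@gaussian R x) ^+ 2) = wint nu (fun x => (1 * gq 1 1 x) ^+ 2).
  apply: eq_integral => x _; congr (_ * _)%:E.
  have h1 (z : R) : (1 : {poly R}).[z] = 1 by rewrite hornerE.
  by rewrite normc_sqr /gaussian /= expr0n addr0 mul1r /gq h1 mul1r; congr (expR (- _) ^+ 2); ring.
rewrite wint_gq1_sqr // mcst_double // powR1 expr1n !mul1r /=.
have G0 := Gamma_gt0 (nu1_gt0 hnu).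
by rewrite sqr_sqrtr mulrC // mulr_ge0 ?invr_ge0 // ltW.
Qed.

Let c2 : c ^+ 2 * (mcst nu (2 * s) * Gamma (nu + 1)) = 1.
Proof.
have G0 := Gamma_gt0 (nu1_gt0 hnu).
rewrite mcst_double // /c exprMn exprVn L2norm_gaussian.
have -> : s `^ (- (nu + 1)) = (alpha `^ (nu + 1)) ^- 2.
  rewrite powRN; congr (_^-1).
  rewrite -(powR_mulrn 2 (powR_ge0 alpha (nu + 1))) powRAC.
  by rewrite (powR_mulrn 2 (ltW alpha0)).
by field; rewrite !gt_eqF ?powR_gt0.
Qed.

Let normf0 x : Normc.normc (f0 x) ^+ 2 = (c * gq s 1 x) ^+ 2.
Proof. by have [h1 h2] := f0E x; rewrite normc_sqr h1 h2 expr0n addr0. Qed.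

Lemma gaussian_admissible : admissible nu f0.
Proof.
apply: (is_gq_admissible hnu s0).
  exists (c%:P) => x _; have [-> ->] := f0E x; split => //.
  by rewrite -[c%:P]mulr1 mul_polyC gqZ.
rewrite /L2norm (_ : wint _ _ = wint nu (fun x => (c * gq s 1 x) ^+ 2)).
  by rewrite wint_gq1_sqr // c2 sqrtr1.
by apply: eq_integral => x _; rewrite normf0.
Qed.

(** The transform of [f0] is the normalized Gaussian of parameter [s^-1], so the two factors are
    [(nu + 1) / s] and [(nu + 1) * s]. *)
Lemma gaussian_Jfun : Jfun nu f0 = ((nu + 1) ^+ 2)%:E.
Proof.
have si0 : 0 < s^-1 by rewrite invr_gt0.
rewrite /Jfun.
rewrite (_ : wint nu (fun x => _ * Normc.normc (f0 x) ^+ 2) =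
   wint nu (fun x => x ^+ 2 * (c * gq s 1 x) ^+ 2)); last first.
  by apply: eq_integral => x _; rewrite normf0.
pose S := s `^ (- (nu + 1)).
have FE y : 0 < y -> Normc.normc (FourierBessel nu f0 y) ^+ 2 = (c * S * gq s^-1 1 y) ^+ 2.
  move=> y0; rewrite normc_sqr.
  have -> : complex.Re (FourierBessel nu f0 y) = c * S * gq s^-1 1 y.
    transitivity (FB nu (gq s c%:P) y).
      apply: eq_Int => x x0; congr (_ * _ * _).
      by rewrite /re (f0E x).1 -[c%:P]mulr1 mul_polyC gqZ.
    rewrite FB_gq // -[c%:P]mulr1 mul_polyC lapTZ gqZ -(expr0 'X) lapT_Xn lagp0.
    by rewrite /S; ring.
  have -> : complex.Im (FourierBessel nu f0 y) = 0.
    transitivity (Int (fun _ : R => 0)); last by rewrite /Int /Rintegral integral0.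
    by apply: eq_Int => x x0; rewrite /im (f0E x).2 mulr0 mul0r.
  by rewrite expr0n addr0.
rewrite (_ : wint nu (fun y => _ * Normc.normc (FourierBessel nu f0 y) ^+ 2) =
   wint nu (fun y => y ^+ 2 * (c * S * gq s^-1 1 y) ^+ 2)); last first.
  by apply: eq_integral => y; rewrite RposE => y0; rewrite FE.
rewrite !wint_x2gq1_sqr // c2 -EFinM; congr EFin.
have -> : (c * S) ^+ 2 * (mcst nu (2 * s^-1) * Gamma (nu + 1)) = 1.
  rewrite -[RHS]c2 (mcst_double s0) (mcst_double si0) -/S.
  have -> : s^-1 `^ (- (nu + 1)) = S^-1.
    by rewrite -[s^-1]powR_inv1 ?(ltW s0) // powRAC powR_inv1 // powR_ge0.
  by field; rewrite gt_eqF // powR_gt0.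
by field; rewrite gt_eqF.
Qed.

End Scale.
End Extremal.

Theorem theorem8p1 (R : realType) (nu : R) (hnu : - (1 / 2) < nu) :
  (forall f : R -> R[i], admissible nu f -> (((nu + 1) ^+ 2)%:E <= Jfun nu f)%E) /\
  (forall alpha : R, 0 < alpha ->
     admissible nu (dilation nu alpha (normalize nu gaussian)) /\
     Jfun nu (dilation nu alpha (normalize nu gaussian)) = ((nu + 1) ^+ 2)%:E).
Proof.
split=> [f af|alpha alpha0]; first exact: lower_bound.
by split; [exact: gaussian_admissible|exact: gaussian_Jfun].
Qed.
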